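(* Let $k$ be a perfect field and let $\mathcal{H}$ be a (non-weighted) noncommutative regular projective curve over $k$. For each point $x\in\mathbb{X}$ the full subcategory $\mathcal{U}_x$ of skyscraper sheaves concentrated in $x$ is equivalent to the category of finite length modules over the skew power series ring $\mathrm{End}(S_x)[[T,\tau^-]]$. Here the twist $\tau^-$, with $Tf=\tau^-(f)T$ for all $f\in\mathrm{End}(S_x)$, is given by the restriction of the inverse Auslander--Reiten translation $\tau^-\colon\mathcal{H}\to\mathcal{H}$ to the simple object $S_x$ concentrated in $x$.
   Context: Let $k$ be a field. A (non-weighted) noncommutative regular projective curve over $k$ is a category $\mathcal{H}$ such that: (NC1) $\mathcal{H}$ is small, connected (not a product of two non-zero categories), abelian, and each object of $\mathcal{H}$ is noetherian; (NC2) $\mathcal{H}$ is a $k$-category with finite dimensional Hom- and Ext-spaces; (NC3) there is an autoequivalence $\tau$ of $\mathcal{H}$ (the Auslander--Reiten translation), with quasi-inverse $\tau^-$, with Serre duality $\mathrm{Ext}^1(X,Y)\cong\mathrm{Hom}_k(\mathrm{Hom}(Y,\tau X),k)$, naturally in $X,Y$; (NC4) $\mathcal{H}$ contains an object of infinite length; (NC5) the Serre subcategory $\mathcal{H}_0$ of objects of finite length, which decomposes as a coproduct $\mathcal{H}_0=\coprod_{x\in\mathbb{X}}\mathcal{U}_x$ of connected uniserial categories $\mathcal{U}_x$ (tubes), has an infinite index set $\mathbb{X}$; and (non-weightedness) each $\mathcal{U}_x$ has exactly one simple object $S_x$ up to isomorphism. The elements of $\mathbb{X}$ are called points; objects of $\mathcal{U}_x$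 are called skyscraper sheaves concentrated in $x$. One has $\tau S_x\cong S_x$; identifying $\tau S_x=S_x$, the functors $\tau$ and $\tau^-$ induce $k$-algebra automorphisms of the division algebra $\mathrm{End}(S_x)$, well defined up to inner automorphisms. For a division algebra $D$ over $k$ and $\sigma\in\mathrm{Aut}(D/k)$, $D[[T,\sigma]]$ denotes the ring of formal power series $\sum_{n\ge 0}a_nT^n$ with $a_n\in D$, with multiplication determined by $Ta=\sigma(a)T$ for $a\in D$. *)

(* Defs.v *)
From HB Require Import structures.
From mathcomp Require Import all_boot all_order all_algebra.
From mathcomp Require Import separable.
From mathcomp Require Import boolp classical_sets functions cardinality.

Set Implicit Arguments.
Unset Strict Implicit.
Unset Printing Implicit Defensive.

Import GRing.Theory.
Local Open Scope ring_scope.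

Definition perfect_field (k : fieldType) : Prop :=
  forall p : {poly k}, irreducible_poly p -> separable_poly p.

Definition finite_dim (k : fieldType) (V : lmodType k) : Prop :=
  exists n, inhabited (Vector.axiom n V).

(* The objects form a type, that is, a set: every [lincat] is small. *)
Record lincat (k : fieldType) := Lincat {
  obj :> Type;
  hom : obj -> obj -> lmodType k;
  idm : forall X : obj, hom X X;
  comp : forall X Y Z : obj, hom Y Z -> hom X Y -> hom X Z;
  comp1m : forall (X Y : obj) (f : hom X Y), comp (idm Y) f = f;
  compm1 : forall (X Y : obj) (f : hom X Y), comp f (idm X) = f;
  compmA : forall (X Y Z W : obj) (h : hom Z W) (g : hom Y Z) (f : hom X Y),
    comp h (comp g f) = comp (comp h g) f;
  comp_linearr : forall (X Y Z : obj) (g : hom Y Z),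
    linear (fun f : hom X Y => comp g f);
  comp_linearl : forall (X Y Z : obj) (f : hom X Y),
    linear (fun g : hom Y Z => comp g f)
}.

Arguments hom {k l} X Y : rename.
Arguments idm {k l} X : rename.
Arguments comp {k l X Y Z} g f : rename.

Notation "g \oc f" := (comp g f) (at level 40, left associativity).

Section FullSubcategory.
Variables (k : fieldType) (C : lincat k) (P : C -> Prop).

Definition fullsub : lincat k := @Lincat k {X : C | P X}
  (fun X Y => hom (sval X) (sval Y))
  (fun X => idm (sval X))
  (fun X Y Z g f => g \oc f)
  (fun X Y f => comp1m f)
  (fun X Y f => compm1 f)
  (fun X Y Z W h g f => compmA h g f)
  (fun X Y Z g => comp_linearr g)
  (fun X Y Z f => comp_linearl f).

End FullSubcategory.

Section ProductCategory.
Variables (k : fieldType) (A B : lincat k).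

Definition prodcat : lincat k.
Proof.
refine (@Lincat k (A * B)%type
  (fun X Y => (hom X.1 Y.1 * hom X.2 Y.2)%type : lmodType k)
  (fun X => (idm X.1, idm X.2))
  (fun X Y Z g f => (g.1 \oc f.1, g.2 \oc f.2)) _ _ _ _ _).
- by move=> X Y [f1 f2] /=; rewrite !comp1m.
- by move=> X Y [f1 f2] /=; rewrite !compm1.
- by move=> X Y Z W h g f /=; rewrite !compmA.
- by move=> X Y Z g a f f' /=; congr pair; exact: comp_linearr.
- by move=> X Y Z f a g g' /=; congr pair; exact: comp_linearl.
Defined.

End ProductCategory.

Section Functors.
Variable k : fieldType.

Record linfunctor (C D : lincat k) := Linfunctor {
  fobj :> C -> D;
  fmap : forall X Y : C, {linear hom X Y -> hom (fobj X) (fobj Y)};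
  fmap1 : forall X : C, fmap X X (idm X) = idm (fobj X);
  fmapM : forall (X Y Z : C) (g : hom Y Z) (f : hom X Y),
    fmap X Z (g \oc f) = fmap Y Z g \oc fmap X Y f
}.

Definition isomorphism (C : lincat k) (X Y : C) (f : hom X Y) : Prop :=
  exists g : hom Y X, g \oc f = idm X /\ f \oc g = idm Y.

Definition isomorphic (C : lincat k) (X Y : C) : Prop :=
  exists f : hom X Y, isomorphism f.

(* [G] is a quasi-inverse of [F]: natural isomorphisms [GF ~ 1] and
   [FG ~ 1]. *)
Definition quasi_inverse (C D : lincat k) (F : linfunctor C D)
    (G : linfunctor D C) : Prop :=
  (exists eta : forall X : C, hom (G (F X)) X,
     (forall X, isomorphism (eta X)) /\
     (forall (X Y : C) (f : hom X Y),
        eta Y \oc fmap G (F X) (F Y) (fmap F X Y f) = f \oc eta X)) /\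
  (exists eps : forall X : D, hom (F (G X)) X,
     (forall X, isomorphism (eps X)) /\
     (forall (X Y : D) (f : hom X Y),
        eps Y \oc fmap F (G X) (G Y) (fmap G X Y f) = f \oc eps X)).

Definition equivalent (C D : lincat k) : Prop :=
  exists (F : linfunctor C D) (G : linfunctor D C), quasi_inverse F G.

End Functors.

Definition zero_object (k : fieldType) (C : lincat k) (X : C) : Prop :=
  idm X = 0.

Definition zero_category (k : fieldType) (C : lincat k) : Prop :=
  forall X : C, zero_object X.

Section AbelianCategories.
Variables (k : fieldType) (C : lincat k).
Implicit Types X Y Z : C.

Definition mono X Y (f : hom X Y) : Prop :=
  forall Z (g h : hom Z X), f \oc g = f \oc h -> g = h.

Definition epi X Y (f : hom X Y) : Prop :=
  forall Z (g h : hom Y Z), g \oc f = h \oc f -> g = h.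

Definition is_kernel X Y (f : hom X Y) (K : C) (i : hom K X) : Prop :=
  f \oc i = 0 /\
  forall Z (g : hom Z X), f \oc g = 0 -> exists! h : hom Z K, i \oc h = g.

Definition is_cokernel X Y (f : hom X Y) (K : C) (p : hom Y K) : Prop :=
  p \oc f = 0 /\
  forall Z (g : hom Y Z), g \oc f = 0 -> exists! h : hom K Z, h \oc p = g.

Definition is_biproduct X Y (B : C) (i1 : hom X B) (i2 : hom Y B)
    (p1 : hom B X) (p2 : hom B Y) : Prop :=
  [/\ p1 \oc i1 = idm X, p2 \oc i2 = idm Y, p1 \oc i2 = 0, p2 \oc i1 = 0
    & i1 \oc p1 + i2 \oc p2 = idm B].

Definition direct_sum X Y (B : C) : Prop :=
  exists i1 i2 p1 p2, @is_biproduct X Y B i1 i2 p1 p2.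

Definition finite_direct_sum (n : nat) (E : 'I_n -> C) (B : C) : Prop :=
  exists (i : forall j, hom (E j) B) (p : forall j, hom B (E j)),
    [/\ forall j, p j \oc i j = idm (E j),
        forall j l, j <> l -> p j \oc i l = 0
      & \sum_(j < n) (i j \oc p j) = idm B].

Definition abelian_category : Prop :=
  (exists Z, zero_object Z) /\
  (forall X Y, exists B, direct_sum X Y B) /\
  (forall X Y (f : hom X Y), exists (K : C) (i : hom K X), is_kernel f i) /\
  (forall X Y (f : hom X Y), exists (K : C) (p : hom Y K), is_cokernel f p) /\
  (forall X Y (f : hom X Y), mono f ->
     exists Z (g : hom Y Z), is_kernel g f) /\
  (forall X Y (f : hom X Y), epi f ->
     exists Z (g : hom Z X), is_cokernel g f).

Definition connected_category : Prop :=
  forall A B : lincat k, equivalent C (prodcat A B) ->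
    zero_category A \/ zero_category B.

Definition short_exact Y E X (i : hom Y E) (p : hom E X) : Prop :=
  is_kernel p i /\ is_cokernel i p.

(* The preorder on the subobjects of [X], represented by monomorphisms. *)
Definition sub_le X A B (m : hom A X) (n : hom B X) : Prop :=
  exists h : hom A B, n \oc h = m.

Definition noetherian_object X : Prop :=
  forall (A : nat -> C) (m : forall n, hom (A n) X),
    (forall n, mono (m n)) ->
    (forall n, sub_le (m n) (m n.+1)) ->
    exists N, forall n, (N <= n)%N -> sub_le (m n) (m N).

Definition simple_object X : Prop :=
  ~ zero_object X /\
  forall A (m : hom A X), mono m -> zero_object A \/ isomorphism m.

Inductive finite_length : C -> Prop :=
| finite_length0 X : zero_object X -> finite_length X
| finite_lengthS A X T (i : hom A X) (p : hom X T) :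
    short_exact i p -> finite_length A -> simple_object T -> finite_length X.

Definition indecomposable_object X : Prop :=
  ~ zero_object X /\
  forall A B, direct_sum A B X -> zero_object A \/ zero_object B.

Definition uniserial_object X : Prop :=
  forall A B (m : hom A X) (n : hom B X),
    mono m -> mono n -> sub_le m n \/ sub_le n m.

Definition uniserial_category : Prop :=
  [/\ abelian_category, forall X, finite_length X
    & forall X, indecomposable_object X -> uniserial_object X].

(* [Q] is the coproduct of the strictly full additive subcategories [P i]. *)
Record coproduct_decomposition (I : Type) (Q : C -> Prop)
    (P : I -> C -> Prop) : Prop := {
  coprod_sub : forall i X, P i X -> Q X;
  coprod_iso : forall i X Y, isomorphic X Y -> P i X -> P i Y;
  coprod_zero : forall i X, zero_object X -> P i X;
  coprod_sum : forall i X Y B, direct_sum X Y B -> P i X -> P i Y -> P i B;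
  coprod_orth : forall i j X Y, i <> j -> P i X -> P j Y ->
    forall f : hom X Y, f = 0;
  coprod_gen : forall X, Q X ->
    exists (n : nat) (i : 'I_n -> I) (E : 'I_n -> C),
      (forall j, P (i j) (E j)) /\ finite_direct_sum E X
}.

End AbelianCategories.

Section YonedaExt.
Variables (k : fieldType) (C : lincat k).

(* Extensions [0 -> Y -> E -> X -> 0]. *)
Record extension (X Y : C) := Extension {
  ext_mid : C;
  ext_inj : hom Y ext_mid;
  ext_prj : hom ext_mid X;
  ext_exact : short_exact ext_inj ext_prj
}.

Definition ext_map (X Y X' Y' : C) (e : extension X Y) (e' : extension X' Y')
    (a : hom Y Y') (b : hom X X') : Prop :=
  exists m : hom (ext_mid e) (ext_mid e'),
    m \oc ext_inj e = ext_inj e' \oc a /\ ext_prj e' \oc m = b \oc ext_prj e.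

(* Yoneda equivalence, push-out along [a] and pull-back along [b]; over an
   abelian category these are characterised by the existence of a morphism of
   extensions that is the identity on the appropriate ends. *)
Definition ext_equiv (X Y : C) (e e' : extension X Y) : Prop :=
  ext_map e e' (idm Y) (idm X).

Definition is_pushout_ext (X Y Y' : C) (a : hom Y Y') (e : extension X Y)
    (e' : extension X Y') : Prop := ext_map e e' a (idm X).

Definition is_pullback_ext (X X' Y : C) (b : hom X' X) (e : extension X Y)
    (e' : extension X' Y) : Prop := ext_map e' e (idm Y) b.

(* [d] represents [e1 (+) e2], its pull-back along the diagonal of [X] is
   [m], and the push-out of [m] along the codiagonal of [Y] is [e]. *)
Definition is_baer_sum (X Y : C) (e1 e2 e : extension X Y) : Prop :=
  exists (XX YY : C)
    (iX1 iX2 : hom X XX) (pX1 pX2 : hom XX X)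
    (iY1 iY2 : hom Y YY) (pY1 pY2 : hom YY Y)
    (d : extension XX YY) (m : extension X YY),
    [/\ is_biproduct iX1 iX2 pX1 pX2, is_biproduct iY1 iY2 pY1 pY2,
        ext_map e1 d iY1 iX1 /\ ext_map e2 d iY2 iX2,
        is_pullback_ext (iX1 + iX2) d m
      & is_pushout_ext (pY1 + pY2) m e].

(* The vector space [Ext^1(X, Y)] of Yoneda classes of extensions under Baer
   sum.  The conditions determine the space together with the class map [ecl]
   up to a unique linear isomorphism; taking [ext_space] as a field instead of
   a quotient of [extension X Y] leaves it in the universe of the Hom-spaces. *)
Record ext1 (X Y : C) := Ext1 {
  ext_space :> lmodType k;
  ecl : extension X Y -> ext_space;
  ecl_surj : forall v, exists e, ecl e = v;
  ecl_eq : forall e e', ecl e = ecl e' <-> ext_equiv e e';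
  eclD : forall e1 e2 e, is_baer_sum e1 e2 e -> ecl e = ecl e1 + ecl e2;
  eclZ : forall (c : k) e e', is_pushout_ext (c *: idm Y) e e' ->
    ecl e' = c *: ecl e
}.

End YonedaExt.

Section EndomorphismAlgebra.
Variables (k : fieldType) (C : lincat k).

Record simpleObj := SimpleObj {
  simple_val :> C;
  simple_valP : simple_object simple_val
}.

Definition endo (S : simpleObj) : Type := @hom k C S S.

Variable S : simpleObj.

HB.instance Definition _ := GRing.Lmodule.copy (endo S) (@hom k C S S).

Let emul (f g : endo S) : endo S := @comp k C S S S f g.

Fact endo_mulA : associative emul.
Proof. by move=> f g h; exact: compmA. Qed.

Fact endo_mul1 : left_id (idm S : endo S) emul.
Proof. by move=> f; exact: comp1m. Qed.

Fact endo_mulr1 : right_id (idm S : endo S) emul.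
Proof. by move=> f; exact: compm1. Qed.

Fact endo_mulDl : left_distributive emul +%R.
Proof.
move=> f g h; have := @comp_linearl k C S S S h 1 f g.
by rewrite !scale1r.
Qed.

Fact endo_mulDr : right_distributive emul +%R.
Proof.
move=> f g h; have := @comp_linearr k C S S S f 1 g h.
by rewrite !scale1r.
Qed.

Fact endo_neq0 : (idm S : endo S) != 0.
Proof. by apply/eqP => h; case: (simple_valP S) => /(_ h). Qed.

HB.instance Definition _ := GRing.Zmodule_isNzRing.Build (endo S)
  endo_mulA endo_mul1 endo_mulr1 endo_mulDl endo_mulDr endo_neq0.

Fact endo_scaleAl (a : k) (f g : endo S) : a *: (f * g) = (a *: f) * g.
Proof.
have c0 : (0 : hom S S) \oc (g : hom S S) = 0.
  have := @comp_linearl k C S S S g (-1) 0 0.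
  by rewrite !scaler0 addr0 scaleN1r addNr.
have := @comp_linearl k C S S S g a f 0.
by rewrite /= c0 !addr0 => e; exact: esym e.
Qed.

HB.instance Definition _ :=
  GRing.Lmodule_isLalgebra.Build k (endo S) endo_scaleAl.

Fact endo_scaleAr (a : k) (f g : endo S) : a *: (f * g) = f * (a *: g).
Proof.
have c0 : (f : hom S S) \oc (0 : hom S S) = 0.
  have := @comp_linearr k C S S S f (-1) 0 0.
  by rewrite !scaler0 addr0 scaleN1r addNr.
have := @comp_linearr k C S S S f a g 0.
by rewrite /= c0 !addr0 => e; exact: esym e.
Qed.

HB.instance Definition _ :=
  GRing.Lalgebra_isAlgebra.Build k (endo S) endo_scaleAr.

End EndomorphismAlgebra.

(* [s] is an automorphism of [End(S)] induced by [F] after an identification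
   [phi] of [F S] with [S]; changing [phi] changes [s] by an inner
   automorphism. *)
Definition induced_twist (k : fieldType) (C : lincat k) (S : simpleObj C)
    (F : linfunctor C C) (s : {lrmorphism endo S -> endo S}) : Prop :=
  exists phi : hom (F S) S, isomorphism phi /\
    forall f : endo S, (s f : hom S S) \oc phi = phi \oc fmap F S S f.

(* [a : skew_series s] is the series [\sum_n a n T^n], with [T c = s c T]. *)
Definition skew_series (k : fieldType) (D : algType k)
  (s : {lrmorphism D -> D}) : Type := nat -> D.

Section SkewPowerSeries.
Variables (k : fieldType) (D : algType k) (s : {lrmorphism D -> D}).
Local Notation series := (skew_series s).

HB.instance Definition _ := GRing.Lmodule.copy series (nat -> D).

Let smul (a b : series) : series :=
  fun n => \sum_(i < n.+1) a i * iter i s (b (n - i)%N).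
Let sone : series := fun n => (n == 0%N)%:R.

Let iter_skew0 i : iter i s 0 = 0.
Proof. by elim: i => [|i IH] //=; rewrite IH rmorph0. Qed.

Let iter_skew1 i : iter i s 1 = 1.
Proof. by elim: i => [|i IH] //=; rewrite IH rmorph1. Qed.

Let iter_skewD i a b : iter i s (a + b) = iter i s a + iter i s b.
Proof. by elim: i => [|i IH] //=; rewrite IH rmorphD. Qed.

Let iter_skewM i a b : iter i s (a * b) = iter i s a * iter i s b.
Proof. by elim: i => [|i IH] //=; rewrite IH rmorphM. Qed.

Let iter_skewZ i (c : k) a : iter i s (c *: a) = c *: iter i s a.
Proof. by elim: i => [|i IH] //=; rewrite IH linearZ. Qed.

Let iter_skew_sum i n (F : nat -> D) :
  iter i s (\sum_(j < n) F j) = \sum_(j < n) iter i s (F j).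
Proof.
elim: n => [|n IH]; first by rewrite !big_ord0 iter_skew0.
by rewrite !big_ord_recr /= iter_skewD IH.
Qed.

Fact skew_mulA : associative smul.
Proof.
move=> a b c; apply/funext => n; rewrite /smul.
pose F j i := a j * iter j s (b (i - j)%N) * iter i s (c (n - i)%N).
transitivity (\sum_(0 <= j < n.+1) \sum_(j <= i < n.+1) F j i).
  rewrite big_mkord; apply: eq_bigr => j _.
  rewrite (iter_skew_sum j (n - j).+1
             (fun l => b l * iter l s (c (n - j - l)%N))).
  rewrite big_distrr /= -[X in \sum_(X <= _ < _) _]add0n big_addn big_mkord.
  rewrite subSn; last by rewrite -ltnS.
  apply: eq_bigr => l _.
  by rewrite /F iter_skewM -iterD mulrA addnK [(l + j)%N]addnC subnDA.
transitivity (\sum_(0 <= i < n.+1) \sum_(0 <= j < i.+1) F j i).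
  under eq_bigr => j _ do rewrite (big_nat_widenl j 0) //.
  rewrite (exchange_big_dep xpredT) //=; apply: eq_big_nat => i /andP[_ lt_in].
  by rewrite [RHS](big_nat_widen _ _ n.+1).
rewrite big_mkord; apply: eq_bigr => i _.
by rewrite big_distrl big_mkord.
Qed.

Fact skew_mul1 : left_id sone smul.
Proof.
move=> a; apply/funext => n; rewrite /smul big_ord_recl /= /sone /= mul1r subn0.
by rewrite big1 ?addr0 // => i _; rewrite mul0r.
Qed.

Fact skew_mulr1 : right_id sone smul.
Proof.
move=> a; apply/funext => n.
rewrite /smul big_ord_recr /= /sone subnn /= iter_skew1 mulr1.
rewrite big1 ?add0r // => i _.
by rewrite subn_eq0 leqNgt ltn_ord /= iter_skew0 mulr0.
Qed.

Fact skew_mulDl : left_distributive smul +%R.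
Proof.
move=> a b c; apply/funext => n.
rewrite [RHS](_ : _ = smul a c n + smul b c n) // /smul -big_split /=.
by apply: eq_bigr => i _; rewrite mulrDl.
Qed.

Fact skew_mulDr : right_distributive smul +%R.
Proof.
move=> a b c; apply/funext => n.
rewrite [RHS](_ : _ = smul a b n + smul a c n) // /smul -big_split /=.
by apply: eq_bigr => i _; rewrite iter_skewD mulrDr.
Qed.

Fact skew_one_neq0 : sone != 0.
Proof.
apply/eqP => /(congr1 (fun a : series => a 0%N)) /eqP.
by rewrite /sone /= oner_eq0.
Qed.

HB.instance Definition _ := GRing.Zmodule_isNzRing.Build series
  skew_mulA skew_mul1 skew_mulr1 skew_mulDl skew_mulDr skew_one_neq0.

Fact skew_scaleAl (c : k) (a b : series) : c *: (a * b) = (c *: a) * b.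
Proof.
apply/funext => n; rewrite [LHS](scaler_sumr c).
by apply: eq_bigr => i _; rewrite scalerAl.
Qed.

HB.instance Definition _ :=
  GRing.Lmodule_isLalgebra.Build k series skew_scaleAl.

Fact skew_scaleAr (c : k) (a b : series) : c *: (a * b) = a * (c *: b).
Proof.
apply/funext => n; rewrite [LHS](scaler_sumr c).
by apply: eq_bigr => i _; rewrite scalerAr -iter_skewZ.
Qed.

HB.instance Definition _ :=
  GRing.Lalgebra_isAlgebra.Build k series skew_scaleAr.

Definition skewC (c : D) : series := fun n => if n == 0%N then c else 0.
Definition skewT : series := fun n => (n == 1%N)%:R.

Fact skewTC (c : D) : skewT * skewC c = skewC (s c) * skewT.
Proof.
apply/funext => n; rewrite /GRing.mul /= /smul /skewT /skewC.
rewrite [RHS]big_ord_recl /= subn0 [X in _ = _ + X]big1 ?addr0; last first.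
  by move=> i _ /=; rewrite mul0r.
case: n => [|n]; first by rewrite big_ord_recl big_ord0 !mul0r mulr0 addr0.
rewrite !big_ord_recl /= mul0r add0r big1 ?addr0; last first.
  by move=> i _ /=; rewrite mul0r.
rewrite mul1r subSS subn0.
by case: n => [|n]; rewrite /= ?mulr1 // rmorph0 mulr0.
Qed.

End SkewPowerSeries.

(* Modules are right modules, that is, modules over the converse ring [A^c]:
   the simple right module [A / T A] over [A = D[[T, s]]] has endomorphism
   algebra [D] for composition of maps, as [S] has in the tube; the simple
   left module has the opposite algebra. *)
Definition rmod_hom (k : fieldType) (A : algType k) (M N : lmodType A^c) :
  Type := {linear M -> N}.

Section ModuleHom.
Variables (k : fieldType) (A : algType k) (M N : lmodType A^c).
Local Notation rhom := (rmod_hom M N).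

Definition rmod_fun (f : rhom) : M -> N := (f : {linear M -> N}).

Fact rmod_homP (f g : rhom) : rmod_fun f =1 rmod_fun g -> f = g.
Proof.
rewrite /rmod_fun => /funext; case: f g => [f cf] [g cg] /= e.
by subst g; congr GRing.Linear.Pack; case: cf cg => [[?] [?]] [[?] [?]];
  congr GRing.Linear.Class; congr (_ _); exact: Prop_irrelevance.
Qed.

HB.instance Definition _ := gen_eqMixin rhom.
HB.instance Definition _ := gen_choiceMixin rhom.

Let hzero : rhom := (\0 : {linear M -> N}).
Let hadd (f g : rhom) : rhom :=
  ((f : {linear M -> N}) \+ (g : {linear M -> N}) : {linear M -> N}).
Let hopp (f : rhom) : rhom := (\- (f : {linear M -> N}) : {linear M -> N}).

Fact rmod_addA : associative hadd.
Proof. by move=> f g h; apply: rmod_homP => m; exact: addrA. Qed.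

Fact rmod_addC : commutative hadd.
Proof. by move=> f g; apply: rmod_homP => m; exact: addrC. Qed.

Fact rmod_add0 : left_id hzero hadd.
Proof. by move=> f; apply: rmod_homP => m; exact: add0r. Qed.

Fact rmod_addN : left_inverse hzero hopp hadd.
Proof. by move=> f; apply: rmod_homP => m; exact: addNr. Qed.

HB.instance Definition _ :=
  GRing.isZmodule.Build rhom rmod_addA rmod_addC rmod_add0 rmod_addN.

(* [c : k] acts on [N] through the central element [c%:A] of [A]. *)
Let hscale_fun (c : k) (f : rhom) : M -> N :=
  fun m => (c%:A : A^c) *: rmod_fun f m.

Fact rmod_scale_linear (c : k) (f : rhom) : linear (hscale_fun c f).
Proof.
move=> a u v; rewrite /hscale_fun /rmod_fun linearP scalerDr !scalerA.
congr (_ *: _ + _).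
exact: etrans (mulr_algr c (a : A)) (esym (mulr_algl c (a : A))).
Qed.

Let hscale (c : k) (f : rhom) : rhom :=
  HB.pack_for {linear M -> N} (hscale_fun c f)
    (GRing.isLinear.Build _ _ _ _ _ (rmod_scale_linear c f)).

Fact rmod_scaleA (a b : k) (f : rhom) : hscale a (hscale b f) = hscale (a * b) f.
Proof.
apply: rmod_homP => m; rewrite /hscale /hscale_fun /rmod_fun /= scalerA.
congr (_ *: _).
by rewrite [LHS](_ : _ = (b%:A : A) * a%:A) // mulr_algl scalerA mulrC.
Qed.

Fact rmod_scale1 : left_id 1 hscale.
Proof.
by move=> f; apply: rmod_homP => m; rewrite {1}/rmod_fun /= /hscale_fun !scale1r.
Qed.

Fact rmod_scaleDr : right_distributive hscale +%R.
Proof. by move=> a f g; apply: rmod_homP => m; exact: scalerDr. Qed.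

Fact rmod_scaleDl (f : rhom) : {morph hscale^~ f : a b / a + b}.
Proof.
move=> a b; apply: rmod_homP => m.
by rewrite {1}/rmod_fun /= /hscale_fun scalerDl; exact: scalerDl.
Qed.

HB.instance Definition _ := GRing.Zmodule_isLmodule.Build k rhom
  rmod_scaleA rmod_scale1 rmod_scaleDr rmod_scaleDl.

End ModuleHom.

Section ModuleCategory.
Variables (k : fieldType) (A : algType k).

Let rid (M : lmodType A^c) : rmod_hom M M := (idfun : {linear M -> M}).
Let rcomp (M N P : lmodType A^c) (g : rmod_hom N P) (f : rmod_hom M N) :
  rmod_hom M P :=
  ((g : {linear N -> P}) \o (f : {linear M -> N}) : {linear M -> P}).

Definition rmod : lincat k.
Proof.
refine (@Lincat k (lmodType A^c) (fun M N => rmod_hom M N) rid rcomp _ _ _ _ _).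
- by move=> M N f; apply: rmod_homP.
- by move=> M N f; apply: rmod_homP.
- by move=> M N P Q h g f; apply: rmod_homP.
- move=> M N P g c f f'; apply: rmod_homP => m.
  by rewrite /rmod_fun /=; exact: (linearP (g : {linear N -> P})).
- by move=> M N P f c g g'; apply: rmod_homP.
Defined.

Definition rmod_finlen : lincat k := fullsub (@finite_length k rmod).

End ModuleCategory.

(* The Serre duality [nc_serre] is a linear bijection from [Ext^1(X, Y)] onto
   the dual of [Hom(Y, tau X)], natural in [Y] ([nc_serre_natl]) and in [X]
   ([nc_serre_natr]); it makes [Ext^1] right exact, so that the higher
   Ext-spaces vanish and need no separate finiteness condition. *)
Record nc_curve (k : fieldType) := NCCurve {
  nc_cat :> lincat k;
  nc_connected : connected_category nc_cat;
  nc_abelian : abelian_category nc_cat;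
  nc_noetherian : forall X : nc_cat, noetherian_object X;

  nc_Ext : forall X Y : nc_cat, ext1 X Y;
  nc_hom_fd : forall X Y : nc_cat, finite_dim (hom X Y);
  nc_Ext_fd : forall X Y : nc_cat, finite_dim (nc_Ext X Y);

  nc_tau : linfunctor nc_cat nc_cat;
  nc_taui : linfunctor nc_cat nc_cat;
  nc_tauK : quasi_inverse nc_tau nc_taui;
  nc_serre : forall X Y : nc_cat,
    nc_Ext X Y -> {scalar hom Y (nc_tau X)};
  nc_serre_linear : forall (X Y : nc_cat) (c : k) (u v : nc_Ext X Y) g,
    nc_serre (c *: u + v) g = c * nc_serre u g + nc_serre v g;
  nc_serre_bij : forall X Y : nc_cat, bijective (@nc_serre X Y);
  nc_serre_natl : forall (X Y Y' : nc_cat) (a : hom Y Y')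
      (e : extension X Y) (e' : extension X Y'),
    is_pushout_ext a e e' -> forall g : hom Y' (nc_tau X),
    nc_serre (ecl (nc_Ext X Y') e') g = nc_serre (ecl (nc_Ext X Y) e) (g \oc a);
  nc_serre_natr : forall (X X' Y : nc_cat) (b : hom X' X)
      (e : extension X Y) (e' : extension X' Y),
    is_pullback_ext b e e' -> forall g : hom Y (nc_tau X'),
    nc_serre (ecl (nc_Ext X' Y) e') g =
      nc_serre (ecl (nc_Ext X Y) e) (fmap nc_tau X' X b \oc g);

  nc_inflen : exists X : nc_cat, ~ finite_length X;

  nc_point : Type;
  nc_tube : nc_point -> nc_cat -> Prop;
  nc_tube_coprod : coproduct_decomposition (@finite_length k nc_cat) nc_tube;
  nc_tube_connected : forall x, connected_category (fullsub (nc_tube x));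
  nc_tube_uniserial : forall x, uniserial_category (fullsub (nc_tube x));
  nc_point_infinite : infinite_set [set: nc_point]%classic;

  nc_tube_simple : forall x, exists S : nc_cat,
    [/\ nc_tube x S, simple_object S
      & forall T : nc_cat, nc_tube x T -> simple_object T -> isomorphic T S]
}.

(* Main.v *)
Require Import Defs.
From HB Require Import structures.
From mathcomp Require Import all_boot all_algebra separable.
From mathcomp Require Import boolp.
(* Imported again so that [hom] denotes the morphisms of a linear category. *)
Require Import Defs.

Set Implicit Arguments.
Unset Strict Implicit.
Unset Printing Implicit Defensive.

Import GRing.Theory.
Local Open Scope ring_scope.

(** Let D = End(S).  The objects of the tube of S are those with a finite
    filtration whose factors are all S ([tube_filtered]), and the theorem says
    that the tube is pro-represented by a single tower
    S = E_0 <- E_1 <- E_2 <- ... of nonsplit extensions by S, on which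
    D[[T, tau^-]] acts.

    The tower.  By Serre duality Ext^1(E_n, S) is dual to Hom(S, tau E_n).  If
    every map S -> E_n factors through a fixed one, the latter space is a free
    D-module of rank one, so every extension of E_n by S is a push-out of one
    nonsplit extension E_{n+1} ([pushout_generates]), and it splits after
    pull-back to E_{n+1} ([nonsplit_lift]).  Hence X |-> colim Hom(E_n, X) is
    exact on the tube ([tower_projective]).

    The ring.  Since k is perfect, the finite-dimensional division algebra D
    is separable: D (x) D contains an element e = sum x (x) y with
    sum x y = 1 and a e = e a ([separable_division_algebra]).  With e one
    lifts the action of D from E_n to E_{n+1} (the second Hochschild
    cohomology vanishes, [lift_action]), and one averages the embedding
    T : E_n -> E_{n+1} onto the kernel of E_{n+1} -> S so as to obtain
    T d = s(d) T ([shift_step]).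

    The twist.  On E_1 the element d of D induces an endomorphism th(d) of the
    subobject S.  The naturality of Serre duality gives
    m(a th(s(d))) = m(d a) for a nonzero linear form m on D, where s is
    induced by tau^-.  So th s is the Nakayama automorphism of m.  A
    finite-dimensional division algebra carries a nonzero symmetric form, so
    this automorphism is inner ([nakayama_inner]), and the conjugating element
    is absorbed in the choice of T : E_0 -> E_1 ([shift_base]).

    The equivalence.  If X is an extension of S by B, a lift w of E_n -> S to
    X gives colim Hom(E_n, X) = colim Hom(E_n, B) + w D with w T in the first
    summand, and X is the push-out of T : E_n -> E_{n+1} along a map
    E_n -> B.  A module of finite length with a simple quotient has the same
    shape.  Induction on the filtration therefore proves that the functor is
    full ([fiber_full]), faithful ([fiber_faithful]) and essentially
    surjective ([fiber_essentially_surjective]). *)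

(** * Division algebras and their tensor square *)

Definition division_ring (D : nzRingType) : Prop :=
  forall x : D, x != 0 -> exists y, y * x = 1 /\ x * y = 1.

Definition central (D : nzRingType) (z : D) : Prop := forall a : D, z * a = a * z.

Lemma linear_at0 (R : pzRingType) (U V : lmodType R) (f : U -> V) :
  linear f -> f 0 = 0.
Proof.
move=> f_lin; have := f_lin (-1) 0 0.
by rewrite scaler0 addr0 scaleN1r addNr.
Qed.

(** A map as below amounts to an additive map out of the tensor product of D
    with itself over the ring generated by Z.  A list of pairs stands for a
    tensor, and two tensors are compared by pairing them with all such maps. *)
Record balanced (D : nzRingType) (Z : D -> Prop) (V : zmodType)
    (B : D -> D -> V) : Prop := Balanced {
  balDl : forall x x' y, B (x + x') y = B x y + B x' y;
  balDr : forall x y y', B x (y + y') = B x y + B x y';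
  balM : forall z, Z z -> forall x y, B (x * z) y = B x (z * y)
}.

Definition pairing (D : nzRingType) (V : zmodType) (B : D -> D -> V)
  (e : seq (D * D)) : V := \sum_(u <- e) B u.1 u.2.

Definition twosided (D : nzRingType) (e : seq (D * D)) (c : D) : D :=
  \sum_(u <- e) u.1 * c * u.2.

Section Balanced.
Variables (D : nzRingType) (Z : D -> Prop) (V : zmodType) (B : D -> D -> V).
Hypothesis balB : balanced Z B.

Lemma bal0l y : B 0 y = 0.
Proof. by apply: (addrI (B 0 y)); rewrite -(balDl balB) !addr0. Qed.

Lemma bal0r x : B x 0 = 0.
Proof. by apply: (addrI (B x 0)); rewrite -(balDr balB) !addr0. Qed.

Lemma balNl x y : B (- x) y = - B x y.
Proof. by apply: (addrI (B x y)); rewrite -(balDl balB) !subrr bal0l. Qed.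

Lemma balBl x x' y : B (x - x') y = B x y - B x' y.
Proof. by rewrite (balDl balB) balNl. Qed.

Lemma bal_suml (I : Type) (r : seq I) (F : I -> D) y :
  B (\sum_(i <- r) F i) y = \sum_(i <- r) B (F i) y.
Proof.
by elim: r => [|i r IH]; rewrite ?big_nil ?bal0l // !big_cons (balDl balB) IH.
Qed.

Lemma bal_sumr (I : Type) (r : seq I) (F : I -> D) x :
  B x (\sum_(i <- r) F i) = \sum_(i <- r) B x (F i).
Proof.
by elim: r => [|i r IH]; rewrite ?big_nil ?bal0r // !big_cons (balDr balB) IH.
Qed.

Lemma bal_mull a : balanced Z (fun x y => B (a * x) y).
Proof.
split=> [x x' y|x y y'|z Zz x y]; first by rewrite mulrDr (balDl balB).
  by rewrite (balDr balB).
by rewrite mulrA (balM balB).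
Qed.

End Balanced.

Section Simplicity.
Variable D : nzRingType.
Hypothesis Ddiv : division_ring D.

(** The tensor square of D over its center acts faithfully on D.  Artin's
    argument on a shortest relation: with one left factor normalised to 1, the
    commutator with any element gives a shorter relation; either all left
    factors are central and can be moved to the right, or the shorter relation
    eliminates one more term. *)
Lemma twosided_faithful (e : seq (D * D)) : (forall c, twosided e c = 0) ->
  forall (V : zmodType) (B : D -> D -> V), balanced (@central D) B ->
  pairing B e = 0.
Proof.
move: {2}(size e) (leqnn (size e)) => n; elim: n e => [|n IH] [|[w v] e] //=;
  rewrite ?ltnS => les rel V B balB; rewrite /pairing ?big_nil //.
rewrite big_cons /=.
have [w0|w0] := eqVneq w 0.
  rewrite w0 (bal0l balB) add0r; apply: (IH) balB => // c.
  by have := rel c; rewrite /twosided big_cons /= w0 !mul0r add0r.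
have [w' [w'w ww']] := Ddiv w0.
pose B' x y := B (w * x) y; have balB' : balanced (@central D) B' by exact: bal_mull.
pose e1 := [seq (w' * u.1, u.2) | u <- e].
have -> : B w v = B' 1 v by rewrite /B' mulr1.
have -> : \sum_(u <- e) B u.1 u.2 = pairing B' e1.
  rewrite /pairing big_map; apply: eq_bigr => u _ /=.
  by rewrite /B' mulrA ww' mul1r.
have rel1 c : c * v + twosided e1 c = 0.
  have := congr1 (fun x => w' * x) (rel c).
  rewrite /twosided big_cons /= mulrDr mulr0 !mulrA w'w mul1r mulr_sumr => relw.
  rewrite -[RHS]relw big_map; congr (_ + _).
  by apply: eq_bigr => u _ /=; rewrite !mulrA.
have se1 : (size e1 <= n)%N by rewrite size_map.
clearbody e1 B'; move: e1 B' balB' rel1 se1 => {B balB w e les rel w0 w' w'w ww'} e B balB.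
have [allc|] := pselect (forall u, u \in e -> central u.1).
  move=> rel _; have /= := rel 1; rewrite mul1r /twosided => rel1.
  have -> : pairing B e = B 1 (\sum_(u <- e) u.1 * u.2).
    rewrite (bal_sumr balB) /pairing; apply: eq_big_seq => u ue.
    by rewrite -(balM balB) ?mul1r //; exact: allc.
  rewrite -(balDr balB).
  under eq_bigr do rewrite -[X in X * _]mulr1.
  by rewrite rel1 (bal0r balB).
move=> /existsNP[u0 /not_implyP[u0e /existsNP[a /eqP nca]]] rel se.
have [g [gK _]] : exists g, g * (a * u0.1 - u0.1 * a) = 1 /\
    (a * u0.1 - u0.1 * a) * g = 1.
  by apply: Ddiv; rewrite subr_eq0 eq_sym.
pose com (u : D * D) := a * u.1 - u.1 * a.
(* The commutator of the relation with [a]; the leading term drops out. *)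
pose e2 := [seq (com u, u.2) | u <- rem u0 e].
have lt_rem : (size (rem u0 e) < n)%N.
  by rewrite size_rem //; case: (e) u0e se.
have rel2 c : com u0 * c * u0.2 + twosided e2 c = 0.
  have ra := congr1 (fun x => a * x) (rel c); have rb := rel (a * c).
  rewrite /twosided big_map -(big_rem u0 (P := xpredT)
    (F := fun u : D * D => com u * c * u.2)) //=.
  transitivity (a * (c * v + twosided e c) - (a * c * v + twosided e (a * c))).
    rewrite mulrDr mulrA opprD addrACA subrr add0r /twosided mulr_sumr -sumrB.
    by apply: eq_bigr => u _; rewrite /com !mulrBl !mulrA.
  by rewrite ra rb mulr0 subrr.
(* Subtracting this multiple of the commutator removes the term of [u0]. *)
pose f (u : D * D) := u.1 - u0.1 * g * com u.
pose e4 := (1, v) :: [seq (f u, u.2) | u <- rem u0 e].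
have rem0 : pairing (fun x y => B (u0.1 * g * x) y) ((com u0, u0.2) :: e2) = 0.
  apply: IH; last exact: bal_mull.
    by rewrite /= size_map.
  by move=> c; rewrite /twosided big_cons.
have -> : B 1 v + pairing B e = pairing B e4.
  rewrite -[LHS]subr0 -rem0 /pairing (big_rem u0) //= !big_cons /= !big_map.
  rewrite -mulrA gK mulr1 -addrA opprD addrACA subrr add0r -sumrB.
  by congr (_ + _); apply: eq_bigr => u _; rewrite (balBl balB).
apply: IH balB; first by rewrite /= size_map.
move=> c; rewrite -[RHS](rel c) /twosided big_cons /= mul1r big_map.
congr (_ + _); rewrite [RHS](big_rem u0) //=.
have := rel2 c; rewrite /twosided big_map => /eqP; rewrite addr_eq0 => /eqP r2.
rewrite -[X in X * c * u0.2]mulr1 -gK.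
rewrite (_ : u0.1 * (g * _) * c * u0.2 = u0.1 * g * (com u0 * c * u0.2)); last first.
  by rewrite !mulrA.
rewrite r2 mulrN addrC mulr_sumr -sumrB; apply: eq_bigr => u _ /=.
by rewrite /f (mulrBl c) (mulrBl u.2) !mulrA.
Qed.

End Simplicity.

Lemma division_rreg (D : nzRingType) : division_ring D ->
  forall x y : D, x * y = 0 -> y != 0 -> x = 0.
Proof.
move=> Ddiv x y xy /Ddiv[z [_ yz]].
by rewrite -[x]mulr1 -yz mulrA xy mul0r.
Qed.

Lemma central_inv (D : nzRingType) (z y : D) :
  central z -> y * z = 1 -> z * y = 1 -> central y.
Proof.
move=> cz yz zy a.
by rewrite -[LHS]mulr1 -zy !mulrA -(mulrA y) -cz mulrA yz mul1r.
Qed.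

(** * Finite-dimensional division algebras *)

Section FiniteDimensional.
Variables (k : fieldType) (V : lmodType k) (n : nat) (v2r : V -> 'rV[k]_n).
Hypotheses (v2r_lin : linear v2r) (v2r_bij : bijective v2r).

HB.instance Definition _ := GRing.isLinear.Build k V 'rV[k]_n _ v2r v2r_lin.

Lemma v2r_inv : exists g, cancel v2r g /\ cancel g v2r.
Proof. by case: v2r_bij => g gK Kg; exists g. Qed.

Definition r2v : 'rV[k]_n -> V := sval (cid v2r_inv).
Let v2rK : cancel v2r r2v. Proof. exact: (proj1 (svalP (cid v2r_inv))). Qed.
Let r2vK : cancel r2v v2r. Proof. exact: (proj2 (svalP (cid v2r_inv))). Qed.

Lemma r2v_lin : linear r2v.
Proof. by move=> a u v; apply: (can_inj v2rK); rewrite linearP /= !r2vK. Qed.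

HB.instance Definition _ := GRing.isLinear.Build k 'rV[k]_n V _ r2v r2v_lin.

Lemma linear_matrix (f : V -> V) : linear f ->
  exists M : 'M_n, forall x, v2r (f x) = v2r x *m M.
Proof.
move=> lf; pose g u := v2r (f (r2v u)).
have lg : linear g by move=> a u v; rewrite /g linearP lf linearP.
pose G : {linear 'rV[k]_n -> 'rV[k]_n} :=
  HB.pack g (GRing.isLinear.Build _ _ _ _ g lg).
exists (lin1_mx G) => x; rewrite mul_rV_lin1 /G /= /g v2rK //.
Qed.

Lemma fd_inj_surj (f : V -> V) : linear f -> (forall x, f x = 0 -> x = 0) ->
  forall y, exists x, f x = y.
Proof.
move=> lf f0; have [M fM] := linear_matrix lf.
have fullM : row_full M.
  rewrite -[row_full M]/(row_free M) -kermx_eq0; apply/eqP/row_matrixP => i.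
  rewrite row0; have /sub_kermxP : (row i (kermx M) <= kermx M)%MS by exact: row_sub.
  rewrite -[row i _]r2vK -fM => /eqP; rewrite -(linear0 v2r) (can_eq v2rK).
  by move=> /eqP/f0 ->; rewrite ?linear0.
move=> y; have /submxP[w yw] := submx_full (v2r y) fullM.
exists (r2v w); apply: (can_inj v2rK).
by rewrite fM r2vK yw.
Qed.

(** A subset closed under linear combinations is the row space of a matrix of
    maximal rank among those whose rows lie in it. *)
Lemma fd_submx_predicate (W : V -> Prop) : W 0 ->
  (forall (c : k) x y, W x -> W y -> W (c *: x + y)) ->
  exists A : 'M_n, forall x, W x <-> (v2r x <= A)%MS.
Proof.
move=> W0 WD; pose P (A : 'M[k]_n) := forall x, (v2r x <= A)%MS -> W x.
have P0 : P 0.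
  move=> x; rewrite submx0 -(linear0 v2r) (can_eq v2rK) => /eqP ->; exact: W0.
pose Q r := `[< exists A, P A /\ \rank A = r >].
have [r /asboolP[A [PA rA]] maxr] : exists2 r, Q r & forall r', Q r' -> (r' <= r)%N.
  have exQ : exists r, Q r by exists 0%N; apply/asboolP; exists 0; rewrite mxrank0.
  have ubQ r : Q r -> (r <= n)%N by move=> /asboolP[A [_ <-]]; exact: rank_leq_col.
  by case: (ex_maxnP exQ ubQ) => r Qr maxr; exists r.
exists A => x; split=> [Wx|]; last exact: PA.
have PAx : P (A + v2r x)%MS.
  move=> y /sub_addsmxP[[u1 u2] /= yE].
  have -> : y = u2 0 0 *: x + r2v (u1 *m A).
    apply: (can_inj v2rK); rewrite yE linearP /= r2vK addrC; congr (_ + _).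
    by rewrite [u2]mx11_scalar mul_scalar_mx mxE eqxx.
  by apply: WD => //; apply: PA; rewrite r2vK submxMl.
have /maxr le_rk : Q (\rank (A + v2r x)%MS) by apply/asboolP; exists (A + v2r x)%MS.
have sA := addsmxSl A (v2r x).
have := (mxrank_leqif_sup sA).2; rewrite eqn_leq (mxrank_leqif_sup sA).1 rA le_rk.
by move=> /esym Ax; apply: submx_trans Ax; exact: addsmxSr.
Qed.

Lemma fd_spanning (W : V -> Prop) : W 0 ->
  (forall (c : k) x y, W x -> W y -> W (c *: x + y)) ->
  exists l : seq V, (forall x, x \in l -> W x) /\
    (forall (P : V -> Prop), P 0 ->
      (forall (c : k) x y, P x -> P y -> P (c *: x + y)) ->
      (forall x, x \in l -> P x) -> forall x, W x -> P x).
Proof.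
move=> W0 WD; have [A WA] := fd_submx_predicate W0 WD.
exists [seq r2v (row i A) | i <- enum 'I_n]; split=> [x /mapP[i _ ->]|P P0 PD Pl x].
  by apply/WA; rewrite r2vK row_sub.
move=> /WA/submxP[u xu].
have -> : x = \sum_i u 0 i *: r2v (row i A).
  by rewrite -[x]v2rK xu mulmx_sum_row linear_sum; under eq_bigr do rewrite linearZ.
elim: (index_enum _) => [|i s IH]; first by rewrite big_nil.
rewrite big_cons; apply: PD => //; apply: Pl; apply/mapP; exists i => //.
by rewrite mem_enum.
Qed.

Lemma fd_separate (x : V) : x != 0 ->
  exists l : V -> k, linear (l : V -> k^o) /\ l x != 0.
Proof.
move=> x0; have /rowP/existsNP[j xj] : v2r x <> 0.
  by move=> /eqP; rewrite -(linear0 v2r) (can_eq v2rK) (negbTE x0).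
exists (fun y => v2r y 0 j); split; last by apply/eqP; rewrite mxE in xj.
by move=> a u v; rewrite linearP !mxE.
Qed.

End FiniteDimensional.

Section CentralIdempotent.
Variables (k : fieldType) (D : algType k).
Hypothesis Dfd : finite_dim D.
Hypothesis Ddiv : division_ring D.

Lemma twosided_mull (e : seq (D * D)) a c :
  twosided [seq (a * u.1, u.2) | u <- e] c = a * twosided e c.
Proof.
rewrite /twosided big_map mulr_sumr; apply: eq_bigr => u _ /=.
by rewrite !mulrA.
Qed.

Lemma twosided_cat (e e' : seq (D * D)) c :
  twosided (e ++ e') c = twosided e c + twosided e' c.
Proof. by rewrite /twosided big_cat. Qed.

Lemma twosided_mulr (e : seq (D * D)) a c :
  twosided [seq (u.1, u.2 * a) | u <- e] c = twosided e c * a.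
Proof.
rewrite /twosided big_map mulr_suml; apply: eq_bigr => u _ /=.
by rewrite !mulrA.
Qed.

Lemma pairing_cat (V : zmodType) (B : D -> D -> V) e e' :
  pairing B (e ++ e') = pairing B e + pairing B e'.
Proof. by rewrite /pairing big_cat. Qed.

(** Among the nonzero operators of this form, one of minimal rank takes central
    values once it is scaled to take the value 1: composed with the commutator
    with [a] it loses rank, because that commutator kills 1, so the composition
    must vanish. *)
Lemma exists_projection_center : exists e : seq (D * D),
  (forall c, central (twosided e c)) /\ twosided e 1 = 1.
Proof.
have [n [[v2r v2r_lin v2r_bij]]] := Dfd.
have [r2v v2rK r2vK] := v2r_bij.
have v0 : v2r 0 = 0 by exact: linear_at0 v2r_lin.
have v_eq0 x : (v2r x == 0) = (x == 0) by rewrite -v0 (can_eq v2rK).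
suff /(_ n [:: (1, 1)] 1%:M) : forall r e (M : 'M[k]_n),
    (\rank M <= r)%N -> (forall c, v2r (twosided e c) = v2r c *m M) ->
    (exists c, twosided e c != 0) ->
  exists e : seq (D * D), (forall c, central (twosided e c)) /\ twosided e 1 = 1.
  apply; first exact: rank_leq_row.
    by move=> c; rewrite /twosided big_seq1 mul1r mulr1 mulmx1.
  by exists 1; rewrite /twosided big_seq1 !mulr1 oner_eq0.
elim=> [|r IH] e M rM eM [c0 ec0].
  move: rM; rewrite leqn0 mxrank_eq0 => /eqP M0.
  by have /eqP := eM c0; rewrite M0 mulmx0 v_eq0 (negbTE ec0).
have [g [gK _]] := Ddiv ec0.
have [cen|/existsNP[c /existsNP[a nca]]] :=
  pselect (forall c, central (g * twosided e c)).
  exists [seq (g * u.1 * c0, u.2) | u <- e]; split=> [c|].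
    rewrite (_ : twosided _ c = g * twosided e (c0 * c)) //.
    rewrite -twosided_mull /twosided !big_map; apply: eq_bigr => u _ /=.
    by rewrite !mulrA.
  rewrite -[RHS]gK -twosided_mull /twosided !big_map; apply: eq_bigr => u _ /=.
  by rewrite mulr1.
pose e1 := [seq (g * u.1, u.2) | u <- e].
pose e2 := [seq (a * u.1, u.2) | u <- e1] ++ [seq (u.1, u.2 * - a) | u <- e1].
have e2E x : twosided e2 x = a * (g * twosided e x) - g * twosided e x * a.
  by rewrite twosided_cat twosided_mull twosided_mulr twosided_mull mulrN.
pose h x := a * (g * x) - g * x * a.
have h_lin : linear h.
  move=> t x y; rewrite /h !(mulrDr, mulrDl) -!(scalerAr, scalerAl) scalerBr.
  by rewrite opprD addrACA.
have [N hN] := linear_matrix v2r_lin v2r_bij h_lin.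
apply: (IH e2 (M *m N)); first last.
- by exists c; rewrite e2E subr_eq0; apply/eqP => /esym.
- by move=> x; rewrite e2E -[X in v2r X]/(h _) hN eM mulmxA.
have := mxrank_mul_ker M N => rk.
suff : (0 < \rank (M :&: kermx N)%MS)%N.
  by move=> lt0; rewrite -ltnS; apply: leq_trans rM; rewrite -rk -addn1 leq_add2l.
rewrite lt0n mxrank_eq0; apply/negP => /eqP cap0.
have : (v2r (twosided e c0) <= M :&: kermx N)%MS.
  rewrite sub_capmx eM submxMl /=; apply/sub_kermxP.
  by rewrite -eM -hN /h gK mulr1 mul1r subrr.
by rewrite cap0 submx0 v_eq0 (negbTE ec0).
Qed.

(** As an operator, a e - e a is the commutator of [a] with a central value,
    hence zero; [twosided_faithful] turns this into an identity of tensors. *)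
Lemma projection_casimir (e : seq (D * D)) :
  (forall c, central (twosided e c)) ->
  forall (V : zmodType) (B : D -> D -> V), balanced (@central D) B ->
  forall a, pairing (fun x y => B (a * x) y) e = pairing (fun x y => B x (y * a)) e.
Proof.
move=> cen V B balB a.
pose e' := [seq (- a * u.1, u.2) | u <- e] ++ [seq (u.1, u.2 * a) | u <- e].
have : pairing B e' = 0.
  apply: (twosided_faithful Ddiv) balB => c.
  by rewrite twosided_cat twosided_mull twosided_mulr mulNr cen addNr.
rewrite pairing_cat /pairing !big_map /= => /eqP; rewrite addrC addr_eq0 => /eqP ->.
by rewrite -sumrN; apply: eq_bigr => u _; rewrite mulNr (balNl balB) opprK.
Qed.

(** The map c |-> sum y c x, for the tensor of [exists_projection_center],
    takes the same value on a b and b a by [projection_casimir].  It is nonzero,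
    since otherwise the flipped tensor, and with it the tensor, would vanish by
    [twosided_faithful]. *)
Lemma symmetric_form : exists l : D -> k,
  [/\ linear (l : D -> k^o), forall a b, l (a * b) = l (b * a)
    & exists c, l c != 0].
Proof.
have [e [cen e1]] := exists_projection_center.
pose N c := \sum_(u <- e) u.2 * c * u.1.
have N_lin : linear N.
  move=> c x y; rewrite /N scaler_sumr -big_split /=; apply: eq_bigr => u _.
  by rewrite mulrDr mulrDl -scalerAr -scalerAl.
have balN c : balanced (@central D) (fun x y : D => y * c * x).
  split=> [x x' y|x y y'|z cz x y]; rewrite ?mulrDr ?mulrDl //.
  by rewrite -!mulrA cz !mulrA.
have NC a b : N (a * b) = N (b * a).
  have := projection_casimir cen (balN a) b; rewrite /pairing /N => h.
  transitivity (\sum_(u <- e) u.2 * a * (b * u.1)).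
    by apply: eq_bigr => u _; rewrite !mulrA.
  by rewrite h; apply: eq_bigr => u _; rewrite !mulrA.
have [c Nc] : exists c, N c != 0.
  apply/not_existsP => N0; pose e' := [seq (u.2, u.1) | u <- e].
  have : pairing (fun x y : D => y * 1 * x) e' = 0.
    apply: (twosided_faithful Ddiv) (balN 1) => c.
    by rewrite /twosided big_map; apply/eqP/negPn/negP/N0.
  by rewrite /pairing big_map; move: e1; rewrite /twosided => -> /eqP; rewrite oner_eq0.
have [n [[v2r v2r_lin v2r_bij]]] := Dfd.
have [l [l_lin lN]] := fd_separate v2r_lin v2r_bij Nc.
exists (fun x => l (N x)); split; last by exists c.
  by move=> t x y; rewrite N_lin l_lin.
by move=> a b; rewrite NC.
Qed.

(** For [l] nonzero, a |-> l (- * a) is an injection of D into its dual, a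
    space of the same dimension. *)
Lemma form_scale (l : D -> k) : linear (l : D -> k^o) -> (exists c, l c != 0) ->
  forall m : D -> k, linear (m : D -> k^o) -> exists a, forall c, m c = l (c * a).
Proof.
move=> l_lin [c0 lc0] m m_lin.
have [n [[v2r v2r_lin v2r_bij]]] := Dfd.
have [r2v v2rK r2vK] := v2r_bij.
have l0 : l 0 = 0 by exact: linear_at0 l_lin.
have r_lin : linear r2v by move=> a u w; apply: (can_inj v2rK); rewrite v2r_lin !r2vK.
pose f a : D := r2v (\row_j l (r2v (delta_mx 0 j) * a)).
have f_lin : linear f.
  move=> t x y; rewrite /f -r_lin; congr r2v; apply/rowP => j.
  by rewrite !mxE mulrDr -scalerAr l_lin.
have expand (F : D -> k) : linear (F : D -> k^o) ->
    forall x, F x = \sum_j v2r x 0 j * F (r2v (delta_mx 0 j)).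
  move=> F_lin x; rewrite -[x in LHS]v2rK [v2r x in LHS]row_sum_delta.
  have F0 : F 0 = 0 by exact: linear_at0 F_lin.
  have r0 : r2v 0 = 0 by exact: linear_at0 r_lin.
  elim: (index_enum _) => [|i s IH]; first by rewrite !big_nil r0 F0.
  by rewrite !big_cons r_lin F_lin IH.
have mul_lin a : linear ((fun c => l (c * a)) : D -> k^o).
  by move=> t x y; rewrite mulrDl -scalerAl l_lin.
have f_inj a : f a = 0 -> a = 0.
  move=> fa; apply/eqP/negPn/negP => /Ddiv[b [ba _]].
  have : l (c0 * b * a) = 0.
    rewrite (expand _ (mul_lin a)) big1 // => j _.
    have /rowP/(_ j) : v2r (f a) = 0.
      rewrite fa; exact: linear_at0.
    by rewrite /f r2vK !mxE => ->; rewrite mulr0.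
  by rewrite -mulrA ba mulr1 => /eqP; rewrite (negbTE lc0).
have [a fa] := fd_inj_surj v2r_lin v2r_bij f_lin f_inj
  (r2v (\row_j m (r2v (delta_mx 0 j)))).
exists a => c; rewrite (expand _ m_lin) (expand _ (mul_lin a)).
apply: eq_bigr => j _; congr (_ * _).
by have /rowP/(_ j) := can_inj r2vK fa; rewrite !mxE.
Qed.

(** With a symmetric form l one has m = l (- * u) for some u; the Nakayama
    automorphism of m is then conjugation by u. *)
Lemma nakayama_inner (m : D -> k) (th : D -> D) :
  linear (m : D -> k^o) -> (exists c, m c != 0) ->
  (forall a d, m (a * th d) = m (d * a)) ->
  exists2 u, u != 0 & forall d, th d * u = u * d.
Proof.
move=> m_lin [c mc] mth; have [l [l_lin lC l0]] := symmetric_form.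
have [u mE] := form_scale l_lin l0 m_lin.
have lz : l 0 = 0 by exact: linear_at0 l_lin.
exists u => [|d].
  by apply: contra_neq mc => u0; rewrite mE u0 mulr0 lz.
apply/eqP; rewrite -subr_eq0; apply/negPn/negP => /Ddiv[g [gK _]].
have [c0 /negP[]] := l0; apply/eqP.
have lN x y : l (-1 *: y + x) = l x - l y by rewrite l_lin scaleN1r addrC.
have lB x y : l (x - y) = l x - l y.
  by rewrite -lN scaleN1r addrC.
rewrite -[c0]mulr1 -gK mulrA mulrBr lB; apply/eqP; rewrite subr_eq0.
by rewrite !mulrA -mE mth mE -!mulrA lC !mulrA.
Qed.

End CentralIdempotent.

Lemma iota0E n : iota 0 n = index_iota 0 n.
Proof. by rewrite /index_iota subn0. Qed.

(** * Separability over a perfect field *)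

Definition scalars (k : fieldType) (D : algType k) (z : D) : Prop :=
  exists c : k, z = c%:A.

(** The insertion of the tensor [e] between the two arguments of [B]; if [e] is
    Casimir for the elements of a set, the result is balanced over that set. *)
Definition average (D : nzRingType) (V : zmodType) (e : seq (D * D))
    (B : D -> D -> V) (x y : D) : V :=
  \sum_(u <- e) B (x * u.1) (u.2 * y).

Definition unital (D : nzRingType) (e : seq (D * D)) : Prop :=
  \sum_(u <- e) u.1 * u.2 = 1.

Definition comp_pairs (D : nzRingType) (e e' : seq (D * D)) : seq (D * D) :=
  [seq (u.1 * w.1, w.2 * u.2) | u <- e, w <- e'].

Section Averaging.
Variable D : nzRingType.
Implicit Type e : seq (D * D).

Definition central_pairs e : Prop :=
  forall u, u \in e -> central u.1 /\ central u.2.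

Lemma central_mul (x y : D) : central x -> central y -> central (x * y).
Proof. by move=> cx cy a; rewrite -mulrA cy !mulrA cx. Qed.

Lemma average_comp (V : zmodType) e e' (B : D -> D -> V) :
  average (comp_pairs e e') B = average e (average e' B).
Proof.
apply/funext => x; apply/funext => y; rewrite /average big_allpairs_dep.
by apply: eq_bigr => u _; apply: eq_bigr => w _; rewrite /= !mulrA.
Qed.

Lemma unital_comp e e' : unital e -> unital e' -> unital (comp_pairs e e').
Proof.
rewrite /unital => ue ue'; rewrite big_allpairs_dep -[RHS]ue.
apply: eq_bigr => u _; rewrite /= -[u.1 in RHS]mulr1 -ue' mulr_sumr mulr_suml.
by apply: eq_bigr => w _; rewrite !mulrA.
Qed.

Lemma central_comp e e' :
  central_pairs e -> central_pairs e' -> central_pairs (comp_pairs e e').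
Proof.
move=> ce ce' v /allpairsP[[u w] /= [/ce[cu1 cu2] /ce'[cw1 cw2] ->]] /=.
by split; apply: central_mul.
Qed.

Lemma average_balanced (V : zmodType) e (B : D -> D -> V) (Z : D -> Prop) :
  central_pairs e -> balanced Z B -> balanced Z (average e B).
Proof.
move=> ce balB; split=> [x x' y|x y y'|z Zz x y]; rewrite /average -?big_split /=.
- by apply: eq_bigr => u _; rewrite mulrDl (balDl balB).
- by apply: eq_bigr => u _; rewrite mulrDr (balDr balB).
apply: eq_big_seq => u /ce[cu1 cu2].
by rewrite -mulrA -cu1 mulrA (balM balB) // mulrA -cu2 mulrA.
Qed.

End Averaging.

Section Separability.
Variables (k : fieldType) (k_perfect : perfect_field k) (D : algType k).
Hypothesis Dfd : finite_dim D.
Hypothesis Ddiv : division_ring D.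

Lemma horner_algE (a : D) (p : {poly k}) :
  horner_alg a p = \sum_(i < size p) p`_i *: a ^+ i.
Proof.
rewrite -[p in LHS]coefK poly_def linear_sum; apply: eq_bigr => i _.
by rewrite linearZ rmorphXn /= horner_algX mulr_algl.
Qed.

Lemma algebraic (a : D) : exists p : {poly k}, p != 0 /\ horner_alg a p = 0.
Proof.
have [n [[v2r v2r_lin v2r_bij]]] := Dfd.
have v0 := linear_at0 v2r_lin.
pose M : 'M[k]_(n.+1, n) := \matrix_(i < n.+1) v2r (a ^+ i).
have /rowV0Pn[u uM u0] : kermx M != 0.
  rewrite kermx_eq0 /row_free; apply/negP => /eqP rM.
  by have := rank_leq_col M; rewrite rM ltnn.
exists (rVpoly u); split; first by apply: contra_neq u0 => ru; rewrite -[u]rVpolyK ru linear0.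
apply: (bij_inj v2r_bij); rewrite v0 -[RHS](sub_kermxP uM) mulmx_sum_row.
rewrite /rVpoly poly_def linear_sum /=.
elim: (index_enum _) => [|i s IH]; first by rewrite !big_nil v0.
rewrite !big_cons linearZ rmorphXn /= horner_algX mulr_algl v2r_lin IH rowK.
by rewrite insubT //= => lt_i; congr (u _ _ *: _ + _); apply: val_inj.
Qed.

Lemma minimal_polynomial (a : D) :
  exists p : {poly k}, irreducible_poly p /\ horner_alg a p = 0.
Proof.
have [p0 [p0n0 p0a]] := algebraic a.
pose Q r := `[< exists p : {poly k}, [/\ p != 0, horner_alg a p = 0 & size p = r] >].
have exQ : exists r, Q r by exists (size p0); apply/asboolP; exists p0.
case: (ex_minnP exQ) => r /asboolP[p [pn0 pa <-]] minp.
have {}minp q : q != 0 -> horner_alg a q = 0 -> (size p <= size q)%N.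
  by move=> qn0 qa; apply: minp; apply/asboolP; exists q.
exists p; split=> //; split=> [|q sq1 qp].
  rewrite ltn_neqAle lt0n size_poly_eq0 pn0 andbT eq_sym; apply/negP => /size_poly1P.
  move=> [c c0 pE]; move: pa; rewrite pE horner_algC => /eqP.
  by rewrite scaler_eq0 (negbTE c0) oner_eq0.
have qn0 : q != 0 by apply: contraNneq pn0 => q0; move: qp; rewrite q0 dvd0p.
rewrite -dvdp_size_eqp // eqn_leq dvdp_leq //=.
have /dvdpP[s ps] := qp; have sn0 : s != 0.
  by apply: contraNneq pn0 => s0; rewrite ps s0 mul0r.
move: pa; rewrite ps rmorphM /= -ps.
have [/eqP qa _|qa sq] := boolP (horner_alg a q == 0); first exact: minp.
have {qa sq}/(minp _ sn0) := division_rreg Ddiv sq qa.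
rewrite {1}ps size_mul //.
have : (0 < size q)%N by rewrite lt0n size_poly_eq0.
by case: (size q) sq1 => [|[|m]] // _ _; rewrite addnS /= -{2}[size s]addn0 leq_add2l.
Qed.

(** Let f be the minimal polynomial of a.  The divided difference
    (f(X) - f(Y)) / (X - Y), evaluated at a (x) 1 and 1 (x) a, is annihilated
    by a (x) 1 - 1 (x) a and has product f'(a), which is invertible because f
    is separable. *)
Lemma central_separable (a : D) : central a ->
  exists e : seq (D * D), [/\ central_pairs e, unital e &
    forall (V : zmodType) (B : D -> D -> V), balanced (@scalars k D) B ->
    forall x y, average e B (x * a) y = average e B x (a * y)].
Proof.
move=> ca; have [p [irr_p pa]] := minimal_polynomial a.
have dpa : horner_alg a p^`() != 0.
  have := k_perfect irr_p; rewrite separable_poly.unlock.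
  move=> /Bezout_coprimepP[[u v] /= /eqpP[[c d] /= /andP[c0 d0] uv]].
  apply/eqP => dpa; have := congr1 (horner_alg a) uv.
  rewrite !linearZ rmorphD !rmorphM /= !mulr_algl pa dpa !mulr0 addr0 scaler0 rmorph1 => /esym/eqP.
  by rewrite scaler_eq0 (negbTE d0) oner_eq0.
have cX i : central (a ^+ i).
  by elim: i => [|i IH]; [move=> b; rewrite mul1r mulr1|rewrite exprS; apply: central_mul].
have cZ c (x : D) : central x -> central (c *: x).
  by move=> cx b; rewrite -scalerAl cx scalerAr.
have chorner q : central (horner_alg a q).
  rewrite horner_algE => b; rewrite mulr_suml mulr_sumr; apply: eq_bigr => i _.
  exact: (cZ _ _ (cX i)).
have [g [gl gr]] := Ddiv dpa; have cg := central_inv (chorner _) gl gr.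
(* The divided difference, divided by the derivative at [a]. *)
pose e := [seq (p`_i *: a ^+ j * g, a ^+ (i - j.+1)) | i <- iota 0 (size p), j <- iota 0 i].
exists e; split.
- move=> u /allpairsPdep[i [j [_ _ ->]]] /=; split; last exact: cX.
  by apply: central_mul => //; apply: cZ.
- rewrite /unital big_allpairs_dep -[RHS]gr.
  have -> : p^`() = \sum_(i < size p) p`_i *: ('X^(i.-1) *+ i).
    rewrite -[p in LHS]coefK poly_def linear_sum; apply: eq_bigr => i _.
    by rewrite linearZ /= derivXn.
  rewrite linear_sum mulr_suml iota0E big_mkord.
  apply: eq_bigr => i _; rewrite linearZ /= raddfMn /= rmorphXn /= horner_algX mulr_algl.
  rewrite iota0E big_mkord.
  transitivity (\sum_(j < i) (p`_i *: a ^+ i.-1 * g)).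
    apply: eq_bigr => j _ /=; rewrite -mulrA cg mulrA -scalerAl -exprD.
    by rewrite subnS -!subn1 subnAC subnKC // subn1 -ltnS prednK // (leq_ltn_trans _ (ltn_ord j)).
  by rewrite sumr_const card_ord -mulrnAl -scalerMnr.
move=> V B balB x y; apply/eqP; rewrite -subr_eq0; apply/eqP.
rewrite /average !big_allpairs_dep -sumrB /=.
pose G i j := B (x * (p`_i *: a ^+ j * g)) (a ^+ (i - j) * y).
transitivity (\sum_(i <- iota 0 (size p)) (G i i - G i 0%N)).
  apply: eq_bigr => i _; rewrite -sumrB iota0E.
  rewrite -telescope_sumr //; apply: eq_big_nat => j /andP[_ ltji].
  rewrite /G; congr (B _ _ - B _ _).
    by rewrite -mulrA [a * _]mulrA -scalerAr -exprS.
  by rewrite mulrA -exprSr subnSK.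
rewrite sumrB iota0E !big_mkord /G.
have -> : \sum_(i < size p) B (x * (p`_i *: a ^+ i * g)) (a ^+ (i - i) * y) = 0.
  under eq_bigr do rewrite subnn expr0 mul1r.
  rewrite -(bal_suml balB) -mulr_sumr -mulr_suml -horner_algE pa mul0r mulr0.
  exact: bal0l balB _.
have -> : \sum_(i < size p) B (x * (p`_i *: a ^+ 0 * g)) (a ^+ (i - 0) * y) = 0.
  transitivity (\sum_(i < size p) B (x * g) (p`_i *: a ^+ i * y)).
    apply: eq_bigr => i _; rewrite subn0 expr0 -scalerAl mul1r -scalerAr.
    rewrite -mulr_algr (balM balB); last by exists p`_i.
    by rewrite mulrA mulr_algl.
  rewrite -(bal_sumr balB) -mulr_suml -horner_algE pa mul0r.
  exact: bal0r balB _.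
by rewrite subrr.
Qed.

(** Averaging successively over a finite set spanning the center: each average
    keeps the balance already achieved, because its entries are central. *)
Lemma center_separable : exists e : seq (D * D), unital e /\
  forall (V : zmodType) (B : D -> D -> V), balanced (@scalars k D) B ->
    balanced (@central D) (average e B).
Proof.
have [n [[v2r v2r_lin v2r_bij]]] := Dfd.
have [l [cl span]] : exists l : seq D, (forall x, x \in l -> central x) /\
    (forall (P : D -> Prop), P 0 ->
      (forall (c : k) x y, P x -> P y -> P (c *: x + y)) ->
      (forall x, x \in l -> P x) -> forall x, central x -> P x).
  apply: (fd_spanning v2r_lin v2r_bij) => [b|c x y cx cy b].
    by rewrite mul0r mulr0.
  by rewrite mulrDl mulrDr -scalerAl -scalerAr cx cy.
have [e [ce ue eB]] : exists e : seq (D * D), [/\ central_pairs e, unital e &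
    forall (V : zmodType) (B : D -> D -> V), balanced (@scalars k D) B ->
    forall a, a \in l -> forall x y, average e B (x * a) y = average e B x (a * y)].
  elim: l cl {span} => [_|a l IH cl].
    exists [:: (1, 1)]; split=> [u|| V B _ a //].
      by rewrite inE => /eqP -> /=; split=> b; rewrite mulr1 mul1r.
    by rewrite /unital big_seq1 mulr1.
  have [|e [ce ue eB]] := IH; first by move=> x xl; apply: cl; rewrite inE xl orbT.
  have [e' [ce' ue' eB']] := central_separable (cl a (mem_head _ _)).
  exists (comp_pairs e e'); split; [exact: central_comp|exact: unital_comp|].
  move=> V B balB b; rewrite inE => /orP[/eqP ->|bl] x y; rewrite average_comp.
    have bal' : balanced (fun z => z = a) (average e' B).
      have := average_balanced ce' balB; case=> Dl Dr _.
      by split=> // z -> {}x {}y; apply: eB'.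
    by have := balM (average_balanced ce bal'); apply.
  by apply: eB => //; apply: average_balanced.
exists e; split=> // V B balB.
have balE := average_balanced ce balB.
split; [exact: balDl balE|exact: balDr balE|].
apply: span.
- by move=> x y; rewrite mulr0 mul0r (bal0l balE) (bal0r balE).
- move=> c z z' Pz Pz' x y.
  rewrite mulrDr mulrDl (balDl balE) (balDr balE) Pz'; congr (_ + _).
  rewrite -[x * _]scalerAr [c *: _ in LHS]scalerAl Pz -[c *: x]mulr_algr.
  by rewrite (balM balE) ?mulr_algl ?scalerAl //; exists c.
- by move=> z zl x y; apply: eB.
Qed.

(** The tensor is a separability idempotent of D over k.  It combines the one of
    the center over k with the one of D over its center. *)
Theorem separable_division_algebra : exists e : seq (D * D), unital e /\
  forall (V : zmodType) (B : D -> D -> V), balanced (@scalars k D) B ->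
  forall a, pairing (fun x y => B (a * x) y) e = pairing (fun x y => B x (y * a)) e.
Proof.
have [e [cen e1]] := exists_projection_center Dfd Ddiv.
have [e' [ue' balE]] := center_separable.
exists (comp_pairs e e'); split.
  apply: unital_comp => //; rewrite /unital -[RHS]e1 /twosided.
  by apply: eq_bigr => u _; rewrite mulr1.
move=> V B balB a; have := projection_casimir Ddiv cen (balE _ _ balB) a.
rewrite /pairing /average !big_allpairs_dep => h.
transitivity (\sum_(u <- e) \sum_(w <- e') B (a * u.1 * w.1) (w.2 * u.2)).
  by apply: eq_bigr => u _; apply: eq_bigr => w _; rewrite /= mulrA.
by rewrite h; apply: eq_bigr => u _; apply: eq_bigr => w _; rewrite /= mulrA.
Qed.

End Separability.

(** * Linear and abelian categories *)

Section LinearCategory.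
Variables (k : fieldType) (C : lincat k).
Implicit Types X Y Z W : C.

Lemma compDl X Y Z (g g' : hom Y Z) (f : hom X Y) :
  (g + g') \oc f = g \oc f + g' \oc f.
Proof. by have := comp_linearl f 1 g g'; rewrite !scale1r. Qed.

Lemma compDr X Y Z (g : hom Y Z) (f f' : hom X Y) :
  g \oc (f + f') = g \oc f + g \oc f'.
Proof. by have := comp_linearr g 1 f f'; rewrite !scale1r. Qed.

Lemma comp0l X Y Z (f : hom X Y) : (0 : hom Y Z) \oc f = 0.
Proof. by apply: (addrI (0 \oc f)); rewrite -compDl !addr0. Qed.

Lemma comp0r X Y Z (g : hom Y Z) : g \oc (0 : hom X Y) = 0.
Proof. by apply: (addrI (g \oc 0)); rewrite -compDr !addr0. Qed.

Lemma compNl X Y Z (g : hom Y Z) (f : hom X Y) : (- g) \oc f = - (g \oc f).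
Proof. by apply: (addrI (g \oc f)); rewrite -compDl !subrr comp0l. Qed.

Lemma compNr X Y Z (g : hom Y Z) (f : hom X Y) : g \oc (- f) = - (g \oc f).
Proof. by apply: (addrI (g \oc f)); rewrite -compDr !subrr comp0r. Qed.

Lemma compBl X Y Z (g g' : hom Y Z) (f : hom X Y) :
  (g - g') \oc f = g \oc f - g' \oc f.
Proof. by rewrite compDl compNl. Qed.

Lemma compBr X Y Z (g : hom Y Z) (f f' : hom X Y) :
  g \oc (f - f') = g \oc f - g \oc f'.
Proof. by rewrite compDr compNr. Qed.

Lemma compZl X Y Z c (g : hom Y Z) (f : hom X Y) : (c *: g) \oc f = c *: (g \oc f).
Proof. by have := comp_linearl f c g 0; rewrite comp0l !addr0. Qed.

Lemma compZr X Y Z c (g : hom Y Z) (f : hom X Y) : g \oc (c *: f) = c *: (g \oc f).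
Proof. by have := comp_linearr g c f 0; rewrite comp0r !addr0. Qed.

Lemma comp_suml X Y Z (I : Type) (r : seq I) (P : pred I) (g : I -> hom Y Z)
    (f : hom X Y) :
  (\sum_(i <- r | P i) g i) \oc f = \sum_(i <- r | P i) (g i \oc f).
Proof.
elim: r => [|i r IH]; rewrite ?big_nil ?comp0l // !big_cons.
by case: (P i); rewrite ?compDl IH.
Qed.

Lemma comp_sumr X Y Z (I : Type) (r : seq I) (P : pred I) (g : hom Y Z)
    (f : I -> hom X Y) :
  g \oc (\sum_(i <- r | P i) f i) = \sum_(i <- r | P i) (g \oc f i).
Proof.
elim: r => [|i r IH]; rewrite ?big_nil ?comp0r // !big_cons.
by case: (P i); rewrite ?compDr IH.
Qed.

Lemma zero_hom_to X Y (f : hom X Y) : zero_object Y -> f = 0.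
Proof. by move=> zY; rewrite -(comp1m f) zY comp0l. Qed.

Lemma zero_hom_from X Y (f : hom X Y) : zero_object X -> f = 0.
Proof. by move=> zX; rewrite -(compm1 f) zX comp0r. Qed.

Lemma mono0P X Y (f : hom X Y) :
  (forall Z (g : hom Z X), f \oc g = 0 -> g = 0) -> mono f.
Proof.
move=> f0 Z g h fgh; apply/eqP; rewrite -subr_eq0; apply/eqP; apply: f0.
by rewrite compBr fgh subrr.
Qed.

Lemma epi0P X Y (f : hom X Y) :
  (forall Z (g : hom Y Z), g \oc f = 0 -> g = 0) -> epi f.
Proof.
move=> f0 Z g h fgh; apply/eqP; rewrite -subr_eq0; apply/eqP; apply: f0.
by rewrite compBl fgh subrr.
Qed.

Lemma mono_eq0 X Y Z (f : hom X Y) (g : hom Z X) : mono f -> f \oc g = 0 -> g = 0.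
Proof. by move=> mf fg; apply: mf; rewrite fg comp0r. Qed.

Lemma epi_eq0 X Y Z (f : hom X Y) (g : hom Y Z) : epi f -> g \oc f = 0 -> g = 0.
Proof. by move=> ef gf; apply: ef; rewrite gf comp0l. Qed.

Lemma mono_comp X Y Z (g : hom Y Z) (f : hom X Y) : mono g -> mono f -> mono (g \oc f).
Proof. by move=> mg mf W a b; rewrite -!compmA => /mg/mf. Qed.

Lemma epi_comp X Y Z (g : hom Y Z) (f : hom X Y) : epi g -> epi f -> epi (g \oc f).
Proof. by move=> eg ef W a b; rewrite !compmA => /ef/eg. Qed.

Lemma epi_right X Y Z (g : hom Y Z) (f : hom X Y) : epi (g \oc f) -> epi g.
Proof. by move=> e W a b ab; apply: e; rewrite !compmA ab. Qed.

Lemma iso_id X : isomorphism (idm X).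
Proof. by exists (idm X); rewrite comp1m. Qed.

Lemma iso_mono X Y (f : hom X Y) : isomorphism f -> mono f.
Proof.
move=> [g [gf _]] Z a b /(congr1 (fun h => g \oc h)).
by rewrite !compmA gf !comp1m.
Qed.

Lemma iso_epi X Y (f : hom X Y) : isomorphism f -> epi f.
Proof.
move=> [g [_ fg]] Z a b /(congr1 (fun h => h \oc g)).
by rewrite -!compmA fg !compm1.
Qed.

Lemma iso_inv X Y (f : hom X Y) : isomorphism f ->
  exists g : hom Y X, [/\ isomorphism g, g \oc f = idm X & f \oc g = idm Y].
Proof. by move=> [g [gf fg]]; exists g; split=> //; exists f. Qed.

Lemma iso_comp X Y Z (g : hom Y Z) (f : hom X Y) :
  isomorphism g -> isomorphism f -> isomorphism (g \oc f).
Proof.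
move=> [g' [g'g gg']] [f' [f'f ff']]; exists (f' \oc g'); split.
  by rewrite compmA -(compmA f') g'g compm1.
by rewrite compmA -(compmA g) ff' compm1.
Qed.

Lemma isomorphic_sym X Y : isomorphic X Y -> isomorphic Y X.
Proof. by move=> [f /iso_inv[g [ig _ _]]]; exists g. Qed.

Lemma isomorphic_trans X Y Z : isomorphic X Y -> isomorphic Y Z -> isomorphic X Z.
Proof. by move=> [f jf] [g ig]; exists (g \oc f); apply: iso_comp. Qed.

Lemma kernel_mono X Y (f : hom X Y) K (i : hom K X) : is_kernel f i -> mono i.
Proof.
move=> [fi ki] Z g h gh.
have [|u [_ uu]] := ki Z (i \oc g); first by rewrite compmA fi comp0l.
by rewrite -(uu g) // -(uu h).
Qed.

Lemma cokernel_epi X Y (f : hom X Y) K (p : hom Y K) : is_cokernel f p -> epi p.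
Proof.
move=> [pf kp] Z g h gh.
have [|u [_ uu]] := kp Z (g \oc p); first by rewrite -compmA pf comp0r.
by rewrite -(uu g) // -(uu h).
Qed.

Lemma kernel_intro X Y (f : hom X Y) K (i : hom K X) : f \oc i = 0 -> mono i ->
  (forall Z (g : hom Z X), f \oc g = 0 -> exists h, i \oc h = g) -> is_kernel f i.
Proof.
move=> fi mi li; split=> // Z g /li[h hg]; exists h; split=> // h' h'g.
by apply: mi; rewrite h'g.
Qed.

Lemma cokernel_intro X Y (f : hom X Y) K (p : hom Y K) : p \oc f = 0 -> epi p ->
  (forall Z (g : hom Y Z), g \oc f = 0 -> exists h, h \oc p = g) -> is_cokernel f p.
Proof.
move=> pf ep lp; split=> // Z g /lp[h hg]; exists h; split=> // h' h'g.
by apply: ep; rewrite h'g.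
Qed.

Section ShortExact.
Variables (A X B : C) (i : hom A X) (p : hom X B).
Hypothesis ex : short_exact i p.

Lemma se_comp0 : p \oc i = 0. Proof. by case: ex => [[]]. Qed.
Lemma se_mono : mono i. Proof. by case: ex => /kernel_mono. Qed.
Lemma se_epi : epi p. Proof. by case: ex => _ /cokernel_epi. Qed.

Lemma se_lift Z (g : hom Z X) : p \oc g = 0 -> exists h, i \oc h = g.
Proof. by case: ex => [[_ ki] _] /ki[h [hg _]]; exists h. Qed.

Lemma se_desc Z (g : hom X Z) : g \oc i = 0 -> exists h, h \oc p = g.
Proof. by case: ex => [_ [_ kp]] /kp[h [hg _]]; exists h. Qed.

Lemma se_split_retraction (s : hom X A) : s \oc i = idm A ->
  exists r : hom B X, p \oc r = idm B.
Proof.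
move=> si; have [|r rp] := @se_desc X (idm X - i \oc s).
  by rewrite compBl comp1m -compmA si compm1 subrr.
exists r; apply: se_epi.
by rewrite -compmA rp compBr compm1 compmA se_comp0 comp0l subr0 comp1m.
Qed.

Lemma se_iso_quotient B' (u : hom B B') : isomorphism u -> short_exact i (u \oc p).
Proof.
move=> iu; have [v [_ vu uv]] := iso_inv iu; split.
  apply: kernel_intro; [by rewrite -compmA se_comp0 comp0r|exact: se_mono|].
  by move=> Z g; rewrite -compmA => /(mono_eq0 (iso_mono iu))/se_lift.
apply: cokernel_intro; first by rewrite -compmA se_comp0 comp0r.
  by apply: epi_comp se_epi; apply: iso_epi.
move=> Z g /se_desc[h hp]; exists (h \oc v).
by rewrite compmA -(compmA h) vu compm1.
Qed.

End ShortExact.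

Lemma simple_nonzero X : simple_object X -> idm X <> 0.
Proof. by case. Qed.

End LinearCategory.

Section AbelianCategory.
Variables (k : fieldType) (C : lincat k).
Hypothesis abC : abelian_category C.
Implicit Types X Y Z W : C.

Lemma has_zero : exists Z : C, zero_object Z. Proof. by case: abC. Qed.
Lemma has_sum X Y : exists B, direct_sum X Y B. Proof. by case: abC => _ []. Qed.
Lemma has_kernel X Y (f : hom X Y) : exists (K : C) (i : hom K X), is_kernel f i.
Proof. by case: abC => _ [_ []]. Qed.
Lemma has_cokernel X Y (f : hom X Y) : exists (K : C) (p : hom Y K), is_cokernel f p.
Proof. by case: abC => _ [_ [_ []]]. Qed.

Lemma mono_is_kernel X Y (f : hom X Y) : mono f ->
  exists Z (g : hom Y Z), is_kernel g f.
Proof. by case: abC => _ [_ [_ [_ [h _]]]]; apply: h. Qed.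

Lemma epi_is_cokernel X Y (f : hom X Y) : epi f ->
  exists Z (g : hom Z X), is_cokernel g f.
Proof. by case: abC => _ [_ [_ [_ [_ h]]]]; apply: h. Qed.

(** [f] is the kernel of some map, and that map factors through the cokernel
    [p]; so whatever [p] kills factors through [f]. *)
Lemma mono_cokernel_exact X Y (f : hom X Y) K (p : hom Y K) :
  mono f -> is_cokernel f p -> short_exact f p.
Proof.
move=> mf cp; split=> //; have [Z [g [gf kf]]] := mono_is_kernel mf.
have [pf lp] := cp; have [h [hp _]] := lp _ _ gf.
apply: kernel_intro => // W a pa.
have [|b [fb _]] := kf W a; first by rewrite -hp -compmA pa comp0r.
by exists b.
Qed.

Lemma epi_kernel_exact X Y (f : hom X Y) K (i : hom K X) :
  epi f -> is_kernel f i -> short_exact i f.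
Proof.
move=> ef ki; split=> //; have [Z [g [fg kf]]] := epi_is_cokernel ef.
have [fi li] := ki; have [h [ih _]] := li _ _ fg.
apply: cokernel_intro => // W a ai.
have [|b [bf _]] := kf W a; first by rewrite -ih compmA ai comp0l.
by exists b.
Qed.

Lemma mono_exact X Y (f : hom X Y) : mono f -> exists K (p : hom Y K), short_exact f p.
Proof.
move=> mf; have [K [p cp]] := has_cokernel f.
by exists K, p; apply: mono_cokernel_exact.
Qed.

Lemma epi_exact X Y (f : hom X Y) : epi f -> exists K (i : hom K X), short_exact i f.
Proof.
move=> ef; have [K [i ki]] := has_kernel f.
by exists K, i; apply: epi_kernel_exact.
Qed.

Lemma mono_epi_iso X Y (f : hom X Y) : mono f -> epi f -> isomorphism f.
Proof.
move=> mf ef; have [Z [g [gf kf]]] := mono_is_kernel mf.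
have g0 := epi_eq0 ef gf.
have [|h [fh _]] := kf Y (idm Y); first by rewrite g0 comp0l.
by exists h; split=> //; apply: mf; rewrite compmA fh comp1m compm1.
Qed.

(** X' is the cokernel of (i, - a) : A -> X + A'.  Exactness on the left is
    deduced from exactness on the right by [mono_cokernel_exact]. *)
Lemma pushout_extension A X B (i : hom A X) (p : hom X B) A' (a : hom A A') :
  short_exact i p -> exists X' (i' : hom A' X') (p' : hom X' B) (m : hom X X'),
    [/\ short_exact i' p', m \oc i = i' \oc a & p' \oc m = p].
Proof.
move=> ex; have [S [i1 [i2 [q1 [q2 [q11 q22 q12 q21 qE]]]]]] := has_sum X A'.
pose c := i1 \oc i - i2 \oc a.
have q1c : q1 \oc c = i by rewrite /c compBr !compmA q11 q12 comp0l subr0 comp1m.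
have mc : mono c.
  apply: mono0P => Z g cg; apply: (mono_eq0 (se_mono ex)).
  by rewrite -q1c -compmA cg comp0r.
have [X' [e exc]] := mono_exact mc; have ec := se_comp0 exc.
have eE : e \oc i1 \oc i = e \oc i2 \oc a.
  by move: ec; rewrite /c compBr !compmA => /eqP; rewrite subr_eq0 => /eqP.
have [|p' p'e] := se_desc exc (g := p \oc q1).
  by rewrite -compmA q1c (se_comp0 ex).
have p'i : p' \oc (e \oc i2) = 0 by rewrite compmA p'e -compmA q12 comp0r.
have p'm : p' \oc (e \oc i1) = p by rewrite compmA p'e -compmA q11 compm1.
exists X', (e \oc i2), p', (e \oc i1); split=> //.
apply: mono_cokernel_exact.
  apply: mono0P => Z g; rewrite -compmA => /(se_lift exc)[h ch].
  have h0 : h = 0.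
    apply: (mono_eq0 (se_mono ex)); rewrite -q1c -compmA ch compmA q12.
    exact: comp0l.
  by rewrite -(comp1m g) -q22 -compmA -ch h0 !comp0r.
apply: cokernel_intro => //.
  by apply: (@epi_right _ _ _ _ _ _ (e \oc i1)); rewrite p'm; exact: se_epi ex.
move=> Z g gi.
have [|h hp] := se_desc ex (g := g \oc (e \oc i1)).
  by rewrite -compmA eE compmA gi comp0l.
exists h; apply: (se_epi exc); rewrite -compmA p'e.
rewrite -[RHS]compm1 -qE compDr !compmA -(compmA g) -hp -(compmA g e i2) gi.
by rewrite comp0l addr0.
Qed.

Lemma pullback_extension A X B (i : hom A X) (p : hom X B) B' (b : hom B' B) :
  short_exact i p -> exists X' (i' : hom A X') (p' : hom X' B') (m : hom X' X),
    [/\ short_exact i' p', m \oc i' = i & p \oc m = b \oc p'].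
Proof.
move=> ex; have [S [i1 [i2 [q1 [q2 [q11 q22 q12 q21 qE]]]]]] := has_sum X B'.
pose c := p \oc q1 - b \oc q2.
have ci1 : c \oc i1 = p by rewrite /c compBl -!compmA q11 q21 comp0r subr0 compm1.
have ec : epi c.
  apply: epi0P => Z g cg; apply: (epi_eq0 (se_epi ex)).
  by rewrite -ci1 compmA cg comp0l.
have [X' [e exc]] := epi_exact ec; have ce := se_comp0 exc.
have eE : p \oc (q1 \oc e) = b \oc (q2 \oc e).
  by move: ce; rewrite /c compBl -!compmA => /eqP; rewrite subr_eq0 => /eqP.
have [|i' ei'] := se_lift exc (g := i1 \oc i).
  by rewrite compmA ci1 (se_comp0 ex).
have p'i : q2 \oc e \oc i' = 0 by rewrite -compmA ei' compmA q21 comp0l.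
have p'm : q1 \oc e \oc i' = i by rewrite -compmA ei' compmA q11 comp1m.
exists X', i', (q2 \oc e), (q1 \oc e); split=> //.
apply: epi_kernel_exact.
  apply: epi0P => Z g; rewrite compmA => /(se_desc exc)[h hc].
  have h0 : h = 0.
    apply: (epi_eq0 (se_epi ex)); rewrite -ci1 compmA hc -compmA q21.
    exact: comp0r.
  by rewrite -(compm1 g) -q22 compmA -hc h0 !comp0l.
apply: kernel_intro => //.
  apply: mono0P => Z g ig; apply: (mono_eq0 (se_mono ex)).
  by rewrite -p'm -compmA ig comp0r.
move=> Z g gi.
have [|h hp] := se_lift ex (g := q1 \oc e \oc g).
  by rewrite !compmA -(compmA p) eE -!compmA (compmA q2) gi comp0r.
exists h; apply: (se_mono exc); rewrite compmA ei' -compmA hp.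
rewrite -[RHS]comp1m -qE compDl -!compmA (compmA q2) gi comp0r addr0.
by rewrite !compmA.
Qed.

(** A morphism of extensions that is the identity on the quotients exhibits a
    push-out square: X + A' -> X' is epi, and its kernel consists of the pairs
    (i x, - a x). *)
Lemma pushout_universal A X B (i : hom A X) (p : hom X B) A' X' (i' : hom A' X')
    (p' : hom X' B) (a : hom A A') (m : hom X X') :
  short_exact i p -> short_exact i' p' -> m \oc i = i' \oc a -> p' \oc m = p ->
  forall Z (f : hom A' Z) (g : hom X Z), f \oc a = g \oc i ->
  exists h : hom X' Z, h \oc i' = f /\ h \oc m = g.
Proof.
move=> ex ex' mi pm Z f g fg.
have [S [i1 [i2 [q1 [q2 [q11 q22 q12 q21 qE]]]]]] := has_sum X A'.
pose c := i1 \oc i - i2 \oc a.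
have [Q [e ce]] := has_cokernel c.
pose s := m \oc q1 + i' \oc q2.
have s1 : s \oc i1 = m by rewrite compDl -!compmA q11 q21 compm1 comp0r addr0.
have s2 : s \oc i2 = i' by rewrite compDl -!compmA q22 q12 compm1 comp0r add0r.
have es : epi s.
  apply: epi0P => W h hs.
  have [|h' h'p] := se_desc ex' (g := h); first by rewrite -s2 compmA hs comp0l.
  suff h'z : h' = 0 by rewrite -h'p h'z comp0l.
  apply: (epi_eq0 (se_epi ex)).
  by rewrite -pm compmA h'p -s1 compmA hs comp0l.
have [K [j exs]] := epi_exact es.
have sj := se_comp0 exs.
pose t := f \oc q2 + g \oc q1.
have tc : t \oc j = 0.
  have [|x ix] := se_lift ex (g := q1 \oc j).
    have := congr1 (fun h => p' \oc h) sj; rewrite comp0r /s compDl compDr.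
    by rewrite -!compmA !(compmA p') pm (se_comp0 ex') comp0l addr0.
  have ax : a \oc x = - (q2 \oc j).
    apply: (se_mono ex'); rewrite compmA -mi -compmA ix compNr.
    apply/eqP; rewrite -addr_eq0; apply/eqP.
    by rewrite -[RHS]sj /s compDl -!compmA.
  rewrite /t compDl -!compmA -ix (compmA g) -fg -compmA ax compNr.
  by rewrite subrr.
have [h hs] := se_desc exs tc; exists h; split.
  by rewrite -s2 compmA hs /t compDl -!compmA q22 q12 comp0r addr0 compm1.
by rewrite -s1 compmA hs /t compDl -!compmA q11 q21 comp0r add0r compm1.
Qed.

Lemma pushout_unique A' X' B (i' : hom A' X') (p' : hom X' B) X (m : hom X X') :
  short_exact i' p' -> epi (p' \oc m) ->
  forall Z (h h' : hom X' Z), h \oc i' = h' \oc i' -> h \oc m = h' \oc m -> h = h'.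
Proof.
move=> ex' epm Z h h' hi hm.
have [|g gp] := se_desc ex' (g := h - h'); first by rewrite compBl hi subrr.
have g0 : g = 0.
  by apply: (epi_eq0 epm); rewrite compmA gp compBl hm subrr.
by apply/eqP; rewrite -subr_eq0 -gp g0 comp0l.
Qed.

(** The kernel of X -> X', the push-out of an extension along a quotient
    A -> A2, is the kernel of A -> A2.  It reduces lifting along X -> B to
    lifting along X' -> B, with kernel A2, and along X -> X', with kernel A1. *)
Lemma pushout_quotient_exact A X B (i : hom A X) (p : hom X B) A1 A2
    (j : hom A1 A) (r : hom A A2) X' (i' : hom A2 X') (p' : hom X' B) (m : hom X X') :
  short_exact i p -> short_exact j r -> short_exact i' p' ->
  m \oc i = i' \oc r -> p' \oc m = p -> short_exact (i \oc j) m.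
Proof.
move=> ex exj ex' mi pm.
have em : epi m.
  apply: epi0P => Z h hm.
  apply: (@pushout_unique _ _ _ i' p' _ m ex'); rewrite ?pm ?comp0l //.
    exact: se_epi ex.
  apply: (epi_eq0 (se_epi exj)).
  by rewrite -compmA -mi compmA hm comp0l.
apply: mono_cokernel_exact; first exact: mono_comp (se_mono ex) (se_mono exj).
apply: cokernel_intro => //.
  by rewrite compmA mi -compmA (se_comp0 exj) comp0r.
move=> Z g gij.
have [|f fr] := se_desc exj (g := g \oc i); first by rewrite -compmA.
have [h [_ hm]] := pushout_universal ex ex' mi pm fr.
by exists h.
Qed.

Lemma simple_mono (S X : C) (f : hom S X) : simple_object S -> f <> 0 -> mono f.
Proof.
move=> [_ sS] f0; have [K [i ki]] := has_kernel f.
have [zK|ii] := sS _ _ (kernel_mono ki).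
  apply: mono0P => Z g /(proj2 ki)[h [<- _]].
  by rewrite (zero_hom_to h zK) comp0r.
by case: f0; apply: (epi_eq0 (iso_epi ii)); case: ki.
Qed.

Lemma simple_epi (S X : C) (f : hom X S) : simple_object S -> f <> 0 -> epi f.
Proof.
move=> [_ sS] f0; apply: epi0P => Z g gf.
have [K [i ki]] := has_kernel g.
have [zK|ii] := sS _ _ (kernel_mono ki).
  by case: f0; have /(proj2 ki)[h [<- _]] := gf; rewrite (zero_hom_to h zK) comp0r.
by apply: (epi_eq0 (iso_epi ii)); case: ki.
Qed.

Lemma simple_hom_iso (S T : C) (f : hom S T) : simple_object S -> simple_object T ->
  f <> 0 -> isomorphism f.
Proof. by move=> sS sT f0; apply: mono_epi_iso; [apply: simple_mono|apply: simple_epi]. Qed.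

Lemma endo_division (S : simpleObj C) : division_ring (endo S).
Proof.
move=> f /eqP f0.
have [g [gf fg]] := simple_hom_iso (simple_valP S) (simple_valP S) f0.
by exists g.
Qed.

End AbelianCategory.

(** * Linear algebra of finite-dimensional spaces *)

Lemma linear_ext (R : pzSemiRingType) (U : lSemiModType R) (V : nmodType)
    (s : R -> V -> V) (f g : {linear U -> V | s}) : f =1 g -> f = g.
Proof.
move=> /funext; case: f g => [f cf] [g cg] /= e.
by subst g; congr GRing.Linear.Pack; case: cf cg => [[?] [?]] [[?] [?]];
  congr GRing.Linear.Class; congr (_ _); exact: Prop_irrelevance.
Qed.

Lemma exists_form (k : fieldType) (V : lmodType k) (v : V) :
  finite_dim V -> v != 0 -> exists l : {scalar V}, l v != 0.
Proof.
move=> [n [[v2r v2r_lin v2r_bij]]] v0.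
have [l [l_lin lv]] := fd_separate v2r_lin v2r_bij v0.
by exists (HB.pack_for {scalar V} l (GRing.isLinear.Build _ _ _ _ _ l_lin)).
Qed.

Lemma linear_choice (k : fieldType) (V U W : lmodType k) (f : {linear V -> W})
    (g : {linear U -> W}) : finite_dim V -> (forall v, exists u, g u = f v) ->
  exists s : {linear V -> U}, forall v, g (s v) = f v.
Proof.
move=> [n [[v2r v2r_lin v2r_bij]]] gf.
have [r2v v2rK r2vK] := v2r_bij.
have r_lin : linear r2v by move=> a u w; apply: (can_inj v2rK); rewrite v2r_lin !r2vK.
pose h j := sval (cid (gf (r2v (delta_mx 0 j)))).
have hE j : g (h j) = f (r2v (delta_mx 0 j)) by exact: svalP (cid (gf _)).
pose s v := \sum_j v2r v 0 j *: h j.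
have s_lin : linear s.
  move=> a u w; rewrite /s scaler_sumr -big_split; apply: eq_bigr => j _ /=.
  by rewrite v2r_lin !mxE scalerDl scalerA.
exists (HB.pack_for {linear V -> U} s (GRing.isLinear.Build _ _ _ _ _ s_lin)) => v /=.
rewrite /s linear_sum /= -[v in RHS]v2rK [v2r v in RHS]row_sum_delta.
have r0 := linear_at0 r_lin.
elim: (index_enum _) => [|i t IH]; first by rewrite !big_nil r0 linear0.
by rewrite !big_cons r_lin linearP IH linearZ /= hE.
Qed.

(** * Equivalences of linear categories *)

Section LinearFunctor.
Variables (k : fieldType) (C D : lincat k) (F : linfunctor C D).

Lemma fmap_iso (X Y : C) (f : hom X Y) : isomorphism f -> isomorphism (fmap F X Y f).
Proof.
by move=> [g [gf fg]]; exists (fmap F Y X g); rewrite -!fmapM gf fg !fmap1.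
Qed.

Lemma fmap_zero_object (X : C) : zero_object X -> zero_object (F X).
Proof. by rewrite /zero_object -fmap1 => ->; rewrite linear0. Qed.

End LinearFunctor.

Section QuasiInverse.
Variables (k : fieldType) (C D : lincat k) (F : linfunctor C D) (G : linfunctor D C).

Lemma quasi_inverse_sym : quasi_inverse F G -> quasi_inverse G F.
Proof. by case. Qed.

Lemma quasi_inverse_faithful : quasi_inverse F G ->
  forall (X Y : C) (f : hom X Y), fmap F X Y f = 0 -> f = 0.
Proof.
move=> [[eta [ieta neta]] _] X Y f Ff.
have := neta X Y f; rewrite Ff linear0 comp0r => /esym.
exact: (epi_eq0 (iso_epi (ieta X))).
Qed.

End QuasiInverse.

Section QuasiInverseFull.
Variables (k : fieldType) (C D : lincat k) (F : linfunctor C D) (G : linfunctor D C).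
Hypothesis FG : quasi_inverse F G.

Lemma quasi_inverse_full (X Y : C) (g : hom (F X) (F Y)) :
  exists f : hom X Y, fmap F X Y f = g.
Proof.
have [[eta [ieta neta]] _] := FG.
have [s [_ se es]] := iso_inv (ieta X).
exists (eta Y \oc fmap G _ _ g \oc s).
apply/eqP; rewrite -subr_eq0; apply/eqP.
apply: (quasi_inverse_faithful (quasi_inverse_sym FG)); rewrite linearB.
apply/eqP; rewrite subr_eq0; apply/eqP; apply: (iso_mono (ieta Y)).
by rewrite neta -!compmA se compm1.
Qed.

Lemma quasi_inverse_simple (S : C) : simple_object S -> simple_object (F S).
Proof.
move=> [S0 sS]; have [_ [eps [ieps _]]] := FG.
have faith := quasi_inverse_faithful FG.
split=> [FS0|A m mm].
  by apply: S0; apply: faith; rewrite fmap1.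
have [n nE] := quasi_inverse_full (m \oc eps A).
have [e [ie ee' e'e]] := iso_inv (ieps A).
have mE : m = fmap F _ _ n \oc e by rewrite nE -compmA e'e compm1.
have mn : mono n.
  apply: mono0P => Z g ng; apply: faith.
  apply: (mono_eq0 (mono_comp mm (iso_mono (ieps A)))).
  by rewrite -nE -fmapM ng linear0.
have [GA0|isn] := sS _ _ mn; [left|right].
  rewrite /zero_object -e'e -(comp1m e) (fmap_zero_object F GA0).
  by rewrite comp0l comp0r.
by rewrite mE; apply: iso_comp => //; apply: fmap_iso.
Qed.

End QuasiInverseFull.

(** * Skyscraper sheaves as iterated self-extensions of a simple object *)

Inductive filtered (k : fieldType) (C : lincat k) (S : C) : C -> Prop :=
| filtered0 X : zero_object X -> filtered S X
| filteredS A X (i : hom A X) (p : hom X S) :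
    short_exact i p -> filtered S A -> filtered S X.

Section Extensions.
Variables (k : fieldType) (C : lincat k).
Hypothesis abC : abelian_category C.

Lemma biproduct_exact (X Y B : C) (i1 : hom X B) (i2 : hom Y B) p1 p2 :
  is_biproduct i1 i2 p1 p2 -> short_exact i1 p2.
Proof.
move=> [p11 p22 p12 p21 pE].
have m1 : mono i1.
  apply: mono0P => Z g ig; by rewrite -(comp1m g) -p11 -compmA ig comp0r.
have e2 : epi p2.
  apply: epi0P => Z g gp; by rewrite -(compm1 g) -p22 compmA gp comp0l.
split; first apply: kernel_intro => // Z g pg.
  exists (p1 \oc g).
  by rewrite -[RHS]comp1m -pE compDl -!compmA pg comp0r addr0.
apply: cokernel_intro => // Z g gi; exists (g \oc i2).
by rewrite -[RHS]compm1 -pE compDr !compmA gi comp0l add0r.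
Qed.

(** A split extension is its own push-out along 0, so its class is 0; an
    extension of class 0 is then equivalent to it. *)
Lemma ecl_split (X Y : C) (V : ext1 X Y) (e : extension X Y) :
  ecl V e = 0 <-> exists r : hom X (ext_mid e), ext_prj e \oc r = idm X.
Proof.
have [B [i1 [i2 [p1 [p2 bi]]]]] := has_sum abC Y X.
have exB := biproduct_exact bi.
have [p11 p22 p12 p21 pE] := bi.
pose e0 := Extension exB.
have e00 : ecl V e0 = 0.
  rewrite -[RHS](scale0r (ecl V e0)); apply: eclZ; exists (i2 \oc p2) => /=.
  by rewrite scale0r comp0r -compmA p21 comp0r compmA p22 !comp1m.
split=> [e_0|[r pr]].
  have /ecl_eq[m [mi pm]] : ecl V e0 = ecl V e by rewrite e00.
  by exists (m \oc i2); rewrite compmA pm comp1m /= p22.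
rewrite -e00; apply/esym/ecl_eq.
exists (ext_inj e \oc p1 + r \oc p2); rewrite /= compm1 comp1m compDl compDr.
rewrite -!compmA p11 p21 comp0r addr0 compm1; split=> //.
by rewrite !compmA pr (se_comp0 (ext_exact e)) comp0l add0r comp1m.
Qed.

Lemma zero_exact (Z X : C) : zero_object Z -> short_exact (0 : hom Z X) (idm X).
Proof.
move=> zZ; split.
  apply: kernel_intro; first by rewrite comp0r.
    by move=> W g h _; rewrite (zero_hom_to g zZ) (zero_hom_to h zZ).
  by move=> W g; rewrite comp1m => ->; exists 0; rewrite comp0l.
apply: cokernel_intro; first by rewrite comp0r.
  exact: iso_epi (iso_id X).
by move=> W g _; exists g; rewrite compm1.
Qed.

Lemma simple_finite_length (T : C) : simple_object T -> finite_length T.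
Proof.
move=> sT; have [Z zZ] := has_zero abC.
exact: finite_lengthS (zero_exact T zZ) (finite_length0 zZ) sT.
Qed.

(** The partial sums are built one summand at a time as retracts of [X], the
    projection being the corresponding partial sum of i_j p_j. *)
Lemma closed_finite_sum (P : C -> Prop) n (E : 'I_n -> C) (X : C) :
  (forall Y Z, isomorphic Y Z -> P Y -> P Z) ->
  (forall Y, zero_object Y -> P Y) ->
  (forall Y Z B, direct_sum Y Z B -> P Y -> P Z -> P B) ->
  (forall j, P (E j)) -> finite_direct_sum E X -> P X.
Proof.
move=> Piso P0 Psum PE [i [p [pii pij pE]]].
suff /(_ n (leqnn n))[B [u [v [vu uv PB]]]] : forall m, (m <= n)%N ->
    exists B (u : hom B X) (v : hom X B),
    [/\ v \oc u = idm B, u \oc v = \sum_(j < n | (j < m)%N) (i j \oc p j) & P B].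
  apply: Piso PB; exists u, v; split=> //; rewrite uv -pE.
  by apply: eq_bigl => j; rewrite ltn_ord.
elim=> [_|m IH lem].
  have [Z zZ] := has_zero abC; exists Z, 0, 0; split; last exact: P0.
    by rewrite comp0l zZ.
  by rewrite comp0r big_pred0.
have [B [u [v [vu uv PB]]]] := IH (ltnW lem).
pose j0 := Ordinal lem.
have mu : mono u.
  by apply: mono0P => Z g ug; rewrite -(comp1m g) -vu -compmA ug comp0r.
have ev : epi v.
  by apply: epi0P => Z g ug; rewrite -(compm1 g) -vu compmA ug comp0l.
have neq (j : 'I_n) : (j < m)%N -> j <> j0.
  by move=> ltj jj; rewrite jj ltnn in ltj.
have vi : v \oc i j0 = 0.
  apply: (mono_eq0 mu); rewrite compmA uv comp_suml big1 // => j /neq jj.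
  by rewrite -compmA pij // comp0r.
have pu : p j0 \oc u = 0.
  apply: (epi_eq0 ev); rewrite -compmA uv comp_sumr big1 // => j /neq jj.
  by rewrite compmA pij ?comp0l // => /esym.
have [B' sB] := has_sum abC B (E j0).
have [a1 [a2 [b1 [b2 [b11 b22 b12 b21 bE]]]]] := sB.
exists B', (u \oc b1 + i j0 \oc b2), (a1 \oc v + a2 \oc p j0); split.
- rewrite compDl !compDr -bE; congr (_ + _).
    by rewrite -!compmA !(compmA v) vu vi comp1m comp0l comp0r addr0.
  by rewrite -!compmA !(compmA (p j0)) pu pii comp1m comp0l comp0r add0r.
- rewrite compDl !compDr -!compmA !(compmA b1) !(compmA b2) b11 b12 b21 b22.
  rewrite !comp0l !comp0r !comp1m addr0 add0r uv (bigD1 (P := fun j : 'I_n => (j < m.+1)%N) j0) //=.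
  rewrite addrC; congr (_ + _); apply: eq_bigl => j.
  by rewrite ltnS [RHS]andbC -val_eqE /= ltn_neqAle.
exact: Psum sB PB (PE _).
Qed.

End Extensions.

Section Curve.
Variables (k : fieldType) (H : nc_curve k).
Let abH := nc_abelian H.
Let tubes := nc_tube_coprod H.

(** The components of [X] in the other tubes are zero, since the projections
    onto them are. *)
Lemma tube_of_no_map_out (x : nc_point H) (X : H) : finite_length X ->
  (forall y (Y : H), y <> x -> nc_tube y Y -> forall f : hom X Y, f = 0) ->
  nc_tube x X.
Proof.
move=> /(coprod_gen tubes)[n [t [E [tE sum]]]] out.
have [i [p [pii _ _]]] := sum.
apply: (closed_finite_sum abH _ _ _ _ sum).
- exact: coprod_iso tubes x.
- exact: coprod_zero tubes x.
- exact: coprod_sum tubes x.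
move=> j; have [<- //|ne] := pselect (t j = x).
apply: (coprod_zero tubes); rewrite /zero_object -(pii j).
by rewrite (out _ _ ne (tE j) (p j)) comp0l.
Qed.

Lemma tube_of_no_map_in (x : nc_point H) (X : H) : finite_length X ->
  (forall y (Y : H), y <> x -> nc_tube y Y -> forall f : hom Y X, f = 0) ->
  nc_tube x X.
Proof.
move=> /(coprod_gen tubes)[n [t [E [tE sum]]]] out.
have [i [p [pii _ _]]] := sum.
apply: (closed_finite_sum abH _ _ _ _ sum).
- exact: coprod_iso tubes x.
- exact: coprod_zero tubes x.
- exact: coprod_sum tubes x.
move=> j; have [<- //|ne] := pselect (t j = x).
apply: (coprod_zero tubes); rewrite /zero_object -(pii j).
by rewrite (out _ _ ne (tE j) (i j)) comp0r.
Qed.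

Lemma tube_extension x (A X T : H) (i : hom A X) (p : hom X T) :
  short_exact i p -> finite_length X -> nc_tube x A -> nc_tube x T -> nc_tube x X.
Proof.
move=> ex fX tA tT; apply: tube_of_no_map_out => // y Y ne tY f.
have [|g <-] := se_desc ex (g := f).
  by apply: (coprod_orth tubes _ tA tY) => /esym.
by rewrite (coprod_orth tubes _ tT tY g) ?comp0l // => /esym.
Qed.

Lemma tube_sub x (A X : H) (i : hom A X) :
  mono i -> finite_length A -> nc_tube x X -> nc_tube x A.
Proof.
move=> mi fA tX; apply: tube_of_no_map_in => // y Y ne tY f.
by apply: (mono_eq0 mi); apply: (coprod_orth tubes ne tY tX).
Qed.

Lemma tube_quotient x (X T : H) (p : hom X T) :
  epi p -> finite_length T -> nc_tube x X -> nc_tube x T.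
Proof.
move=> ep fT tX; apply: tube_of_no_map_out => // y Y ne tY f.
by apply: (epi_eq0 ep); apply: (coprod_orth tubes _ tX tY) => /esym.
Qed.

Lemma simple_in_tube (T : H) : simple_object T -> exists x, nc_tube x T.
Proof.
move=> sT; have := simple_finite_length abH sT.
move=> /(coprod_gen tubes)[n [t [E [tE [i [p [pii _ pE]]]]]]].
have [j ij0] : exists j, i j <> 0.
  apply/not_existsP => i0; apply: (simple_nonzero sT); rewrite -pE big1 // => j _.
  by have /contrapT -> := i0 j; rewrite comp0l.
exists (t j); apply: (coprod_iso tubes) (tE j); exists (i j).
apply: mono_epi_iso => //; last exact: simple_epi.
by apply: mono0P => Z g ig; rewrite -(comp1m g) -(pii j) -compmA ig comp0r.
Qed.

Variables (x : nc_point H) (S : simpleObj H).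
Hypothesis Sx : nc_tube x S.

Lemma tube_simple_unique (T : H) : nc_tube x T -> simple_object T -> isomorphic T S.
Proof.
have [S' [_ _ uniq]] := nc_tube_simple x => tT sT.
apply: isomorphic_trans (uniq T tT sT) _.
by apply: isomorphic_sym; apply: uniq => //; exact: simple_valP.
Qed.

(** An object of finite length is the direct sum of its parts in the tubes, so
    a tube is closed under subobjects, quotients and extensions, and its only
    simple object is S. *)
Lemma tube_filtered (X : H) : nc_tube x X <-> filtered (S : H) X.
Proof.
split=> [tX|].
  have := coprod_sub tubes tX => fX; elim: fX tX => {X} [X zX _|A X T i p ex fA IH sT tX].
    exact: filtered0.
  have tT : nc_tube x T.
    apply: tube_quotient tX; first exact: se_epi ex.
    exact: simple_finite_length.
  have [u iu] := tube_simple_unique tT sT.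
  apply: filteredS (se_iso_quotient ex iu) (IH _).
  exact: tube_sub (se_mono ex) fA tX.
elim=> {X} [X zX|A X i p ex _ tA]; first exact: (coprod_zero tubes).
apply: (tube_extension ex) => //.
apply: finite_lengthS ex _ (simple_valP S).
exact: coprod_sub tubes _ _ tA.
Qed.

Lemma exists_extension (X Y : H) (l : {scalar hom Y (nc_tau H X)}) :
  exists e : extension X Y, nc_serre (ecl (nc_Ext X Y) e) = l.
Proof.
have [g gK Kg] := nc_serre_bij X Y.
by have [e eE] := ecl_surj (g l); exists e; rewrite eE Kg.
Qed.

Lemma nc_serre0 (X Y : H) g : nc_serre (0 : nc_Ext X Y) g = 0.
Proof.
have := nc_serre_linear (-1) (0 : nc_Ext X Y) 0 g.
by rewrite scaler0 addr0 mulN1r addNr.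
Qed.

Lemma serre_inj (X Y : H) (u v : nc_Ext X Y) :
  (forall g, nc_serre u g = nc_serre v g) -> u = v.
Proof.
move=> uv; apply: (bij_inj (nc_serre_bij X Y)).
exact: linear_ext.
Qed.

Lemma nonsplit_extension (X Y : H) (g : hom Y (nc_tau H X)) : g != 0 ->
  exists e : extension X Y, ecl (nc_Ext X Y) e != 0.
Proof.
move=> g0; have [l lg] := exists_form (nc_hom_fd Y (nc_tau H X)) g0.
have [e eE] := exists_extension l; exists e.
by apply: contra_neq lg => e0; rewrite -eE e0 nc_serre0.
Qed.

(** Ext^1(S, tau S) is dual to End(tau S), so there is a nonsplit extension E
    of S by tau S.  If tau S were in another tube, the part of E in the tube of
    S would split it. *)
Lemma tau_simple_isomorphic : isomorphic (nc_tau H S) S.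
Proof.
have stS := quasi_inverse_simple (nc_tauK H) (simple_valP S).
apply: tube_simple_unique => //.
have [y ty] := simple_in_tube stS.
have [<- //|yx] := pselect (y = x).
have id0 : idm (nc_tau H S) != 0 by apply/eqP; apply: simple_nonzero.
have [e e0] := nonsplit_extension id0.
case/eqP: e0; apply/(ecl_split abH).
have fE : finite_length (ext_mid e).
  apply: finite_lengthS (ext_exact e) _ (simple_valP S).
  exact: simple_finite_length.
have [n [t [E [tE [i [p [pii _ pE]]]]]]] := coprod_gen tubes fE.
(* The projection of the extension onto its part in the tube [x]. *)
pose r := \sum_(j < n | `[< t j = x >]) (i j \oc p j).
have ri : r \oc ext_inj e = 0.
  rewrite comp_suml big1 // => j /asboolP tj; rewrite -compmA.
  rewrite (coprod_orth tubes _ ty (tE j) (p j \oc _)) ?comp0r // tj.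
  by move=> /esym/esym.
have [r' r'p] := se_desc (ext_exact e) ri.
exists r'; apply: (se_epi (ext_exact e)); rewrite comp1m -compmA r'p.
rewrite -[RHS]compm1 -pE /r !comp_sumr [RHS](bigID (fun j => `[< t j = x >])) /=.
rewrite [X in _ = _ + X]big1 ?addr0 // => j /asboolP tj; rewrite compmA.
by rewrite (coprod_orth tubes tj (tE j) Sx (_ \oc i j)) comp0l.
Qed.

Lemma taui_simple_isomorphic : isomorphic (nc_taui H S) S.
Proof.
have [f /(fmap_iso (nc_taui H)) iTf] := tau_simple_isomorphic.
apply: isomorphic_trans (isomorphic_sym (ex_intro _ _ iTf)) _.
by have [[eta [ieta _]] _] := nc_tauK H; exists (eta S).
Qed.

End Curve.

(** * The tower of nonsplit extensions *)

Section Composition.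
Variables (k : fieldType) (C : lincat k) (X Y Z : C).

Lemma post_linear (g : hom Y Z) : linear (fun f : hom X Y => g \oc f).
Proof. exact: comp_linearr. Qed.

Lemma pre_linear (f : hom X Y) : linear (fun g : hom Y Z => g \oc f).
Proof. exact: comp_linearl. Qed.

Definition postcomp (g : hom Y Z) : {linear hom X Y -> hom X Z} :=
  HB.pack_for {linear hom X Y -> hom X Z} (fun f : hom X Y => g \oc f)
    (GRing.isLinear.Build _ _ _ _ _ (post_linear g)).

Definition precomp (f : hom X Y) : {linear hom Y Z -> hom X Z} :=
  HB.pack_for {linear hom Y Z -> hom X Z} (fun g : hom Y Z => g \oc f)
    (GRing.isLinear.Build _ _ _ _ _ (pre_linear f)).

End Composition.

Section Stage.
Variables (k : fieldType) (H : nc_curve k) (S : simpleObj H).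
Let abH := nc_abelian H.
Let Ddiv : division_ring (endo S) := endo_division abH (S := S).
Let Dfd : finite_dim (endo S) := nc_hom_fd S S.

(** The data carried along the tower: an object in which every map from S
    factors through [soc], every map to S through [top], with an action of
    End(S) that lifts the tautological one on the top. *)
Record stage := Stage {
  stage_obj :> H;
  soc : hom S stage_obj;
  top : hom stage_obj S;
  act : {linear endo S -> hom stage_obj stage_obj};
  soc_neq0 : soc <> 0;
  soc_gen : forall g : hom S stage_obj, exists c : hom S S, g = soc \oc c;
  top_neq0 : top <> 0;
  top_gen : forall g : hom stage_obj S, exists c : hom S S, g = c \oc top;
  act1 : act (idm S : endo S) = idm stage_obj;
  actM : forall a b : endo S, act (a * b) = act a \oc act b;
  top_act : forall a : endo S, top \oc act a = (a : hom S S) \oc top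
}.

Lemma soc_mono (A : stage) : mono (soc A).
Proof. exact: simple_mono (simple_valP S) (@soc_neq0 A). Qed.

Lemma top_epi (A : stage) : epi (top A).
Proof. exact: simple_epi (simple_valP S) (@top_neq0 A). Qed.

Lemma endo_inv (c : hom S S) : c <> 0 ->
  exists d : hom S S, d \oc c = idm S /\ c \oc d = idm S.
Proof. by move=> /eqP/(Ddiv (x := c))[d [dc cd]]; exists d. Qed.

Definition base_stage : stage.
Proof.
refine (@Stage S (idm S) (idm S) idfun _ _ _ _ _ _ _).
- exact: simple_nonzero (simple_valP S).
- by move=> g; exists g; rewrite comp1m.
- exact: simple_nonzero (simple_valP S).
- by move=> g; exists g; rewrite compm1.
- by [].
- by [].
- by move=> a; rewrite comp1m compm1.
Defined.

Variable g0 : hom S (nc_tau H S).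
Hypothesis ig0 : isomorphism g0.

(** tau is full and tau S is isomorphic to S, so the maps S -> tau A are as few
    as the maps S -> A. *)
Lemma tau_soc_gen (A : stage) (g : hom S (nc_tau H A)) :
  exists c : hom S S, g = fmap (nc_tau H) S A (soc A) \oc (g0 \oc c).
Proof.
have [g0' [_ g0'g g0g']] := iso_inv ig0.
have [f fE] := quasi_inverse_full (nc_tauK H) (g \oc g0').
have [c cE] := soc_gen f.
exists (g0' \oc fmap (nc_tau H) S S c \oc g0).
rewrite 2!(compmA g0) g0g' comp1m compmA -fmapM -cE fE.
by rewrite -compmA g0'g compm1.
Qed.

Local Notation class e := (ecl (nc_Ext _ _) e).

(** Composition with the D-generator of Hom(S, tau A) turns the Serre duals of
    the classes of [e] and [e'] into linear forms on D, and push-out along [a]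
    into multiplication by [a]; now [form_scale] applies. *)
Lemma pushout_generates (A : stage) (e e' : extension A S) : class e != 0 ->
  exists a : hom S S, is_pushout_ext a e e'.
Proof.
move=> e0; pose w c : hom S (nc_tau H A) := fmap (nc_tau H) S A (soc A) \oc (g0 \oc c).
have w_lin : linear (w : endo S -> _).
  by move=> t a b; rewrite /w !(compDr, compZr).
pose m (c : endo S) := nc_serre (class e) (w c).
pose m' (c : endo S) := nc_serre (class e') (w c).
have m_lin : linear (m : _ -> k^o) by move=> t a b; rewrite /m w_lin linearP.
have m'_lin : linear (m' : _ -> k^o) by move=> t a b; rewrite /m' w_lin linearP.
have m0 : exists c, m c != 0.
  apply/not_existsP => m0; case/eqP: e0; apply: serre_inj => g.
  have [c ->] := tau_soc_gen g; rewrite nc_serre0.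
  by have /negP := m0 c; rewrite negbK => /eqP.
have [a mm'] := form_scale Dfd Ddiv m_lin m0 m'_lin.
have [X' [i' [p' [u [ex' ui pu]]]]] := pushout_extension abH (a : hom S S) (ext_exact e).
pose e'' := Extension ex'.
have po : is_pushout_ext (a : hom S S) e e'' by exists u; rewrite comp1m.
exists a; suff /ecl_eq[v [vi pv]] : class e'' = class e'.
  exists (v \oc u); rewrite /= -compmA ui compmA vi compm1; split=> //.
  by rewrite compmA pv !comp1m.
apply: serre_inj => g; have [c ->] := tau_soc_gen g.
rewrite (nc_serre_natl po) -[RHS]/(m' c) mm' /m /w.
by rewrite -!compmA.
Qed.

Section Step.
Variables (A : stage) (e : extension A S).
Hypothesis e0 : class e != 0.
Let E := ext_mid e.
Let i : hom S E := ext_inj e.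
Let p : hom E A := ext_prj e.
Let ex : short_exact i p := ext_exact e.

(** The pull-back along [h] of the extension Y is a push-out of [e]. *)
Lemma nonsplit_lift (Y Z : H) (j : hom S Y) (q : hom Y Z) (h : hom A Z) :
  short_exact j q -> exists u : hom E Y, q \oc u = h \oc p.
Proof.
move=> exq; have [P [i' [p' [m [ex' mi qm]]]]] := pullback_extension abH h exq.
have [a [u [ui pu]]] := pushout_generates (Extension ex') e0.
by exists (m \oc u); rewrite compmA qm -compmA pu comp1m.
Qed.

Lemma nonsplit_no_retraction (s : hom E S) : s \oc i <> idm S.
Proof.
by move=> /(se_split_retraction ex) rp; case/eqP: e0; apply/(ecl_split abH).
Qed.

Lemma next_top_gen (g : hom E S) : exists c : hom S S, g = c \oc (top A \oc p).
Proof.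
have [gi|gi] := pselect (g \oc i = 0).
  have [h hp] := se_desc ex gi; have [c cE] := top_gen h.
  by exists c; rewrite compmA -cE hp.
have [d [dg _]] := endo_inv gi.
by case: (@nonsplit_no_retraction (d \oc g)); rewrite -compmA.
Qed.

(** If g did not map to zero in A, then soc A would lift to E, so that the
    pull-back of [e] along soc A would split.  But pull-back along soc A is
    injective on Ext^1(A, S), being dual to the surjection
    Hom(S, tau S) -> Hom(S, tau A). *)
Lemma next_soc_gen (g : hom S E) : exists c : hom S S, g = i \oc c.
Proof.
suff /(se_lift ex)[c <-] : p \oc g = 0 by exists c.
have [c cE] := soc_gen (p \oc g).
have [c0|/endo_inv[d [dc cd]]] := pselect (c = 0); first by rewrite cE c0 comp0r.
have pgd : p \oc (g \oc d) = soc A by rewrite compmA cE -compmA cd compm1.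
have [B [i1 [i2 [q1 [q2 bi]]]]] := has_sum abH S S.
have [q11 q22 q12 q21 _] := bi.
pose e' := Extension (biproduct_exact bi).
have e'0 : class e' = 0 by apply/(ecl_split abH); exists i2.
(* The lift of soc A exhibits the split extension as a pull-back of [e]. *)
have pb : is_pullback_ext (soc A) e e'.
  exists (i \oc q1 + g \oc d \oc q2) => /=; split.
    by rewrite compDl -!compmA q11 q21 !comp0r addr0.
  by rewrite compDr !compmA (se_comp0 ex) comp0l add0r -(compmA p) pgd.
case/eqP: e0; apply: serre_inj => t; have [c' ->] := tau_soc_gen t.
by rewrite -(nc_serre_natr pb) e'0 !nc_serre0.
Qed.

Lemma square_zero (n n' : hom E E) : p \oc n = 0 -> p \oc n' = 0 -> n \oc n' = 0.
Proof.
move=> /(se_lift ex)[h <-] /(se_lift ex)[h' <-]; have [c ->] := next_top_gen h.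
by rewrite -!compmA (compmA p) (se_comp0 ex) comp0l !comp0r.
Qed.

(** Wedderburn's principal theorem for End E -> End A, whose kernel has square
    zero.  A linear lift [s] of the action fails to be multiplicative by the
    2-cocycle [phi], and [phi] is the coboundary of
    G(a) = sum s(x) phi(y, a), the sum being over the separability idempotent;
    so s - G is multiplicative. *)
Lemma lift_action (idem : seq (endo S * endo S)) : unital idem ->
  (forall (V : zmodType) (B : endo S -> endo S -> V), balanced (@scalars k (endo S)) B ->
   forall a, pairing (fun x y => B (a * x) y) idem = pairing (fun x y => B x (y * a)) idem) ->
  exists r : {linear endo S -> hom E E},
    [/\ r (idm S : endo S) = idm E, forall a b : endo S, r (a * b) = r a \oc r b
      & forall a, p \oc r a = act A a \oc p].
Proof.
move=> idem1 casimir.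
have [s sE] : exists s : {linear endo S -> hom E E}, forall a, p \oc s a = act A a \oc p.
  have [|s sE] := @linear_choice k (endo S) (hom E E) (hom E A)
    (precomp A p \o act A) (postcomp E p) Dfd; last by exists s.
  by move=> a; have [u pu] := nonsplit_lift (act A a) ex; exists u.
pose phi (a b : endo S) := s a \oc s b - s (a * b).
have phiN a b : p \oc phi a b = 0.
  by rewrite compBr compmA !sE -compmA sE actM compmA subrr.
pose G a := \sum_(u <- idem) s u.1 \oc phi u.2 a.
have sN a (n : hom E E) : p \oc n = 0 -> p \oc (s a \oc n) = 0.
  by move=> pn; rewrite compmA sE -compmA pn comp0r.
have GN a : p \oc G a = 0.
  by rewrite comp_sumr big1 // => u _; apply: sN.
have mulN a b (n : hom E E) : p \oc n = 0 -> s a \oc (s b \oc n) = s (a * b) \oc n.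
  move=> pn; apply/eqP; rewrite compmA -subr_eq0 -compBl.
  by apply/eqP; exact: square_zero (phiN a b) pn.
have oneN (n : hom E E) : p \oc n = 0 -> s (idm S : endo S) \oc n = n.
  move=> pn; apply/eqP; rewrite -subr_eq0 -{2}(comp1m n) -compBl.
  apply/eqP; apply: square_zero => //.
  by rewrite compBr sE act1 comp1m compm1 subrr.
have cocycle y a b : phi (y * a) b + phi y a \oc s b - phi y (a * b) = s y \oc phi a b.
  rewrite /phi !(compBl, compBr) !compmA mulrA.
  by rewrite [_ + (_ - _)]addrC subrKA opprB subrKA.
have G_lin : linear G.
  move=> t a b; rewrite /G scaler_sumr -big_split; apply: eq_bigr => u _ /=.
  rewrite -compZr -compDr /phi; congr (_ \oc _).
  by rewrite mulrDr -scalerAr !linearP /= compDr compZr addrACA -scalerDr.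
pose r a := s a - G a.
have r_lin : linear r.
  move=> t a b; rewrite /r G_lin linearP scalerBr opprD addrACA //.
have rE a : p \oc r a = act A a \oc p by rewrite compBr GN subr0 sE.
have rM (a b : endo S) : r (a * b) = r a \oc r b.
  rewrite /r compBr !compBl (square_zero (GN a) (GN b)) subr0.
  suff : s a \oc G b + G a \oc s b - G (a * b) = phi a b.
    rewrite /phi => cob; apply/eqP; rewrite eq_sym !subr_eq.
    rewrite -(subrK (s (a * b)) (s a \oc s b)) -cob -addrA [- _ + _]addrC.
    by rewrite -[X in _ == X]addrA [X in _ == X]addrC.
  have -> : s a \oc G b = \sum_(u <- idem) s u.1 \oc phi (u.2 * a) b.
    have balB : balanced (@scalars k (endo S)) (fun x y => s x \oc phi y b).
      split=> [x x' y|x y y'|z [c ->] x y].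
      - by rewrite linearD compDl.
      - by rewrite /phi mulrDl !linearD /= compDl addrACA -compDr.
      rewrite mulr_algl mulr_algr linearZ /= /phi -scalerAl !linearZ /=.
      by rewrite !compZl -?scalerN -?scalerDr -?scalerBr compZr.
    have := casimir _ _ balB a; rewrite /pairing => <-.
    by rewrite comp_sumr; apply: eq_bigr => u _; rewrite mulN.
  rewrite comp_suml -big_split -sumrB.
  transitivity (\sum_(u <- idem) s (u.1 * u.2) \oc phi a b).
    apply: eq_bigr => u _ /=.
    rewrite -(mulN _ _ _ (phiN a b)) -(cocycle u.2 a b) [RHS]compBr.
    by rewrite [X in _ = X - _]compDr compmA.
  rewrite -[RHS](oneN _ (phiN a b)) -[idm S]idem1 linear_sum.
  by rewrite comp_suml.
clearbody r.
exists (HB.pack_for {linear endo S -> hom E E} r (GRing.isLinear.Build _ _ _ _ _ r_lin)).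
split=> //=.
have r1N : p \oc (r (1 : endo S) - idm E) = 0.
  by rewrite compBr rE act1 comp1m compm1 subrr.
have := square_zero r1N r1N.
rewrite compBr !compBl -rM mulr1 compm1 !comp1m subrr sub0r opprB.
by move=> /eqP; rewrite subr_eq0 => /eqP <-.
Qed.

End Step.

(** The class is quantified over all proofs of exactness, so that the extension
    may be formed from whichever proof is at hand. *)
Definition next_stage (A B : stage) (p : hom B A) : Prop :=
  [/\ short_exact (soc B) p,
      forall ex : short_exact (soc B) p, class (Extension ex) != 0,
      top B = top A \oc p
    & forall a, p \oc act B a = act A a \oc p].

Hypothesis k_perfect : perfect_field k.

Lemma exists_next_stage (A : stage) : exists (B : stage) (p : hom B A), next_stage p.
Proof.
have [|[E i p ex] e0] := @nonsplit_extension _ H A S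
    (fmap (nc_tau H) S A (soc A) \oc g0).
  apply/eqP => /(epi_eq0 (iso_epi ig0)).
  by move=> /(quasi_inverse_faithful (nc_tauK H))/soc_neq0.
have [idem [idem1 casimir]] := separable_division_algebra k_perfect Dfd Ddiv.
have [r [r1 rM rE]] := lift_action e0 idem1 casimir.
have i0 : i <> 0.
  by move=> i0; apply: (simple_nonzero (simple_valP S)); apply: (se_mono ex); rewrite i0 !comp0l.
have topE a : top A \oc p \oc r a = (a : hom S S) \oc (top A \oc p).
  by rewrite -compmA rE compmA top_act compmA.
have top0 : top A \oc p <> 0.
  by move=> /(epi_eq0 (se_epi ex))/top_neq0.
exists (@Stage E i (top A \oc p) r i0 (next_soc_gen e0) top0 (next_top_gen e0) r1 rM topE), p.
split=> //= ex'; by rewrite (Prop_irrelevance ex' ex).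
Qed.

Section NextFacts.
Variables (A B : stage) (p : hom B A).
Hypothesis nx : next_stage p.

Lemma next_exact : short_exact (soc B) p. Proof. by case: nx. Qed.

Lemma next_top : top B = top A \oc p. Proof. by case: nx. Qed.

Lemma next_act a : p \oc act B a = act A a \oc p. Proof. by case: nx. Qed.

Lemma next_epi : epi p. Proof. exact: se_epi next_exact. Qed.

Lemma next_lift (Y Z : H) (j : hom S Y) (q : hom Y Z) (h : hom A Z) :
  short_exact j q -> exists u : hom B Y, q \oc u = h \oc p.
Proof.
by have [ex /(_ ex) e0 _ _] := nx; apply: (nonsplit_lift e0).
Qed.

Lemma next_hom_simple_soc (h : hom B S) : h \oc soc B = 0.
Proof.
have [c ->] := top_gen h.
by rewrite next_top -!compmA (se_comp0 next_exact) !comp0r.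
Qed.

End NextFacts.

Section Shift.
Variable s : {lrmorphism endo S -> endo S}.

(** Multiplication by the variable T, seen as a map from one stage to the next
    with image the kernel of the top. *)
Definition shift (A B : stage) (t : hom A B) : Prop :=
  short_exact t (top B) /\ forall a, t \oc act A a = act B (s a) \oc t.

(** The pull-back along [t] of the extension C is a push-out, along an invertible
    [a], of the extension B; this gives a map w : B -> C over t.  It is
    made equivariant by averaging with the separability idempotent, which
    changes it only by maps through the top of B, so that its effect on the
    socle of B is still [a]. *)
Lemma shift_step (A B C : stage) (p : hom B A) (q : hom C B) (t : hom A B) :
  next_stage p -> next_stage q -> shift t ->
  exists t' : hom B C, shift t' /\ q \oc t' = t \oc p.
Proof.
move=> np nq [ext tE].
have [exp /(_ exp) ep0 _ _] := np; have [exq /(_ exq) eq0 _ _] := nq.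
have [P [i' [p' [m [ex' mi qm]]]]] := pullback_extension abH t exq.
have [a [u [ui pu]]] := pushout_generates (Extension ex') ep0.
have pb : is_pullback_ext t (Extension exq) (Extension ex').
  by exists m; rewrite /= compm1.
(* Pull-back along [t] is injective on Ext^1(B, S), as [soc B] factors
   through [t]. *)
have a0 : a <> 0.
  move=> a0; have e'0 : class (Extension ex') = 0.
    apply/(ecl_split abH) => /=.
    have [|r rp] := se_desc exp (g := u).
      by rewrite -[soc B]/(ext_inj (Extension exp)) ui a0 comp0r.
    exists r; apply: (next_epi np).
    by rewrite -compmA rp comp1m; move: pu; rewrite /= comp1m.
  case/eqP: eq0; apply: serre_inj => g; rewrite nc_serre0.
  have [c ->] := tau_soc_gen g.
  have [b bE] := soc_gen (t \oc soc A).
  have b0 : b <> 0.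
    move=> b0; move: bE; rewrite b0 comp0r => /(mono_eq0 (se_mono ext)).
    exact: soc_neq0.
  have [d [_ bd]] := endo_inv b0.
  have -> : soc B = t \oc (soc A \oc d) by rewrite compmA bE -compmA bd compm1.
  by rewrite fmapM -compmA -(nc_serre_natr pb) e'0 nc_serre0.
have [a' [_ aa']] := endo_inv a0.
pose w := m \oc u.
have wsoc : w \oc soc B = soc C \oc a.
  by rewrite /w -compmA -[soc B]/(ext_inj (Extension exp)) ui /= compmA mi.
have qw : q \oc w = t \oc p.
  by rewrite /w compmA qm -compmA; move: pu; rewrite /= comp1m => ->.
clearbody w.
have [idem [idem1 casimir]] := separable_division_algebra k_perfect Dfd Ddiv.
pose t' := \sum_(u <- idem) act C (s u.1) \oc (w \oc act B u.2).
have qt' : q \oc t' = t \oc p.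
  rewrite comp_sumr.
  transitivity (\sum_(u <- idem) act B (s (u.1 * u.2)) \oc (t \oc p)).
    apply: eq_bigr => v _; rewrite !compmA (next_act nq) -(compmA _ q) qw.
    rewrite -!compmA (next_act np) !compmA; congr (_ \oc _).
    by rewrite -compmA tE compmA rmorphM actM.
  rewrite -comp_suml -!linear_sum idem1.
  by rewrite rmorph1 act1 comp1m.
have t'E d : t' \oc act B d = act C (s d) \oc t'.
  pose bil x y := act C (s x) \oc (w \oc act B y).
  have balB : balanced (@scalars k (endo S)) bil.
    split=> [x x' y|x y y'|z [c ->] x y].
    - by rewrite /bil !linearD compDl.
    - by rewrite /bil linearD /= !compDr.
    by rewrite /bil mulr_algl mulr_algr !linearZ /= compZl !compZr.
  have := casimir _ _ balB d; rewrite /pairing => h.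
  rewrite comp_suml comp_sumr.
  transitivity (\sum_(u <- idem) bil u.1 (u.2 * d)).
    by apply: eq_bigr => v _; rewrite /bil actM !compmA.
  by rewrite -h; apply: eq_bigr => v _; rewrite /bil rmorphM actM !compmA.
have t'soc : t' \oc soc B = soc C \oc a.
  have [|f fE] := se_lift exq (g := t' - w); first by rewrite compBr qt' qw subrr.
  rewrite -[t'](subrK w) -fE compDl wsoc -compmA (next_hom_simple_soc np).
  by rewrite comp0r add0r.
exists t'; split=> //; split=> //; apply: mono_cokernel_exact => //.
  apply: mono0P => Z g tg.
  have [|h hE] := se_lift exp (g := g).
    by apply: (mono_eq0 (se_mono ext)); rewrite compmA -qt' -compmA tg comp0r.
  suff h0 : h = 0 by rewrite -hE h0 comp0r.
  have : soc C \oc (a \oc h) = 0 by rewrite compmA -t'soc -compmA hE.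
  move=> /(mono_eq0 (@soc_mono C)) ah.
  have [a'' [a''a _]] := endo_inv a0.
  by rewrite -(comp1m h) -a''a -compmA ah comp0r.
apply: cokernel_intro; [|exact: top_epi|].
  by rewrite (next_top nq) -compmA qt' compmA (se_comp0 ext) comp0l.
move=> Z g gt.
have [|g' g'q] := se_desc exq (g := g).
  by rewrite -(compm1 (soc C)) -aa' (compmA (soc C)) -t'soc !compmA gt !comp0l.
have [|g'' g''E] := se_desc ext (g := g').
  by apply: (next_epi np); rewrite -compmA -qt' compmA g'q gt comp0l.
by exists g''; rewrite (next_top nq) compmA g''E.
Qed.

(** On the first extension the action of d restricts to an endomorphism th(d) of
    the sub-object S, and the push-out along th(d) is the pull-back along d.
    Serre duality makes this an identity m(a th(s(d))) = m(d a), so that th s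
    is inner by [nakayama_inner]; the conjugating unit u corrects the
    inclusion. *)
Lemma shift_base (A : stage) (p : hom A base_stage) : next_stage p ->
  (forall f : endo S, fmap (nc_tau H) S S (s f) \oc g0 = g0 \oc f) ->
  exists t : hom base_stage A, shift t.
Proof.
move=> np sg0; have [ex /(_ ex) e0 _ _] := np.
pose i : hom S A := soc A; pose p' : hom A S := p.
have th_ex (d : endo S) : exists c : endo S, act A d \oc i = i \oc c.
  exact: soc_gen.
pose th d := sval (cid (th_ex d)).
have thE d : act A d \oc i = i \oc th d by exact: svalP (cid (th_ex d)).
pose m (a : endo S) := nc_serre (class (Extension ex)) (g0 \oc a).
have m_lin : linear (m : _ -> k^o).
  by move=> c a b; rewrite /m compDr compZr linearP.
have m0 : exists c, m c != 0.
  apply/not_existsP => m0; case/eqP: e0; apply: serre_inj => g.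
  have [c ->] := tau_soc_gen g; rewrite nc_serre0 /= fmap1 comp1m.
  by have /negP := m0 c; rewrite negbK => /eqP.
have mth (a d : endo S) : m (a * th (s d)) = m (d * a).
  have [X' [j [q [u [ex' uj qu]]]]] := pushout_extension abH (th (s d) : hom S S) ex.
  have po : is_pushout_ext (th (s d) : hom S S) (Extension ex) (Extension ex').
    by exists u; rewrite comp1m.
  have [v [vj vu]] := pushout_universal abH ex ex' uj qu (esym (thE (s d))).
  have pb : is_pullback_ext (s d : hom S S) (Extension ex) (Extension ex').
    exists v; rewrite /= compm1; split=> //.
    apply: (pushout_unique ex' (m := u)).
    - by rewrite qu; exact: se_epi ex.
    - by rewrite -!compmA vj (se_comp0 ex) (se_comp0 ex') comp0r.
    by rewrite -!compmA vu qu (next_act np).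
  have := nc_serre_natl po (g0 \oc a); rewrite (nc_serre_natr pb).
  by rewrite /m compmA sg0 -!compmA.
have [u u0 thu] := nakayama_inner Dfd Ddiv m_lin m0 mth.
have [u' [u'u uu']] := endo_inv (elimN eqP u0).
exists (i \oc u); split=> [|d].
  rewrite (next_top np) /= comp1m; split.
    apply: kernel_intro.
    - by rewrite compmA (se_comp0 ex) comp0l.
    - by apply: mono_comp (se_mono ex) _; apply: iso_mono; exists u'.
    move=> Z g /(se_lift ex)[h <-]; exists (u' \oc h).
    by rewrite compmA -(compmA i) uu' compm1.
  apply: cokernel_intro.
  - by rewrite compmA (se_comp0 ex) comp0l.
  - exact: se_epi ex.
  move=> Z g giu; apply: (se_desc ex).
  rewrite -(compm1 (soc A)) -uu' (compmA (soc A)) compmA.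
  by rewrite -[soc A]/i giu comp0l.
transitivity (i \oc (th (s d) \oc u)).
  by rewrite /= -compmA; congr (_ \oc _); exact: esym (thu d).
by rewrite compmA -thE compmA.
Qed.

End Shift.
End Stage.

Section TowerExistence.
Variables (k : fieldType) (k_perfect : perfect_field k) (H : nc_curve k).
Variables (S : simpleObj H) (s : {lrmorphism endo S -> endo S}).
Hypothesis twist : induced_twist (nc_taui H) s.

(** An identification of tau^- S with S that induces s yields one of tau S with
    S that induces the inverse of s. *)
Lemma twist_tau : exists g0 : hom S (nc_tau H S), isomorphism g0 /\
  forall f : endo S, fmap (nc_tau H) S S (s f) \oc g0 = g0 \oc f.
Proof.
have [phi [iphi phiE]] := twist; have [_ [eps [ieps neps]]] := nc_tauK H.
have [e [ie ee e'e]] := iso_inv (ieps S).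
exists (fmap (nc_tau H) _ _ phi \oc e); split=> [|f].
  by apply: iso_comp => //; apply: fmap_iso.
rewrite compmA -fmapM phiE fmapM -!compmA; congr (_ \oc _).
apply: (iso_mono (ieps S)).
by rewrite !compmA neps -compmA e'e compm1 comp1m.
Qed.

Record tower (E : nat -> stage S) (p : forall n, hom (E n.+1) (E n))
    (t : forall n, hom (E n) (E n.+1)) : Prop := Tower {
  tw_next : forall n, next_stage (p n);
  tw_lift : forall n (Y Z : H) (j : hom S Y) (q : hom Y Z) (h : hom (E n) Z),
    short_exact j q -> exists u : hom (E n.+1) Y, q \oc u = h \oc p n;
  tw_shift : forall n, shift s (t n);
  tw_comm : forall n, p n.+1 \oc t n.+1 = t n \oc p n;
  tw_base : p 0%N \oc t 0%N = 0
}.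

(** Dependent choice, first of the stages and then of the shifts between them. *)
Lemma tower_exists : exists E p t, @tower E p t.
Proof.
have [g0 [ig0 sg0]] := twist_tau.
have nextP A := exists_next_stage ig0 k_perfect A.
pose nx A : stage S := sval (cid (nextP A)).
pose nxp A : hom (nx A) A := sval (cid (svalP (cid (nextP A)))).
have nxP A : next_stage (nxp A) := svalP (cid (svalP (cid (nextP A)))).
pose E n : stage S := iter n nx (base_stage S).
pose p n : hom (E n.+1) (E n) := nxp (E n).
pose good n := {t : hom (E n) (E n.+1) | shift s t}.
have stepP n (t : good n) : exists t' : hom (E n.+1) (E n.+2),
    shift s t' /\ p n.+1 \oc t' = sval t \oc p n.
  exact: (shift_step ig0 k_perfect (nxP _) (nxP _) (svalP t)).
have base : good 0%N by apply: cid; apply: (shift_base ig0 (nxP _) sg0).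
pose step n (t : good n) : good n.+1 :=
  exist _ (sval (cid (stepP n t))) (proj1 (svalP (cid (stepP n t)))).
pose t := nat_rect good base step.
exists E, p, (fun n => sval (t n)); split=> [n|n Y Z j q h|n|n|]; first exact: nxP.
- exact: (next_lift ig0 (nxP _)).
- exact: svalP (t n).
- exact: (proj2 (svalP (cid (stepP n (t n))))).
have [ex _] := svalP (t 0%N).
by have := se_comp0 ex; rewrite (next_top (nxP _)) -compmA comp1m.
Qed.

End TowerExistence.

(** * The action of power series on the tower *)

Section Series.
Variables (k : fieldType) (D : algType k) (s : {lrmorphism D -> D}).
Hypothesis s_surj : forall d, exists d', s d' = d.
Local Notation A := (skew_series s).

Lemma skew_mulE (a b : A) n : (a * b) n = \sum_(i < n.+1) a i * iter i s (b (n - i)%N).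
Proof. by []. Qed.

Lemma skewT_mul (a : A) n : (skewT s * a) n = if n is m.+1 then s (a m) else 0.
Proof.
rewrite skew_mulE big_ord_recl /= /skewT mul0r add0r.
case: n => [|n]; first by rewrite big_ord0.
by rewrite big_ord_recl /= mul1r subSS subn0 big1 ?addr0 // => i _; rewrite mul0r.
Qed.

(** The coefficients have to be moved to the right of T, hence the surjectivity
    of s. *)
Lemma skew_decomp (a : A) : exists b : A, a = skewC s (a 0%N) + skewT s * b.
Proof.
pose b : A := fun n => sval (cid (s_surj (a n.+1))).
have bE n : s (b n) = a n.+1 by exact: svalP (cid (s_surj (a n.+1))).
exists b; apply/funext => n.
rewrite -[RHS]/(skewC s (a 0%N) n + (skewT s * b) n) skewT_mul.
by case: n => [|n]; rewrite /skewC /= ?addr0 // add0r bE.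
Qed.

Lemma skewCM (c d : D) : skewC s c * skewC s d = skewC s (c * d) :> A.
Proof.
apply/funext => n; rewrite skew_mulE big_ord_recl /= subn0 big1 => [|i _].
  by rewrite addr0 /skewC; case: n => //=; rewrite mulr0.
by rewrite mul0r.
Qed.

(** The coefficients of the inverse are found recursively; [l n] lists the first
    n of them. *)
Lemma skew_right_inverse (b : A) : b 0%N = 1 -> exists c : A, b * c = 1.
Proof.
move=> b0.
pose stepc (l : seq D) : D := (size l == 0%N)%:R -
  \sum_(i < size l) b i.+1 * iter i.+1 s (nth 0 l (size l - i.+1)).
pose l n := iter n (fun l => rcons l (stepc l)) [::].
have sl n : size (l n) = n by elim: n => //= n IH; rewrite size_rcons IH.
have nl n m : (m < n)%N -> nth 0 (l n) m = stepc (l m).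
  elim: n => // n IH; rewrite ltnS leq_eqVlt => /orP[/eqP ->|lt_mn].
    by rewrite /= nth_rcons sl ltnn eqxx.
  by rewrite /= nth_rcons sl lt_mn IH.
pose c : A := fun n => stepc (l n).
exists c; apply/funext => n.
rewrite skew_mulE big_ord_recl /= b0 mul1r subn0.
have -> : c n = (n == 0%N)%:R - \sum_(i < n) b i.+1 * iter i.+1 s (c (n - i.+1)%N).
  rewrite /c {1}/stepc sl; congr (_ - _); apply: eq_bigr => i _.
  by rewrite nl // -subn_gt0 subKn.
by rewrite subrK.
Qed.

End Series.

Section Tower.
Variables (k : fieldType) (H : nc_curve k).
Variables (S : simpleObj H) (s : {lrmorphism endo S -> endo S}).
Variables (E : nat -> stage S) (p : forall n, hom (E n.+1) (E n)).
Variable t : forall n, hom (E n) (E n.+1).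
Hypothesis tw : tower s p t.
Local Notation D := (endo S).
Local Notation A := (skew_series s).

Definition shift_endo n : hom (E n) (E n) :=
  match n with 0 => 0 | m.+1 => t m \oc p m end.

Definition shift_pow n j : hom (E n) (E n) := iter j (fun g => shift_endo n \oc g) (idm (E n)).

Lemma shift_powS n j : shift_pow n j.+1 = shift_endo n \oc shift_pow n j.
Proof. by []. Qed.

Lemma shift_pow_0 n : shift_pow n 0 = idm (E n).
Proof. by []. Qed.

Local Arguments shift_pow : simpl never.

Definition series_act n (a : A) : hom (E n) (E n) :=
  \sum_(j < n.+1) act (E n) (a j) \oc shift_pow n j.

Lemma tower_act n a : p n \oc act (E n.+1) a = act (E n) a \oc p n.
Proof. exact: next_act (tw_next tw n) a. Qed.

Lemma tower_top n : top (E n.+1) = top (E n) \oc p n.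
Proof. exact: next_top (tw_next tw n). Qed.

Lemma tower_epi n : epi (p n).
Proof. exact: next_epi (tw_next tw n). Qed.

Lemma shift_endo_proj n : p n \oc shift_endo n.+1 = shift_endo n \oc p n.
Proof.
by case: n => [|n] /=; rewrite compmA ?(tw_base tw) ?comp0l // (tw_comm tw).
Qed.

Lemma shift_endo_act n d : shift_endo n \oc act (E n) d = act (E n) (s d) \oc shift_endo n.
Proof.
case: n => [|n] /=; first by rewrite comp0l comp0r.
by have [_ te] := tw_shift tw n; rewrite -compmA tower_act compmA te compmA.
Qed.

Lemma shift_pow_proj n j : p n \oc shift_pow n.+1 j = shift_pow n j \oc p n.
Proof.
elim: j => [|j IH]; first by rewrite comp1m compm1.
by rewrite !shift_powS compmA shift_endo_proj -!compmA IH.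
Qed.

Lemma shift_powD n i j : shift_pow n (i + j) = shift_pow n i \oc shift_pow n j.
Proof. by elim: i => [|i IH]; rewrite ?comp1m // addSn !shift_powS IH compmA. Qed.

Lemma shift_pow_act n j d :
  shift_pow n j \oc act (E n) d = act (E n) (iter j s d) \oc shift_pow n j.
Proof.
elim: j => [|j IH]; first by rewrite comp1m compm1.
by rewrite !shift_powS -compmA IH compmA shift_endo_act compmA.
Qed.

(** T on E_{n+1} factors through the projection to E_n, which commutes with T. *)
Lemma shift_pow0 n j : (n < j)%N -> shift_pow n j = 0.
Proof.
move=> /subnK <-; rewrite shift_powD.
suff -> : shift_pow n n.+1 = 0 by rewrite comp0r.
elim: n {j} => [|n IH]; first by rewrite shift_powS /= comp0l.
by rewrite -[LHS]/(t n \oc p n \oc shift_pow n.+1 n.+1) -compmA shift_pow_proj IH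
  comp0l comp0r.
Qed.

Lemma series_act_linear n : linear (series_act n : A -> _).
Proof.
move=> c a b; rewrite /series_act scaler_sumr -big_split; apply: eq_bigr => j _ /=.
by rewrite -compZl -compDl -linearP.
Qed.

Lemma series_actD n (a b : A) : series_act n (a + b) = series_act n a + series_act n b.
Proof. by have := series_act_linear n 1 a b; rewrite !scale1r. Qed.

Lemma series_act_proj n (a : A) : p n \oc series_act n.+1 a = series_act n a \oc p n.
Proof.
rewrite /series_act big_ord_recr /= compDr comp_sumr comp_suml.
rewrite [X in _ + X]compmA [X in _ + X](_ : _ = 0) ?addr0; last first.
  by rewrite tower_act -compmA shift_pow_proj (shift_pow0 (ltnSn n)) comp0l comp0r.
by apply: eq_bigr => j _; rewrite compmA tower_act -!compmA shift_pow_proj.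
Qed.

Lemma series_actC n (d : D) : series_act n (skewC s d) = act (E n) d.
Proof.
rewrite /series_act big_ord_recl /= shift_pow_0 compm1 big1 ?addr0 // => i _.
by rewrite linear0 comp0l.
Qed.

Lemma series_act1 n : series_act n (1 : A) = idm (E n).
Proof.
have -> : (1 : A) = skewC s 1 by apply/funext; case.
by rewrite series_actC act1.
Qed.

Lemma series_actT n : series_act n (skewT s) = shift_endo n.
Proof.
rewrite /series_act big_ord_recl /= /skewT linear0 comp0l add0r.
case: n => [|n]; first by rewrite big_ord0.
rewrite big_ord_recl /= act1 comp1m shift_powS shift_pow_0 compm1 big1 ?addr0 // => i _.
by rewrite linear0 comp0l.
Qed.

Lemma series_actM n (a b : A) : series_act n (a * b) = series_act n a \oc series_act n b.
Proof.
pose F i m := act (E n) (a i * iter i s (b (m - i)%N)) \oc shift_pow n m.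
transitivity (\sum_(0 <= m < n.+1) \sum_(0 <= i < m.+1) F i m).
  rewrite big_mkord; apply: eq_bigr => m _; rewrite big_mkord -comp_suml.
  by rewrite -linear_sum.
transitivity (\sum_(0 <= i < n.+1) \sum_(i <= m < n.+1) F i m).
  symmetry; under eq_bigr => j _ do rewrite (big_nat_widenl j 0) //.
  rewrite (exchange_big_dep xpredT) //=; apply: eq_big_nat => i /andP[_ lt_in].
  by rewrite [RHS](big_nat_widen _ _ n.+1).
rewrite /series_act comp_suml big_mkord; apply: eq_bigr => i _.
rewrite comp_sumr -[X in \sum_(X <= _ < _) _]add0n big_addn big_mkord.
have le_in : (i <= n.+1)%N by apply: ltnW.
rewrite [RHS](bigID (fun j : 'I_n.+1 => (j < n.+1 - i)%N)) /=.
rewrite [X in _ = _ + X]big1 ?addr0 => [|j]; last first.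
  rewrite -leqNgt leq_subLR => le_n.
  rewrite -compmA (compmA (shift_pow n i)) shift_pow_act -compmA -shift_powD.
  by rewrite shift_pow0 ?comp0r.
rewrite (big_ord_widen_cond n.+1 xpredT (fun m => F i (m + i)%N)) ?leq_subr //=.
apply: eq_bigr => j _; rewrite /F addnK addnC shift_powD actM -!compmA; congr (_ \oc _).
by rewrite !compmA shift_pow_act.
Qed.

(** The composite E_n -> E_m of the tower for m <= n, extended by zero maps to
    all pairs of indices so that no proof of m <= n enters the type. *)
Fixpoint transition n m : hom (E n) (E m) :=
  match n with
  | 0 => if m is 0 then idm (E 0%N) else 0
  | l.+1 => match @eqP _ l.+1 m with
    | ReflectT e => ecast m (hom (E l.+1) (E m)) e (idm (E l.+1))
    | ReflectF _ => transition l m \oc p l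
    end
  end.

Lemma transition_id n : transition n n = idm (E n).
Proof. by case: n => //= n; case: eqP => // e; rewrite (eq_axiomK e). Qed.

Lemma transitionS n m : (m <= n)%N -> transition n.+1 m = transition n m \oc p n.
Proof.
move=> le_mn /=; case: eqP => // e; exfalso.
by rewrite -e ltnn in le_mn.
Qed.

Lemma transition_comp n l m : (m <= l)%N -> (l <= n)%N ->
  transition l m \oc transition n l = transition n m.
Proof.
move=> le_ml; elim: n => [|n IH].
  rewrite leqn0 => /eqP l0; move: le_ml; rewrite l0 leqn0 => /eqP ->.
  by rewrite transition_id comp1m.
rewrite leq_eqVlt => /orP[/eqP ->|]; first by rewrite transition_id compm1.
rewrite ltnS => le_ln; rewrite !transitionS ?(leq_trans le_ml) //.
by rewrite compmA IH.
Qed.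

Lemma transition_epi n m : (m <= n)%N -> epi (transition n m).
Proof.
elim: n => [|n IH].
  rewrite leqn0 => /eqP ->; rewrite transition_id; exact: iso_epi (iso_id _).
rewrite leq_eqVlt => /orP[/eqP ->|].
  rewrite transition_id; exact: iso_epi (iso_id _).
rewrite ltnS => le_mn; rewrite transitionS //.
by apply: epi_comp; [exact: (IH le_mn)|exact: tower_epi].
Qed.

Lemma transition_pred n m : (m < n)%N -> p m \oc transition n m.+1 = transition n m.
Proof.
move=> lt_mn; rewrite -(transition_comp (leqnSn m) lt_mn) transitionS //.
by rewrite transition_id comp1m.
Qed.

Lemma transition_act n m (a : A) : (m <= n)%N ->
  transition n m \oc series_act n a = series_act m a \oc transition n m.
Proof.
elim: n => [|n IH].
  by rewrite leqn0 => /eqP ->; rewrite transition_id comp1m compm1.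
rewrite leq_eqVlt => /orP[/eqP ->|]; first by rewrite transition_id comp1m compm1.
rewrite ltnS => le_mn; rewrite transitionS //.
by rewrite -compmA series_act_proj compmA IH // -compmA.
Qed.

Lemma transition_top n m : (m <= n)%N -> top (E m) \oc transition n m = top (E n).
Proof.
elim: n => [|n IH].
  by rewrite leqn0 => /eqP ->; rewrite transition_id compm1.
rewrite leq_eqVlt => /orP[/eqP ->|]; first by rewrite transition_id compm1.
by rewrite ltnS => le_mn; rewrite transitionS // compmA IH // tower_top.
Qed.

(** Exactness of colim Hom(E_n, -): one step up the tower lifts along an
    epimorphism with kernel S, and the kernel B is peeled off one factor S at a
    time by [pushout_quotient_exact]. *)
Lemma tower_projective (B X Z : H) (i : hom B X) (q : hom X Z) n (h : hom (E n) Z) :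
  filtered (S : H) B -> short_exact i q ->
  exists m (u : hom (E m) X), (n <= m)%N /\ q \oc u = h \oc transition m n.
Proof.
have abH := nc_abelian H.
move=> fB; elim: fB X Z i q n h => {B} [B zB|B' B j r exj _ IH] X Z i q n h ex.
  have [g [qg gq]] : isomorphism q.
    apply: (mono_epi_iso abH) (se_epi ex); apply: mono0P => W v qv.
    by have [w <-] := se_lift ex qv; rewrite (zero_hom_to w zB) comp0r.
  by exists n, (g \oc h); rewrite transition_id compm1 compmA gq comp1m.
have [X' [i' [q' [m [ex' mi qm]]]]] := pushout_extension abH r ex.
have [u1 u1E] := tw_lift tw h ex'.
have ex2 := pushout_quotient_exact abH ex exj ex' mi qm.
have [l [u [le_nl mu]]] := IH _ _ _ _ _ u1 ex2.
exists l, u; split; first exact: ltnW.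
by rewrite -qm -compmA mu compmA u1E -compmA transition_pred.
Qed.

(** From the level [l] on, all maps E_n -> X factor through E_l, that is,
    Hom(E_l, X) is already the colimit. *)
Definition stable (X : H) l : Prop :=
  forall n, (l <= n)%N -> forall f : hom (E n.+1) X, f \oc soc (E n.+1) = 0.

Lemma exists_stable (X : H) : filtered (S : H) X -> exists l, stable X l.
Proof.
elim=> {X} [X zX|B X i q ex fB [l lP]].
  by exists 0%N => n _ f; exact: zero_hom_to.
have [m [w [_ qw]]] := tower_projective (top (E 0%N)) fB ex.
rewrite transition_top // in qw.
exists (maxn l m) => n; rewrite geq_max => /andP[le_ln le_mn] f.
have [c qf] := top_gen (q \oc f).
pose f' := w \oc (transition n m \oc (act (E n) c \oc p n)).
have f'E : f' = w \oc transition n.+1 m \oc act (E n.+1) c.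
  by rewrite /f' -tower_act transitionS // !compmA.
have [|g ig] := se_lift ex (g := f - f').
  rewrite compBr f'E !compmA qf qw transition_top ?(leqW le_mn) //.
  by rewrite top_act subrr.
have /eqP := congr1 (fun g => i \oc g) (lP n le_ln g).
rewrite compmA ig comp0r compBl subr_eq0 => /eqP ->.
by rewrite /f' -!compmA (se_comp0 (next_exact (tw_next tw n))) !comp0r.
Qed.

End Tower.

(** * Exactness and simplicity in categories of modules *)

Section Modules.
Variables (k : fieldType) (A : algType k).
Implicit Types M N L : lmodType A^c.

Lemma rmod_fun0 M N (f : rmod_hom M N) : rmod_fun f 0 = 0.
Proof. exact: linear0. Qed.

Lemma rmod_fun_linear M N (f : rmod_hom M N) : linear (rmod_fun f).
Proof. exact: linearP. Qed.

Lemma scale_linear M (m : M) : linear (fun a : (A^c)^o => (a : A^c) *: m).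
Proof. by move=> c a b; rewrite scalerDl scalerA. Qed.

Definition orbit_map M (m : M) : rmod_hom ((A^c)^o : lmodType A^c) M :=
  HB.pack_for {linear (A^c)^o -> M} (fun a : (A^c)^o => (a : A^c) *: m)
    (GRing.isLinear.Build _ _ _ _ _ (scale_linear m)).

Definition rmod_of_linear M N (f : M -> N) (f_lin : linear f) : rmod_hom M N :=
  HB.pack_for {linear M -> N} f (GRing.isLinear.Build _ _ _ _ _ f_lin).

(** An element is a map from the free module of rank one. *)
Lemma rmod_mono_inj M N (f : rmod_hom M N) : mono (C := rmod A) f ->
  forall m, rmod_fun f m = 0 -> m = 0.
Proof.
move=> mf m fm.
have f0 : (f : @hom k (rmod A) M N) \oc (orbit_map m : @hom k (rmod A) _ M) = 0.
  by apply: rmod_homP => a; rewrite /rmod_fun /= linearZ /= [f m]fm scaler0.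
have := mono_eq0 mf f0 => /(congr1 (fun g => rmod_fun g 1)).
by rewrite /rmod_fun /= scale1r.
Qed.

Lemma rmod_short_exact M N L (f : rmod_hom M N) (g : rmod_hom N L) :
  (forall m, rmod_fun f m = 0 -> m = 0) -> (forall l, exists n, rmod_fun g n = l) ->
  (forall m, rmod_fun g (rmod_fun f m) = 0) ->
  (forall n, rmod_fun g n = 0 -> exists m, rmod_fun f m = n) ->
  @short_exact k (rmod A) M N L f g.
Proof.
move=> f_inj g_surj gf gK.
have f_eq m m' : rmod_fun f m = rmod_fun f m' -> m = m'.
  move=> /eqP; rewrite -subr_eq0 -[_ - _](linearB (f : {linear M -> N})) => /eqP/f_inj/eqP.
  by rewrite subr_eq0 => /eqP.
split.
  apply: kernel_intro.
  - by apply: rmod_homP => m; exact: gf.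
  - apply: mono0P => Z h fh; apply: rmod_homP => z; apply: f_inj.
    by have /(congr1 (fun u => rmod_fun u z)) := fh.
  move=> Z h gh.
  have exh z : exists m, rmod_fun f m = rmod_fun h z.
    by apply: gK; have /(congr1 (fun u => rmod_fun u z)) := gh.
  pose u z := sval (cid (exh z)).
  have uE z : rmod_fun f (u z) = rmod_fun h z by exact: svalP (cid (exh z)).
  have u_lin : linear u.
    move=> a x y; apply: f_eq; rewrite uE !rmod_fun_linear !uE //.
  by exists (rmod_of_linear u_lin); apply: rmod_homP.
apply: cokernel_intro.
- by apply: rmod_homP => m; exact: gf.
- apply: epi0P => Z h hg; apply: rmod_homP => l; have [n <-] := g_surj l.
  by have /(congr1 (fun u => rmod_fun u n)) := hg.
move=> Z h hf.
pose v l := sval (cid (g_surj l)).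
have vE l : rmod_fun g (v l) = l by exact: svalP (cid (g_surj l)).
have hE n n' : rmod_fun g n = rmod_fun g n' -> rmod_fun h n = rmod_fun h n'.
  move=> /eqP; rewrite -subr_eq0 -[_ - _](linearB (g : {linear N -> L})) => /eqP/gK[m mE].
  have : rmod_fun h (n - n') = 0.
    by rewrite -mE; have /(congr1 (fun u => rmod_fun u m)) := hf.
  rewrite /rmod_fun linearB => /eqP; rewrite subr_eq0 => /eqP //.
have w_lin : linear (fun l => rmod_fun h (v l)).
  by move=> a x y; rewrite -rmod_fun_linear; apply: hE; rewrite rmod_fun_linear !vE.
exists (rmod_of_linear w_lin); apply: rmod_homP => n.
by apply: hE; rewrite vE.
Qed.

Lemma rmod_iso M N (f : rmod_hom M N) :
  (forall m, rmod_fun f m = 0 -> m = 0) -> (forall n, exists m, rmod_fun f m = n) ->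
  @isomorphism k (rmod A) M N f.
Proof.
move=> f_inj f_surj.
have f_eq m m' : rmod_fun f m = rmod_fun f m' -> m = m'.
  move=> /eqP; rewrite -subr_eq0 -[_ - _](linearB (f : {linear M -> N})) => /eqP/f_inj/eqP.
  by rewrite subr_eq0 => /eqP.
pose v n := sval (cid (f_surj n)).
have vE n : rmod_fun f (v n) = n by exact: svalP (cid (f_surj n)).
have v_lin : linear v by move=> a x y; apply: f_eq; rewrite rmod_fun_linear !vE.
exists (rmod_of_linear v_lin); split; apply: rmod_homP => x; last exact: vE.
by apply: f_eq; exact: vE.
Qed.

Lemma rmod_simple L : (exists l : L, l != 0) ->
  (forall l l' : L, l != 0 -> exists a : A^c, l' = a *: l) ->
  simple_object (L : rmod A).
Proof.
move=> [l0 l0n0] gen; split=> [zL|M f mf].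
  have /(congr1 (fun u => rmod_fun u l0)) : idm (L : rmod A) = 0 := zL.
  by move=> l00; case/eqP: l0n0.
have f_inj := rmod_mono_inj mf.
have [M0|/existsNP[m /eqP m0]] := pselect (forall m : M, m = 0).
  by left; apply: rmod_homP => m; exact: M0.
right; apply: rmod_iso => // l.
have fm0 : rmod_fun f m != 0 by apply: contra_neq m0 => /f_inj.
by have [a ->] := gen _ l fm0; exists (a *: m); rewrite /rmod_fun linearZ.
Qed.

Section Cyclic.
Variables (L : lmodType A^c) (l : L).

Definition cyclic_pred : {pred L} := fun x => `[< exists a : A^c, x = a *: l >].

Lemma cyclic_submod : submod_closed cyclic_pred.
Proof.
split=> [|a x y /asboolP[b ->] /asboolP[c ->]]; apply/asboolP.
  by exists 0; rewrite scale0r.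
by exists (a * b + c); rewrite scalerDl scalerA.
Qed.

HB.instance Definition _ := GRing.isSubmodClosed.Build A^c L cyclic_pred cyclic_submod.

Definition cyclic_submodule := {x : L | cyclic_pred x}.
HB.instance Definition _ := SubChoice.copy cyclic_submodule {x : L | cyclic_pred x}.
HB.instance Definition _ := [SubChoice_isSubLmodule of cyclic_submodule by <:].

Lemma simple_cyclic : simple_object (L : rmod A) -> l != 0 ->
  forall l' : L, exists a : A^c, l' = a *: l.
Proof.
move=> [_ sL] l0 l'.
have v_lin : linear (fun x : cyclic_submodule => val x).
  by move=> a x y; rewrite linearP.
pose M : rmod A := (cyclic_submodule : lmodType A^c).
have mv : mono (C := rmod A) (X := M) (rmod_of_linear v_lin).
  apply: mono0P => Z g vg; apply: rmod_homP => z; apply: val_inj.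
  by have /(congr1 (fun u => rmod_fun u z)) := vg.
have ll : cyclic_pred l by apply/asboolP; exists 1; rewrite scale1r.
have [M0|[g [_ vg]]] := sL _ _ mv.
  have /(congr1 (fun u => val (rmod_fun u (Sub l ll : cyclic_submodule)))) : idm M = 0 := M0.
  by rewrite /rmod_fun /= => l00; case/eqP: l0.
have /(congr1 (fun u => rmod_fun u l')) := vg.
rewrite /rmod_fun /= => <-.
by case: (g l') => x /= /asboolP.
Qed.

End Cyclic.

Lemma zero_rmod M : @zero_object k (rmod A) M <-> forall m : M, m = 0.
Proof.
split=> [M0 m|M0]; last by apply: rmod_homP => m; exact: M0.
by have /(congr1 (fun u => rmod_fun u m)) : idm (M : rmod A) = 0 := M0.
Qed.

Lemma rmod_exact_facts M N L (f : rmod_hom M N) (g : rmod_hom N L) :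
  @short_exact k (rmod A) M N L f g -> simple_object (L : rmod A) ->
  [/\ forall m, rmod_fun f m = 0 -> m = 0, forall l, exists n, rmod_fun g n = l,
    forall m, rmod_fun g (rmod_fun f m) = 0
    & forall n, rmod_fun g n = 0 -> exists m, rmod_fun f m = n].
Proof.
move=> ex sL; have gf := se_comp0 ex.
have gf0 m : rmod_fun g (rmod_fun f m) = 0.
  by have /(congr1 (fun u => rmod_fun u m)) := gf.
split=> // [|l|n gn]; first exact: rmod_mono_inj (se_mono ex).
  have [n gn0] : exists n, rmod_fun g n != 0.
    apply/not_existsP => g0; case: sL => L0 _; apply: L0.
    apply: (epi_eq0 (se_epi ex)); rewrite comp1m; apply: rmod_homP => n.
    by have /negP := g0 n; rewrite negbK => /eqP.
  have [a ->] := simple_cyclic sL gn0 l.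
  by exists (a *: n); rewrite /rmod_fun linearZ.
have gn0 : (g : @hom k (rmod A) N L) \oc (orbit_map n : @hom k (rmod A) _ N) = 0.
  by apply: rmod_homP => a; rewrite /rmod_fun /= linearZ /= [g n]gn scaler0.
have [h fh] := se_lift ex gn0.
exists (rmod_fun h 1); have /(congr1 (fun u => rmod_fun u 1)) := fh.
by rewrite /rmod_fun /= scale1r.
Qed.

Lemma simple_nonzero_elt L : simple_object (L : rmod A) -> exists l : L, l != 0.
Proof.
move=> [L0 _]; apply/not_existsP => l0; apply: L0; apply/zero_rmod => l.
by have /negP := l0 l; rewrite negbK => /eqP.
Qed.

End Modules.

(** * The fiber functor colim Hom(E_n, -) *)

Section Fiber.
Variables (k : fieldType) (H : nc_curve k).
Variables (S : simpleObj H) (s : {lrmorphism endo S -> endo S}).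
Variables (E : nat -> stage S) (p : forall n, hom (E n.+1) (E n)).
Variable t : forall n, hom (E n) (E n.+1).
Hypothesis tw : tower s p t.
Local Notation D := (endo S).
Local Notation A := (skew_series s).
Local Notation tr := (transition p).
Local Notation sact := (@series_act k H S s E p t).
Let abH := nc_abelian H.

Definition level (X : H) : nat :=
  if pselect (exists l, stable E X l) is left e then sval (cid e) else 0%N.

Lemma level_stable X : filtered (S : H) X -> stable E X (level X).
Proof.
move=> fX; rewrite /level; case: pselect => [e|[]]; first exact: svalP (cid e).
exact: exists_stable tw X fX.
Qed.

Section FiberModule.
Variable X : H.
Local Notation V := (hom (E (level X)) X).

(** The colimit of the spaces Hom(E_n, X), realised at a stable level if there is
    one. *)
Definition fiber_space : Type := V.
HB.instance Definition _ := GRing.Zmodule.copy fiber_space V.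

Definition fiber_scale (a : A^c) (z : fiber_space) : fiber_space := z \oc sact _ (a : A).

Fact fiber_scaleA a b z : fiber_scale a (fiber_scale b z) = fiber_scale (a * b) z.
Proof. by rewrite /fiber_scale -compmA -(series_actM tw). Qed.

Fact fiber_scale1 : left_id 1 fiber_scale.
Proof. by move=> z; rewrite /fiber_scale series_act1 compm1. Qed.

Fact fiber_scaleDr : right_distributive fiber_scale +%R.
Proof. by move=> a z z'; rewrite /fiber_scale compDl. Qed.

Fact fiber_scaleDl z : {morph fiber_scale^~ z : a b / a + b}.
Proof. by move=> a b; rewrite /fiber_scale (@series_actD k H S s E p t _ a b) compDr. Qed.

Definition fiber : lmodType A^c :=
  HB.pack_for (lmodType A^c) fiber_space (GRing.Zmodule_isLmodule.Build A^c fiber_space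
    fiber_scaleA fiber_scale1 fiber_scaleDr fiber_scaleDl).

(** The representative at level [n] of an element of the colimit. *)
Definition germ n (z : fiber) : hom (E n) X := (z : V) \oc tr n (level X).

Lemma germD n (z z' : fiber) : germ n (z + z') = germ n z + germ n z'.
Proof. exact: compDl. Qed.

Lemma germ0 n : germ n 0 = 0.
Proof. exact: comp0l. Qed.

Lemma germ_scale n (a : A) (z : fiber) : (level X <= n)%N ->
  germ n ((a : A^c) *: z) = germ n z \oc sact n a.
Proof.
move=> le_n; rewrite /germ -[_ *: _]/((z : V) \oc sact _ a).
by rewrite -!compmA (transition_act tw).
Qed.

Lemma germ_transition n m (z : fiber) : (level X <= m)%N -> (m <= n)%N ->
  germ n z = germ m z \oc tr n m.
Proof. by move=> le_m le_mn; rewrite /germ -compmA transition_comp. Qed.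

Lemma germ_inj n (z z' : fiber) : (level X <= n)%N -> germ n z = germ n z' -> z = z'.
Proof. by move=> le_n; apply: (transition_epi tw le_n). Qed.

Lemma germ_surj n (f : hom (E n) X) : filtered (S : H) X -> (level X <= n)%N ->
  exists z, germ n z = f.
Proof.
move=> fX; elim: n f => [|n IH] f.
  rewrite leqn0 => /eqP l0.
  have : exists z : hom (E (level X)) X, z \oc tr 0 (level X) = f.
    by rewrite l0; exists f; rewrite transition_id compm1.
  by move=> [z zf]; exists z.
rewrite leq_eqVlt => /orP[/eqP lE|].
  have : exists z : hom (E (level X)) X, z \oc tr n.+1 (level X) = f.
    by rewrite lE; exists f; rewrite transition_id compm1.
  by move=> [z zf]; exists z.
rewrite ltnS => le_n.
have [f' f'p] := se_desc (next_exact (tw_next tw n)) (level_stable fX le_n f).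
have [z zf'] := IH f' le_n; exists z.
by rewrite -f'p -zf' /germ transitionS // compmA.
Qed.

End FiberModule.

Section FiberMap.
Variables (X Y : H).
Hypothesis fY : filtered (S : H) Y.

Lemma fiber_map_exists (f : hom X Y) (z : fiber X) : exists z' : fiber Y,
  forall n, (level X <= n)%N -> (level Y <= n)%N -> germ n z' = f \oc germ n z.
Proof.
pose N := maxn (level X) (level Y).
have [z' z'E] := germ_surj (f \oc germ N z) fY (leq_maxr _ _).
exists z' => n leX leY.
have leN : (N <= n)%N by rewrite geq_max leX.
by rewrite !(germ_transition _ _ leN) ?leq_maxl ?leq_maxr // z'E compmA.
Qed.

Definition fiber_map (f : hom X Y) (z : fiber X) : fiber Y :=
  sval (cid (fiber_map_exists f z)).

Lemma germ_map (f : hom X Y) z n : (level X <= n)%N -> (level Y <= n)%N ->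
  germ n (fiber_map f z) = f \oc germ n z.
Proof. exact: (svalP (cid (fiber_map_exists f z))). Qed.

Lemma fiber_map_linear (f : hom X Y) : linear (fiber_map f).
Proof.
move=> a z z'; pose N := maxn (level X) (level Y).
have leX : (level X <= N)%N by exact: leq_maxl.
have leY : (level Y <= N)%N by exact: leq_maxr.
apply: (germ_inj leY); rewrite germ_map // !germD !germ_scale // !germ_map //.
by rewrite compDr compmA.
Qed.

Definition fiber_hom (f : hom X Y) : rmod_hom (fiber X) (fiber Y) :=
  HB.pack_for {linear fiber X -> fiber Y} (fiber_map f)
    (GRing.isLinear.Build _ _ _ _ _ (fiber_map_linear f)).

Lemma fiber_hom_linear : linear fiber_hom.
Proof.
move=> c f g; apply: rmod_homP => z; pose N := maxn (level X) (level Y).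
have leX : (level X <= N)%N by exact: leq_maxl.
have leY : (level Y <= N)%N by exact: leq_maxr.
apply: (germ_inj leY).
transitivity (germ N ((c%:A : A^c) *: fiber_map f z + fiber_map g z)); last by [].
rewrite /rmod_fun /= germ_map // germD germ_scale // !germ_map // compDl compZl.
have -> : sact N (c%:A : A) = c *: idm (E N).
  have := @series_act_linear k H S s E p t N c (1 : A) 0.
  rewrite !addr0 => ->; rewrite series_act1 (linear_at0 (@series_act_linear k H S s E p t N)).
  by rewrite addr0.
by rewrite compZr compm1.
Qed.

End FiberMap.

Lemma fiber_map_comp (X Y Z : H) (fY : filtered (S : H) Y) (fZ : filtered (S : H) Z)
    (g : hom Y Z) (f : hom X Y) z :
  fiber_map fZ (g \oc f) z = fiber_map fZ g (fiber_map fY f z).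
Proof.
pose N := maxn (level X) (maxn (level Y) (level Z)).
have leX : (level X <= N)%N by rewrite leq_max leqnn.
have leY : (level Y <= N)%N by rewrite !leq_max leqnn orbT.
have leZ : (level Z <= N)%N by rewrite !leq_max leqnn !orbT.
by apply: (germ_inj leZ); rewrite !germ_map // compmA.
Qed.

Lemma fiber_map_id (X : H) (fX : filtered (S : H) X) z :
  fiber_map fX (idm X) z = z.
Proof. by apply: (germ_inj (leqnn _)); rewrite germ_map // comp1m. Qed.

Section Filtration.
Variables (B X : H) (i : hom B X) (q : hom X S).
Hypotheses (ex : short_exact i q) (fB : filtered (S : H) B) (fX : filtered (S : H) X).

(** [w] lifts the top of the tower along X -> S. *)
Definition top_lift (w : fiber X) : Prop :=
  forall n, (level X <= n)%N -> q \oc germ n w = top (E n).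

Lemma exists_top_lift : exists w, top_lift w.
Proof.
have [m [u [_ qu]]] := tower_projective tw (top (E 0%N)) fB ex.
rewrite (transition_top tw) // in qu.
pose N := maxn m (level X).
have [w wE] := germ_surj (u \oc tr N m) fX (leq_maxr _ _).
exists w => n le_n; pose M := maxn n N.
apply: (transition_epi tw (leq_maxl n N)).
rewrite (transition_top tw) ?leq_maxl // -compmA -(germ_transition w le_n (leq_maxl n N)).
rewrite (germ_transition w (leq_maxr _ _) (leq_maxr n N)) wE -(compmA u).
rewrite transition_comp ?leq_maxl ?leq_maxr // compmA qu.
by rewrite (transition_top tw) // (leq_trans (leq_maxl _ _) (leq_maxr _ _)).
Qed.

Variable w : fiber X.
Hypothesis w_top : top_lift w.

(** A map E_n -> S is d times the top, so a map E_n -> X differs from w d by a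
    map into B. *)
Lemma fiber_decomp (z : fiber X) : exists (z' : fiber B) (d : D),
  z = fiber_map fX i z' + (skewC s d : A^c) *: w.
Proof.
pose N := maxn (level X) (level B).
have leX : (level X <= N)%N by exact: leq_maxl.
have leB : (level B <= N)%N by exact: leq_maxr.
have [d qz] := top_gen (q \oc germ N z).
have [|g ig] := se_lift ex (g := germ N z - germ N ((skewC s d : A^c) *: w)).
  by rewrite compBr qz germ_scale // compmA w_top // series_actC top_act subrr.
have [z' z'E] := germ_surj g fB leB.
exists z', d; apply: (germ_inj leX).
by rewrite germD germ_map // z'E ig subrK.
Qed.

Lemma fiber_decomp0 (z' : fiber B) (d : D) :
  fiber_map fX i z' + (skewC s d : A^c) *: w = 0 -> d = 0 /\ z' = 0.
Proof.
pose N := maxn (level X) (level B).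
have leX : (level X <= N)%N by exact: leq_maxl.
have leB : (level B <= N)%N by exact: leq_maxr.
move=> /(congr1 (@germ X N)); rewrite germ0 germD germ_map // germ_scale // series_actC => e.
have d0 : d = 0.
  have := congr1 (fun g => q \oc g) e.
  rewrite comp0r compDr (compmA q i) (se_comp0 ex) comp0l add0r.
  rewrite (compmA q (germ N w)) w_top // top_act.
  exact: (epi_eq0 (@top_epi _ _ _ (E N))).
split=> //; move: e; rewrite d0 linear0 comp0r addr0 => /(mono_eq0 (se_mono ex)) z0.
by apply: (germ_inj leB); rewrite z0 germ0.
Qed.

(** T maps into the kernel of the top, so w T has values in B.  Thus w and h
    form a morphism of extensions from E_n -> E_{n+1} -> S to B -> X -> S. *)
Lemma top_lift_shift : exists h : fiber B,
  (skewT s : A^c) *: w = fiber_map fX i h /\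
  forall n, (level X <= n)%N -> (level B <= n)%N -> germ n.+1 w \oc t n = i \oc germ n h.
Proof.
have key n : (level X <= n)%N -> q \oc (germ n.+1 w \oc t n) = 0.
  move=> leX; rewrite compmA w_top ?(leqW leX) //.
  by have [et _] := tw_shift tw n; rewrite (se_comp0 et).
pose N := maxn (level X) (level B).
have leX : (level X <= N)%N by exact: leq_maxl.
have leB : (level B <= N)%N by exact: leq_maxr.
have [g ig] := se_lift ex (key N leX).
have [h hE] := germ_surj g fB leB.
have Tw : (skewT s : A^c) *: w = fiber_map fX i h.
  apply: (@germ_inj X N.+1); first exact: leqW.
  rewrite germ_scale ?(leqW leX) // germ_map ?(leqW leX) ?(leqW leB) //.
  rewrite series_actT /= compmA -ig -hE -compmA; congr (_ \oc _).
  by rewrite /germ -compmA -transitionS.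
exists h; split=> // n leXn leBn; apply: (tower_epi tw).
have := congr1 (@germ X n.+1) Tw.
rewrite germ_scale ?(leqW leXn) // germ_map ?(leqW leXn) ?(leqW leBn) //.
rewrite series_actT /= compmA => ->; rewrite -compmA; congr (_ \oc _).
by rewrite /germ -compmA -transitionS.
Qed.

End Filtration.

(** By induction f vanishes on B, hence factors through the top of X; there it is
    detected by the lift w. *)
Lemma fiber_faithful (X Y : H) (fX : filtered (S : H) X) (fY : filtered (S : H) Y)
    (f : hom X Y) : (forall z, fiber_map fY f z = 0) -> f = 0.
Proof.
elim: fX f => {X} [X zX f _|B X i q ex fB IH f f0]; first exact: zero_hom_from.
have fX := filteredS ex fB.
have [|g gq] := se_desc ex (g := f).
  by apply: IH => z; rewrite (fiber_map_comp fX) f0.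
have [w w_top] := exists_top_lift ex fB fX.
pose N := maxn (level X) (level Y).
have leX : (level X <= N)%N by exact: leq_maxl.
have leY : (level Y <= N)%N by exact: leq_maxr.
suff g0 : g = 0 by rewrite -gq g0 comp0l.
apply: (epi_eq0 (@top_epi _ _ _ (E N))).
by rewrite -(w_top N leX) compmA gq -(germ_map fY) // f0 germ0.
Qed.

(** X is the push-out of T : E_n -> E_{n+1} along a map to B.  A linear map u is
    realised on B by induction, and on E_{n+1} by a representative of u(w);
    the two agree on E_n because u(w T) = u(w) T. *)
Lemma fiber_full (X Y : H) (fX : filtered (S : H) X) (fY : filtered (S : H) Y)
    (u : rmod_hom (fiber X) (fiber Y)) :
  exists f : hom X Y, forall z, fiber_map fY f z = rmod_fun u z.
Proof.
elim: fX u => {X} [X zX u|B X i q ex fB IH u].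
  have z0 (z : fiber X) : z = 0.
    by apply: (germ_inj (leqnn _)); rewrite germ0; apply: zero_hom_to.
  exists 0 => z; rewrite (z0 z) rmod_fun0.
  exact: (linear_at0 (fiber_map_linear fY 0)).
have fX := filteredS ex fB.
have ui_lin : linear (fun z => rmod_fun u (fiber_map fX i z)).
  by move=> a z z'; rewrite fiber_map_linear rmod_fun_linear.
have [f fE] := IH (rmod_of_linear ui_lin).
have [w w_top] := exists_top_lift ex fB fX.
have [h [Tw hE]] := top_lift_shift ex fB fX w_top.
pose v := rmod_fun u w.
pose N := maxn (level X) (maxn (level Y) (level B)).
have leX : (level X <= N)%N by rewrite leq_max leqnn.
have leY : (level Y <= N)%N by rewrite !leq_max leqnn orbT.
have leB : (level B <= N)%N by rewrite !leq_max leqnn !orbT.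
have fh : f \oc germ N h = germ N.+1 v \oc t N.
  apply: (tower_epi tw); rewrite -compmA.
  have -> : germ N h \oc p N = germ N.+1 h by rewrite /germ -compmA -transitionS.
  have := congr1 (@germ Y N.+1) (fE h).
  rewrite germ_map ?(leqW leB) ?(leqW leY) // => ->.
  rewrite -[rmod_fun _ h]/(rmod_fun u (fiber_map fX i h)) -Tw.
  rewrite /rmod_fun linearZ /= germ_scale ?(leqW leY) // series_actT /=.
  by rewrite compmA.
have [et _] := tw_shift tw N.
have [g [gi gw]] := pushout_universal abH et ex (hE N leX leB) (w_top _ (leqW leX)) fh.
exists g => z; have [z' [d ->]] := fiber_decomp ex fB fX w_top z.
have gv : fiber_map fY g w = v.
  by apply: (@germ_inj Y N.+1); rewrite ?germ_map ?(leqW leX) ?(leqW leY).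
rewrite addrC fiber_map_linear rmod_fun_linear gv; congr (_ + _).
by rewrite -(fiber_map_comp fX) gi fE.
Qed.

(** The functor maps the extension of S by B to a short exact sequence, and S to
    the simple module D. *)
Lemma fiber_finite_length (X : H) : filtered (S : H) X ->
  @finite_length k (rmod A) (fiber X).
Proof.
elim=> {X} [X zX|B X i q ex fB IH].
  apply: finite_length0; apply/zero_rmod => z.
  by apply: (germ_inj (leqnn _)); rewrite germ0; apply: zero_hom_to.
have fX := filteredS ex fB.
have [Z zZ] := has_zero abH.
have fS : filtered (S : H) S := filteredS (zero_exact S zZ) (filtered0 _ zZ).
have [w w_top] := exists_top_lift ex fB fX.
pose N := maxn (level X) (maxn (level S) (level B)).
have leX : (level X <= N)%N by rewrite leq_max leqnn.
have leS : (level S <= N)%N by rewrite !leq_max leqnn orbT.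
have leB : (level B <= N)%N by rewrite !leq_max leqnn !orbT.
pose v := fiber_map fS q w.
have germ_v : germ N v = top (E N) by rewrite germ_map // w_top.
have gen (l : fiber S) : exists d : D, l = (skewC s d : A^c) *: v.
  have [d dE] := top_gen (germ N l); exists d; apply: (germ_inj leS).
  by rewrite germ_scale // series_actC germ_v dE top_act.
apply: (@finite_lengthS k (rmod A) (fiber B) (fiber X) (fiber S)
  (fiber_hom fX i) (fiber_hom fS q)) => //.
  apply: rmod_short_exact.
  - move=> z iz; have [|_ //] := fiber_decomp0 ex (fX := fX) w_top (z' := z) (d := 0).
    rewrite (_ : skewC s 0 = 0) ?scale0r ?addr0; first exact: iz.
    by apply/funext; case.
  - move=> l; have [d ->] := gen l; exists ((skewC s d : A^c) *: w).
    by rewrite /rmod_fun linearZ.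
  - move=> z; apply: (germ_inj leS).
    by rewrite /rmod_fun /= !germ_map // compmA (se_comp0 ex) comp0l germ0.
  move=> z qz; have [|g ig] := se_lift ex (g := germ N z).
    by rewrite -(germ_map fS) //; move: qz; rewrite /rmod_fun /= => ->; rewrite germ0.
  have [z' z'E] := germ_surj g fB leB; exists z'.
  by apply: (germ_inj leX); rewrite /rmod_fun /= germ_map // z'E.
apply: rmod_simple; first exists v.
  apply/eqP => v0; have := germ_v; rewrite v0 germ0 => top0.
  by apply: (@top_neq0 _ _ _ (E N)).
move=> l l' l0; have [d lE] := gen l; have [d' l'E] := gen l'.
have d0 : d != 0.
  apply: contra_neq l0 => d0; rewrite lE d0.
  by rewrite (_ : skewC s 0 = 0) ?scale0r //; apply/funext; case.
have [g [_ dg]] := endo_division abH d0.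
exists (skewC s (g * d') : A^c); rewrite lE l'E scalerA; congr (_ *: _).
by rewrite -[RHS]/(skewC s d * skewC s (g * d')) skewCM mulrA dg mul1r.
Qed.

Section EssentialSurjectivity.
Hypothesis s_surj : forall d, exists d', s d' = d.

(** An element h of the fiber of B is made divisible by T in the push-out of
    T : E_n -> E_{n+1} along the map E_n -> B that represents h. *)
Lemma exists_fiber_extension (B : H) (fB : filtered (S : H) B) (h : fiber B) :
  exists (X : H) (i : hom B X) (q : hom X S) (fX : filtered (S : H) X) (w : fiber X),
    [/\ short_exact i q, top_lift q w & (skewT s : A^c) *: w = fiber_map fX i h].
Proof.
pose n := level B; have [et _] := tw_shift tw n.
have [X [i [q [m [ex mt qm]]]]] := pushout_extension abH (germ n h) et.
have fX := filteredS ex fB.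
pose N := maxn n.+1 (level X).
have leX : (level X <= N)%N by exact: leq_maxr.
have le_nN : (n < N)%N by exact: leq_maxl.
have leB : (level B <= N)%N by exact: ltnW.
have [w wE] := germ_surj (m \oc tr N n.+1) fX leX.
exists X, i, q, fX, w; split=> //.
  move=> l le_l; pose M := maxn l N.
  apply: (transition_epi tw (leq_maxl l N)).
  rewrite (transition_top tw) ?leq_maxl // -compmA -(germ_transition w le_l (leq_maxl l N)).
  rewrite (germ_transition w leX (leq_maxr l N)) wE !compmA qm.
  by rewrite !(transition_top tw) ?leq_maxr.
apply: (germ_inj leX); rewrite germ_scale // germ_map // wE -compmA.
rewrite (transition_act tw) // series_actT /= !compmA mt -!compmA.
by rewrite transition_pred // /germ -?compmA transition_comp // ltnW.
Qed.

(** If l T were nonzero it would generate the module, so l = l T a; but 1 - T a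
    is invertible. *)
Lemma simple_shift0 (L : lmodType A^c) : simple_object (L : rmod A) ->
  forall l : L, (skewT s : A^c) *: l = 0.
Proof.
move=> sL l; apply/eqP/negPn/negP => Tl0.
have l0 : l != 0 by apply: contra_neq Tl0 => ->; rewrite scaler0.
have [a lE] := simple_cyclic sL Tl0 l.
pose b : A := 1 - skewT s * (a : A).
have b0 : b 0%N = 1.
  by rewrite /b -[LHS]/((1 : A) 0%N - (skewT s * (a : A)) 0%N) skewT_mul subr0.
have [c bc] := skew_right_inverse b0.
have bl : (b : A^c) *: l = 0.
  rewrite -[b : A^c]/(1 - (a : A^c) * (skewT s : A^c)) scalerBl scale1r.
  by rewrite -scalerA -lE subrr.
have cb : (c : A^c) * (b : A^c) = 1 by exact: bc.
by case/eqP: l0; rewrite -(scale1r l) -cb -scalerA bl scaler0.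
Qed.

(** Let M be an extension of a simple module by M', and m a lift of a generator
    of the quotient.  Then m T lies in M', which is the fiber of some B.
    [exists_fiber_extension] provides X and w with w T = m T, and
    z' + w d |-> z' + m d is an isomorphism from the fiber of X to M. *)
Lemma fiber_essentially_surjective (M : rmod A) : finite_length M ->
  exists X (fX : filtered (S : H) X), isomorphic (fiber X : rmod A) M.
Proof.
elim=> {M} [M M0|M' M L f g exM _ [B [fB [kap ikap]]] sL].
  have [Z zZ] := has_zero abH.
  exists Z, (filtered0 _ zZ), 0; apply: rmod_iso => [z _|m].
    by apply: (germ_inj (leqnn _)); rewrite germ0; apply: zero_hom_to.
  by exists 0; have /zero_rmod M0' := M0; rewrite [RHS]M0' [LHS]M0'.
have [f_inj g_surj gf gK] := rmod_exact_facts exM sL.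
have [kap' [_ kk' k'k]] := iso_inv ikap.
have kK z : rmod_fun kap' (rmod_fun kap z) = z.
  by have /(congr1 (fun u => rmod_fun u z)) := kk'.
have Kk z : rmod_fun kap (rmod_fun kap' z) = z.
  by have /(congr1 (fun u => rmod_fun u z)) := k'k.
have [l0 l0n0] := simple_nonzero_elt sL.
have [m gm] := g_surj l0.
have [m' fm'] : exists m', rmod_fun f m' = (skewT s : A^c) *: m.
  by apply: gK; rewrite /rmod_fun linearZ /= [g m]gm simple_shift0.
have [X [i [q [fX [w [ex w_top Tw]]]]]] := exists_fiber_extension fB (rmod_fun kap' m').
pose fk z := rmod_fun f (rmod_fun kap z).
have fk_lin : linear fk by move=> a x y; rewrite /fk !rmod_fun_linear.
(* The graph of the isomorphism. *)
pose R (z : fiber X) (v : M) := exists z' d,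
  z = fiber_map fX i z' + (skewC s d : A^c) *: w /\ v = fk z' + (skewC s d : A^c) *: m.
have RT z : exists v, R z v.
  have [z' [d zE]] := fiber_decomp ex fB fX w_top z.
  by exists (fk z' + (skewC s d : A^c) *: m), z', d.
have sC0 : skewC s 0 = 0 by apply/funext; case.
have R0 v : R 0 v -> v = 0.
  move=> [z' [d [/esym zE ->]]]; have [-> ->] := fiber_decomp0 ex (fX := fX) w_top zE.
  by rewrite sC0 scale0r addr0 (linear_at0 fk_lin).
have scale_gen (b : A) : exists z' d, (b : A^c) *: w = fiber_map fX i z' + (skewC s d : A^c) *: w
    /\ (b : A^c) *: m = fk z' + (skewC s d : A^c) *: m.
  have [b' bE] := skew_decomp s_surj b.
  move: (b 0%N) bE => d bE.
  have bE' : (b : A^c) = (b' : A^c) * (skewT s : A^c) + (skewC s d : A^c).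
    by rewrite addrC; exact: bE.
  exists ((b' : A^c) *: rmod_fun kap' m'), d; rewrite bE' !scalerDl -!scalerA Tw.
  have iZ a z : fiber_map fX i (a *: z) = a *: fiber_map fX i z.
    by have := fiber_map_linear fX i a z 0; rewrite addr0 (linear_at0 (fiber_map_linear fX i)) addr0.
  have fkZ a z : fk (a *: z) = a *: fk z by rewrite /fk /rmod_fun !linearZ.
  by rewrite iZ fkZ /fk Kk fm'.
have R_lin a z1 v1 z2 v2 : R z1 v1 -> R z2 v2 -> R (a *: z1 + z2) (a *: v1 + v2).
  move=> [y1 [d1 [-> ->]]] [y2 [d2 [-> ->]]].
  have [y [d [bw bm]]] := scale_gen (skewC s d1 * (a : A)).
  have bw' : a *: ((skewC s d1 : A^c) *: w) = fiber_map fX i y + (skewC s d : A^c) *: w.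
    by rewrite scalerA -bw.
  have bm' : a *: ((skewC s d1 : A^c) *: m) = fk y + (skewC s d : A^c) *: m.
    by rewrite scalerA -bm.
  have sCD : (skewC s (d + d2) : A^c) = (skewC s d : A^c) + (skewC s d2 : A^c).
    by apply/funext; case=> //= n; rewrite -[RHS]/(0 + 0) addr0.
  exists (a *: y1 + y2 + y), (d + d2).
  have iD := fiber_map_linear fX i.
  have iD1 z z' : fiber_map fX i (z + z') = fiber_map fX i z + fiber_map fX i z'.
    by have := iD 1 z z'; rewrite !scale1r.
  have fkD1 z z' : fk (z + z') = fk z + fk z'.
    by have := fk_lin 1 z z'; rewrite !scale1r.
  rewrite iD1 fkD1 iD fk_lin !scalerDr bw' bm' sCD !scalerDl.
  by split; rewrite addrACA -!addrA.
pose th z := sval (cid (RT z)).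
have thR z : R z (th z) by exact: svalP (cid (RT z)).
have R_fun z v v' : R z v -> R z v' -> v = v'.
  move=> Rv Rv'; have := R_lin (-1) _ _ _ _ Rv Rv'.
  rewrite !scaleN1r addNr => /R0/eqP; rewrite addrC subr_eq0 => /eqP //.
have th_lin : linear th.
  by move=> a x y; apply: R_fun (thR _) _; apply: R_lin.
exists X, fX, (rmod_of_linear th_lin); apply: rmod_iso => [z thz|v].
  have [z' [d [zE e]]] := thR z; rewrite [th z]thz in e; rewrite zE.
  have d0 : d = 0.
    apply/eqP/negPn/negP => d0; have [d' [_ dd']] := endo_division abH d0.
    have := congr1 (rmod_fun g) e.
    rewrite rmod_fun0 addrC rmod_fun_linear gm /fk gf addr0.
    move=> /esym/(congr1 (fun l => (skewC s d' : A^c) *: l)); rewrite scaler0 scalerA.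
    rewrite -[(skewC s d' : A^c) * _]/(skewC s d * skewC s d') skewCM dd'.
    rewrite (_ : skewC s 1 = 1) ?scale1r; first by move=> l00; case/eqP: l0n0.
    by apply/funext; case.
  move: e; rewrite d0 sC0 !scale0r !addr0 => /esym/f_inj kz.
  by rewrite -(kK z') kz rmod_fun0 (linear_at0 (fiber_map_linear fX i)).
have [d dE] : exists d : D, rmod_fun g v = (skewC s d : A^c) *: l0.
  have [a aE] := simple_cyclic sL l0n0 (rmod_fun g v).
  exists ((a : A) 0%N); have [a' a'E] := skew_decomp s_surj (a : A).
  have aE' : a = (a' : A^c) * (skewT s : A^c) + (skewC s ((a : A) 0%N) : A^c).
    by rewrite addrC; exact: a'E.
  by rewrite aE {1}aE' scalerDl -scalerA simple_shift0 // scaler0 add0r.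
have [|v' fv'] := gK (v - (skewC s d : A^c) *: m).
  by move: dE; rewrite /rmod_fun linearB linearZ /= [g m]gm => ->; rewrite subrr.
exists (fiber_map fX i (rmod_fun kap' v') + (skewC s d : A^c) *: w).
apply: R_fun (thR _) _; exists (rmod_fun kap' v'), d; split=> //.
by rewrite /fk Kk fv' subrK.
Qed.

End EssentialSurjectivity.

End Fiber.

(** * The equivalence *)

Section FullyFaithful.
Variables (k : fieldType) (C D : lincat k) (F : linfunctor C D).
Hypothesis F_faithful : forall (X Y : C) (f : hom X Y), fmap F X Y f = 0 -> f = 0.
Hypothesis F_full : forall (X Y : C) (g : hom (F X) (F Y)), exists f, fmap F X Y f = g.
Hypothesis F_surj : forall Y : D, exists X : C, isomorphic (F X) Y.

Let inj (X Y : C) (f g : hom X Y) : fmap F X Y f = fmap F X Y g -> f = g.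
Proof.
move=> /eqP; rewrite -subr_eq0 -linearB => /eqP/F_faithful/eqP.
by rewrite subr_eq0 => /eqP.
Qed.

Let preim (X Y : C) (g : hom (F X) (F Y)) : hom X Y := sval (cid (F_full g)).

Let preimE (X Y : C) (g : hom (F X) (F Y)) : fmap F X Y (preim g) = g.
Proof. exact: svalP (cid (F_full g)). Qed.

Lemma fully_faithful_equivalent : equivalent C D.
Proof.
pose G (Y : D) : C := sval (cid (F_surj Y)).
pose e (Y : D) : hom (F (G Y)) Y := sval (cid (svalP (cid (F_surj Y)))).
have ie Y : isomorphism (e Y) := svalP (cid (svalP (cid (F_surj Y)))).
pose e' (Y : D) : hom Y (F (G Y)) := sval (cid (ie Y)).
have e'e Y : e' Y \oc e Y = idm _ := proj1 (svalP (cid (ie Y))).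
have ee' Y : e Y \oc e' Y = idm _ := proj2 (svalP (cid (ie Y))).
pose g (X Y : D) (f : hom X Y) : hom (G X) (G Y) := preim (e' Y \oc f \oc e X).
have g_lin X Y : linear (g X Y).
  move=> a u v; apply: inj; rewrite linearP /= !preimE.
  by rewrite compDr compDl compZr compZl.
pose gm X Y : {linear hom X Y -> hom (G X) (G Y)} :=
  HB.pack_for {linear hom X Y -> hom (G X) (G Y)} (g X Y)
    (GRing.isLinear.Build _ _ _ _ _ (g_lin X Y)).
have gm1 X : gm X X (idm X) = idm (G X).
  by apply: inj; rewrite /= preimE compm1 e'e fmap1.
have gmM X Y Z (u : hom Y Z) (v : hom X Y) : gm X Z (u \oc v) = gm Y Z u \oc gm X Y v.
  apply: inj; by rewrite fmapM /= !preimE !compmA -(compmA _ (e Y)) ee' compm1.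
exists F, (Linfunctor gm1 gmM); split.
  exists (fun X => preim (e (F X))); split=> [X|X Y f].
    exists (preim (e' (F X))).
    by split; apply: inj; rewrite fmapM !preimE fmap1 ?e'e ?ee'.
  apply: inj; rewrite !fmapM /= !preimE !compmA ee' comp1m //.
exists e; split=> // X Y f.
by rewrite /= preimE !compmA ee' comp1m.
Qed.

End FullyFaithful.

Section Twist.
Variables (k : fieldType) (H : nc_curve k) (S : simpleObj H).

Lemma twist_exists : isomorphic (nc_taui H S) S ->
  exists s : {lrmorphism endo S -> endo S}, induced_twist (nc_taui H) s.
Proof.
move=> [phi iphi]; have [psi [_ psiphi phipsi]] := iso_inv iphi.
pose s (f : endo S) : endo S := phi \oc fmap (nc_taui H) S S f \oc psi.
have s_lin : linear s.
  by move=> a u v; rewrite /s linearP /= compDr compZr compDl compZl.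
have s_mon : monoid_morphism s.
  split=> [|u v].
    by rewrite /s fmap1 compm1 phipsi.
  rewrite /s [RHS](_ : _ = s u \oc s v) // /s fmapM !compmA; congr (_ \oc _ \oc _).
  by rewrite -(compmA _ psi) psiphi compm1.
exists (HB.pack_for {lrmorphism endo S -> endo S} s
  (GRing.isLinear.Build _ _ _ _ _ s_lin)
  (GRing.isMonoidMorphism.Build _ _ s s_mon)).
exists phi; split=> // f /=.
by rewrite /s -compmA psiphi compm1.
Qed.

Lemma endomorphism_surjective (s : {lrmorphism endo S -> endo S}) :
  forall d, exists d', s d' = d.
Proof.
have fdS : finite_dim (endo S) := nc_hom_fd S S.
have [n [[v2r v2r_lin v2r_bij]]] := fdS.
apply: (fd_inj_surj v2r_lin v2r_bij) => [a x y|x sx]; first exact: linearP.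
apply/eqP/negPn/negP => /(endo_division (nc_abelian H))[y [_ xy]].
have := congr1 s xy; rewrite rmorphM rmorph1 /= sx mul0r => /esym/eqP.
by rewrite oner_eq0.
Qed.

End Twist.

Theorem theorem1p4 (k : fieldType) (k_perfect : perfect_field k)
    (H : nc_curve k) (x : nc_point H) (S : simpleObj H) (Sx : nc_tube x S) :
  (exists s : {lrmorphism endo S -> endo S}, induced_twist (nc_taui H) s) /\
  (forall s : {lrmorphism endo S -> endo S}, induced_twist (nc_taui H) s ->
     equivalent (fullsub (@nc_tube k H x)) (rmod_finlen (skew_series s))).
Proof.
split; first exact: twist_exists (taui_simple_isomorphic Sx).
move=> s twist; have [E [p [t tw]]] := tower_exists k_perfect twist.
have s_surj := endomorphism_surjective s.
have filt (X : fullsub (@nc_tube k H x)) : filtered (S : H) (sval X).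
  exact/(tube_filtered Sx)/(svalP X).
pose F (X : fullsub (@nc_tube k H x)) : rmod_finlen (skew_series s) :=
  exist _ (fiber tw (sval X)) (fiber_finite_length tw (filt X)).
pose m (X Y : fullsub (@nc_tube k H x)) : {linear hom X Y -> hom (F X) (F Y)} :=
  HB.pack_for {linear hom X Y -> hom (F X) (F Y)} (fiber_hom tw (X := sval X) (filt Y))
    (GRing.isLinear.Build _ _ _ _ _ (fiber_hom_linear tw (X := sval X) (filt Y))).
have m1 X : m X X (idm X) = idm (F X).
  by apply: rmod_homP => z; exact: fiber_map_id.
have mM X Y Z (g : hom Y Z) (f : hom X Y) : m X Z (g \oc f) = m Y Z g \oc m X Y f.
  by apply: rmod_homP => z; exact: fiber_map_comp.
apply: (@fully_faithful_equivalent _ _ _ (Linfunctor m1 mM)) => [X Y f mf|X Y g|[M finM]].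
- refine (fiber_faithful (tw := tw) (filt X) (fY := filt Y) (f := f) _) => z.
  by have /(congr1 (fun u => rmod_fun u z)) := mf.
- have [f fE] := fiber_full (filt X) (filt Y) g.
  by exists f; apply: rmod_homP => z; exact: fE.
have [X [fX [u iu]]] := fiber_essentially_surjective tw s_surj finM.
by exists (exist _ X (proj2 (tube_filtered Sx X) fX)), u.
Qed.
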